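(* Let $\Omega\subset\mathbb{R}^2$ be a bounded polygonal domain. For $u,v\in\mathscr{C}^\infty(\partial\Omega)$ define the Riesz potential $\mathscr{A}$ through the bilinear form $$\langle\mathscr{A}(u),v\rangle_{\partial\Omega}:=\int_{\partial\Omega}\int_{\partial\Omega}\frac{u(\mathbf{y})\,v(\mathbf{x})}{\sqrt{|\mathbf{x}-\mathbf{y}|}}\,d\sigma(\mathbf{x})\,d\sigma(\mathbf{y}).$$ Then $\mathscr{A}$ extends to a bounded linear operator from $\mathrm{L}^2(\partial\Omega)$ into $\mathrm{H}^{1/2}(\partial\Omega)$; that is, $$\sup_{u,v\in\mathscr{C}^\infty(\partial\Omega)\setminus\{0\}}\frac{|\langle\mathscr{A}(u),v\rangle_{\partial\Omega}|}{\|u\|_{\mathrm{L}^2(\partial\Omega)}\,\|v\|_{\mathrm{H}^{-1/2}(\partial\Omega)}}<+\infty.$$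
   Context: $\mathscr{C}^\infty(\partial\Omega):=\{\varphi|_{\partial\Omega}:\varphi\in\mathscr{C}^\infty(\mathbb{R}^2)\}$ and $d\sigma$ is arc-length measure. $\mathrm{H}^{1/2}(\partial\Omega)$ is the completion of $\mathscr{C}^\infty(\partial\Omega)$ for the norm $\|\varphi\|^2_{\mathrm{H}^{1/2}(\partial\Omega)}:=\|\varphi\|^2_{\mathrm{L}^2(\partial\Omega)}+\int_{\partial\Omega\times\partial\Omega}\frac{|\varphi(\mathbf{x})-\varphi(\mathbf{y})|^2}{|\mathbf{x}-\mathbf{y}|^2}\,d\mathbf{x}\,d\mathbf{y}$. $\mathrm{H}^{-1/2}(\partial\Omega)$ is the dual of $\mathrm{H}^{1/2}(\partial\Omega)$ (with respect to the $\mathrm{L}^2$ pairing $\langle\cdot,\cdot\rangle_{\partial\Omega}$), with norm $\|q\|_{\mathrm{H}^{-1/2}(\partial\Omega)}:=\sup_{w\neq0}|\langle q,w\rangle_{\partial\Omega}|/\|w\|_{\mathrm{H}^{1/2}(\partial\Omega)}$. *)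

(* Defs.v *)
From HB Require Import structures.
From mathcomp Require Import all_boot all_order all_algebra.
From mathcomp Require Import all_classical all_reals all_analysis.
Set Implicit Arguments. Unset Strict Implicit. Unset Printing Implicit Defensive.
Import Order.TTheory GRing.Theory Num.Theory.
Import numFieldNormedType.Exports.
Local Open Scope classical_set_scope.
Local Open Scope ring_scope.

Section Defs.
Variable R : realType.
Notation pt := (R * R)%type.

(** Euclidean distance in R^2 (the library norm on R*R is the max norm). *)
Definition edist (x y : pt) : R :=
  Num.sqrt ((x.1 - y.1) ^+ 2 + (x.2 - y.2) ^+ 2).

Fixpoint Ck (k : nat) (f : pt -> R) : Prop :=
  match k with
  | 0 => continuous f
  | k'.+1 => (forall x, differentiable f x) /\
             forall v : pt, Ck k' (fun x => 'D_v f x)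
  end.
Definition smooth (f : pt -> R) : Prop := forall k, Ck k f.

Definition bdry (O : set pt) : set pt := closure O `\` interior O.

Definition segment := (pt * pt)%type.
Definition gam (g : segment) (t : R) : pt :=
  (g.1.1 + t * (g.2.1 - g.1.1), g.1.2 + t * (g.2.2 - g.1.2)).
Definition seg_set (g : segment) : set pt := gam g @` `[0, 1].
Definition seg_len (g : segment) : R := edist g.1 g.2.

Definition boundary_decomp (O : set pt) (s : seq segment) : Prop :=
  [/\ bdry O = \bigcup_(g in [set g | g \in s]) seg_set g,
      uniq s,
      (forall g, g \in s -> g.1 <> g.2) &
      (forall g h, g \in s -> h \in s -> g <> h ->
         forall p q, seg_set g p -> seg_set h p ->
                     seg_set g q -> seg_set h q -> p = q)].

Definition polygonal_domain (O : set pt) (s : seq segment) : Prop :=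
  [/\ open O, connected O, bounded_set O & boundary_decomp O s].

Local Open Scope ereal_scope.
Notation mu := (@lebesgue_measure R).

Definition bint (s : seq segment) (f : pt -> R) : \bar R :=
  \sum_(g <- s) ((seg_len g)%:E *
     \int[mu]_(t in `[0%R, 1%R]) (f (gam g t))%:E).

Definition bint2 (s : seq segment) (K : pt -> pt -> R) : \bar R :=
  \sum_(h <- s) \sum_(g <- s) ((seg_len h)%:E * (seg_len g)%:E *
     \int[mu]_(r in `[0%R, 1%R]) \int[mu]_(t in `[0%R, 1%R])
        (K (gam h r) (gam g t))%:E).

Definition bpair (s : seq segment) (q w : pt -> R) : \bar R :=
  bint s (fun x => q x * w x)%R.

Definition L2norm (s : seq segment) (u : pt -> R) : \bar R :=
  sqrte (bint s (fun x => u x ^+ 2)%R).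

Definition H12norm (s : seq segment) (w : pt -> R) : \bar R :=
  sqrte (bint s (fun x => w x ^+ 2)%R +
         bint2 s (fun x y => (w x - w y) ^+ 2 / edist x y ^+ 2)%R).

Definition nonzero_on (O : set pt) (w : pt -> R) : Prop :=
  exists2 x, bdry O x & w x <> 0%R.

Definition Hm12norm (O : set pt) (s : seq segment) (q : pt -> R) : \bar R :=
  ereal_sup [set abse (bpair s q w) / H12norm s w |
             w in [set w | smooth w /\ nonzero_on O w]].

Definition riesz_form (s : seq segment) (u v : pt -> R) : \bar R :=
  bint2 s (fun y x => u y * v x / Num.sqrt (edist x y))%R.

End Defs.

(* Main.v *)
Require Import Defs.
From HB Require Import structures.
From mathcomp Require Import all_boot all_order all_algebra.
From mathcomp Require Import cyclic separable cyclotomic complex.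
From mathcomp Require Import all_classical all_reals all_analysis.
From mathcomp Require Import measurable_realfun ring lra zify.
(** By duality it suffices to approximate [A u] weakly by smooth functions [w] with
    [H12norm w <= C * L2norm u]. Truncating the binomial series of
    [rho^(-1/4) = M^(-1/4) (1 - (1 - rho/M))^(-1/4)] at [rho = |x - y|^2] gives polynomial
    kernels which increase to [|x - y|^(-1/2)], so that [w] is a polynomial; they are
    decreasing in the distance and satisfy size and slope estimates uniform in the truncation.

    The uniform [H^(1/2)] bound is first proved for sums over [n] equidistant points of every
    segment and passes to the limit as Riemann sums. For three points on one and the same
    segment the operator is a convolution and the bound is an instance of Parseval's identity:
    the Fourier transform of a decreasing kernel [k d <= A d^(-1/2)] is at most
    [C |b - 1|^(-1/2)] at the point [b] of the unit circle (Abel summation), while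
    [sum_h |b^h - 1|^2 / h^2 <= C |b - 1|]. All other triples of segments are either
    separated or meet at a corner [P], where the differences of the kernel are bounded by
    [d^(-1/2) / (|x - P| + |x' - P| + |y - P|)] and Schur's test applies. *)
Set Implicit Arguments. Unset Strict Implicit. Unset Printing Implicit Defensive.
Import Order.TTheory GRing.Theory Num.Theory.
Import numFieldNormedType.Exports.
Import Defs.
Local Open Scope ring_scope.

(** * Cauchy-Schwarz inequalities for finite sums *)

Section Sums.
Variable R : realType.
Implicit Types (n : nat).

(** The critical case is three points on one segment. With d = |x - y| and d' = |x' - y|, the bound
    d^(-1/2) / (d + d') gives up too much there: for a constant density it sums to |x - x'|^(-1/2),
    whose square diverges logarithmically at the diagonal. Oscillation must be used, and Parseval
    replaces Schur's test; near a corner the distances to [P] restore convergence. Estimates are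
    made in units of the mesh 1/n, where the kernel is cut off at the unit scale and the constants
    depend neither on n nor on the truncation order N. This asks for n >= [bker N r 0 ^+ 2], hence
    the order of limits: n -> oo with N and a regularisation e of |x - x'|^2 fixed, then e -> 0, and
    N -> oo only in the pairing with a fixed v. The polynomial form of the kernels matters twice: it
    makes w an admissible test function for the dual norm, and it makes the kernels separable, so
    that w and its Riemann sums lie in one finite-dimensional space and n -> oo concerns
    coefficients only. *)

Lemma cauchy_schwarz (I : finType) (a b : I -> R) :
  (\sum_i a i * b i) ^+ 2 <= (\sum_i a i ^+ 2) * (\sum_i b i ^+ 2).
Proof.
set A := \sum_i a i ^+ 2; set B := \sum_i b i ^+ 2; set S := \sum_i a i * b i.
have A0 : 0 <= A by apply: sumr_ge0 => i _; exact: sqr_ge0.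
have H (x y : R) : 0 <= x ^+ 2 * A + 2 * x * y * S + y ^+ 2 * B.
  have -> : x ^+ 2 * A + 2 * x * y * S + y ^+ 2 * B =
      \sum_i (x * a i + y * b i) ^+ 2.
    rewrite /A /B /S !mulr_sumr -!big_split /=; apply: eq_bigr => i _; ring.
  by apply: sumr_ge0 => i _; exact: sqr_ge0.
have [A00|A00] := eqVneq A 0.
  suff -> : S = 0 by rewrite expr0n mulr_ge0 ?A0 //; apply: sumr_ge0 => i _; exact: sqr_ge0.
  rewrite /S big1 // => i _.
  suff : a i ^+ 2 == 0 by rewrite sqrf_eq0 => /eqP ->; rewrite mul0r.
  have := A00; rewrite /A => /eqP; rewrite psumr_eq0; last by move=> j _; exact: sqr_ge0.
  by move=> /allP /(_ i); rewrite mem_index_enum => /(_ isT).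
have Agt : 0 < A by rewrite lt_def A00.
have := H (- S) A.
have -> : (- S) ^+ 2 * A + 2 * - S * A * S + A ^+ 2 * B = A * (A * B - S ^+ 2) by ring.
by rewrite pmulr_rge0 // subr_ge0.
Qed.

Lemma sum_sqr_le (I : finType) (a : I -> R) :
  (\sum_i a i) ^+ 2 <= #|I|%:R * \sum_i a i ^+ 2.
Proof.
have := cauchy_schwarz (fun _ : I => 1) a.
under eq_bigr do rewrite mul1r.
by under [in X in _ <= X -> _]eq_bigr do rewrite expr1n; rewrite sumr_const.
Qed.

End Sums.

(** * Discrete Parseval identity *)

Section Parseval.
Variable R : realType.
Notation C := R[i].

(** The modulus of R[i] takes values in R[i]; [nrm] is its real part, so that estimates are
    inequalities in R. *)
Definition nrm (z : C) : R := complex.Re `|z|.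

Lemma nrmE z : `|z| = (nrm z)%:C%C.
Proof. by rewrite /nrm RRe_real // normr_real. Qed.

Lemma nrm_ge0 z : 0 <= nrm z.
Proof. by rewrite -lecR -nrmE normr_ge0. Qed.

Lemma nrmM z w : nrm (z * w) = nrm z * nrm w.
Proof. by apply: complexI; rewrite rmorphM -!nrmE normrM. Qed.

Lemma nrmX z n : nrm (z ^+ n) = nrm z ^+ n.
Proof. by apply: complexI; rewrite rmorphXn -!nrmE normrX. Qed.

Lemma nrmN z : nrm (- z) = nrm z.
Proof. by rewrite /nrm normrN. Qed.

Lemma nrmD z w : nrm (z + w) <= nrm z + nrm w.
Proof. by rewrite -lecR rmorphD -!nrmE ler_normD. Qed.

Lemma nrmB z w : nrm (z - w) <= nrm z + nrm w.
Proof. by rewrite -(nrmN w) nrmD. Qed.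

Lemma nrm_sum (I : Type) (r : seq I) (P : pred I) (F : I -> C) :
  nrm (\sum_(i <- r | P i) F i) <= \sum_(i <- r | P i) nrm (F i).
Proof.
rewrite -lecR -nrmE (le_trans (ler_norm_sum _ _ _)) // rmorph_sum /=.
by apply: ler_sum => i _; rewrite nrmE.
Qed.

Lemma nrm_real (x : R) : nrm x%:C%C = `|x|.
Proof. by apply: complexI; rewrite -nrmE normc_def expr0n addr0 sqrtr_sqr. Qed.

Lemma nrm0_eq0 z : nrm z = 0 -> z = 0.
Proof. by move=> z0; apply/eqP; rewrite -normr_eq0 nrmE z0. Qed.

(** Over the algebraically closed field R[i] the polynomial X^N - 1 splits, and it is separable in
    characteristic 0; among N distinct N-th roots of unity one is primitive. *)
Lemma prim_root_exists N : (0 < N)%N -> exists z : C, N.-primitive_root z.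
Proof.
move=> N0; have [r Dp] := closed_field_poly_normal ('X^N - 1 : {poly C}).
move: Dp; rewrite lead_coefXnsubC // scale1r => Dp.
have rn1 : all N.-unity_root r.
  by apply/allP=> z; rewrite -root_prod_XsubC -Dp.
have sz_r : (N <= size r)%N.
  by rewrite -ltnS -(size_prod_XsubC r id) -Dp size_XnsubC.
have [|z] := hasP (has_prim_root N0 rn1 _ sz_r); last by exists z.
have N1 : (N%:R : C) != 0 by rewrite pnatr_eq0 -lt0n.
by rewrite -separable_prod_XsubC -Dp separable_Xn_sub_1.
Qed.

Lemma sum_root_of_unity (N : nat) (y : C) : y ^+ N = 1 -> y != 1 ->
  \sum_(b < N) y ^+ b = 0.
Proof.
move=> yN y1; have := subrX1 y N; rewrite yN subrr => /esym /eqP.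
by rewrite mulf_eq0 subr_eq0 (negbTE y1) => /eqP.
Qed.

Definition ceval (p : {poly R}) (x : C) : C := (map_poly (real_complex R) p).[x].

Lemma nrm_sqr z : (nrm z ^+ 2)%:C%C = z * z^*.
Proof. by rewrite rmorphXn /= -nrmE normCK. Qed.

Lemma ceval_sum (p : {poly R}) N x : (size p <= N)%N ->
  ceval p x = \sum_(i < N) (p`_i)%:C%C * x ^+ i.
Proof.
move=> sp; rewrite /ceval (@horner_coef_wide _ N); last first.
  by rewrite (leq_trans (size_poly _ _)).
by apply: eq_bigr => i _; rewrite coef_map.
Qed.

Lemma nrm_unit (N : nat) (z : C) : (0 < N)%N -> z ^+ N = 1 -> nrm z = 1.
Proof.
move=> N0 zN; have : nrm z ^+ N = 1 by rewrite -nrmX zN -[1]/(1%:C%C) nrm_real normr1.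
by move/eqP; rewrite pexpr_eq1 ?nrm_ge0 // => /eqP.
Qed.

(** Orthogonality of the characters b -> z^(b (i - j)). The bound on the size keeps the exponents
    distinct modulo N. *)
Lemma parseval (N : nat) (z : C) (p : {poly R}) : N.-primitive_root z ->
  (size p <= N)%N ->
  \sum_(b < N) nrm (ceval p (z ^+ b)) ^+ 2 = N%:R * \sum_(i < N) p`_i ^+ 2.
Proof.
move=> zN sp; have N0 := prim_order_gt0 zN.
have zz : z * z^* = 1.
  by rewrite -nrm_sqr (nrm_unit N0 (prim_expr_order zN)) expr1n.
apply: complexI; rewrite rmorph_sum rmorphM rmorph_sum /=.
under eq_bigr => b _ do rewrite nrm_sqr (ceval_sum _ sp) rmorph_sum mulr_suml.
rewrite exchange_big mulr_sumr /=; apply: eq_bigr => i _.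
under eq_bigr => b _ do rewrite mulr_sumr.
rewrite exchange_big (bigD1 i) //= [X in _ + X]big1 ?addr0; last first.
  move=> j ji; rewrite (eq_bigr (fun b : 'I_N =>
     ((p`_i)%:C%C * (p`_j)%:C%C^*) * (z ^+ i * z^* ^+ j) ^+ b)); last first.
    move=> b _; rewrite rmorphM rmorphXn rmorphXn exprMn -!exprM mulrACA.
    by rewrite (mulnC b i) (mulnC b j).
  rewrite -mulr_sumr sum_root_of_unity ?mulr0 //.
    rewrite exprMn -!exprM (mulnC i) (mulnC j) !exprM -rmorphXn (prim_expr_order zN).
    by rewrite rmorph1 !expr1n mulr1.
  apply: contra ji => /eqP zij.
  have : z ^+ i = z ^+ j.
    by rewrite -[LHS]mulr1 -(expr1n _ j) -zz exprMn mulrCA zij mulr1.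
  by move/eqP; rewrite (eq_prim_root_expr zN) !modn_small // eq_sym.
rewrite (eq_bigr (fun=> ((p`_i) ^+ 2)%:C%C)); last first.
  move=> b _; rewrite rmorphM !rmorphXn mulrACA -!exprMn zz !expr1n mulr1.
  by rewrite /= conj_Creal ?rmorphXn ?expr2 ?rmorphM // complex_real.
by rewrite sumr_const card_ord rmorph_nat mulr_natl.
Qed.

End Parseval.

(** * Energy of a discrete convolution with a decreasing kernel *)

Section ConvolutionEnergy.
Variable R : realType.
Notation C := R[i].

(** Summation by parts: x^l (x - 1) is a difference of consecutive powers, and the decrements of [k]
    are nonnegative and telescope. *)
Lemma abel_bound (k : nat -> R) (x : C) (m n : nat) :
  (forall l, 0 <= k l) -> (forall l, k l.+1 <= k l) -> nrm x = 1 -> (m <= n)%N ->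
  nrm (\sum_(m <= l < n) (k l)%:C%C * x ^+ l) * nrm (x - 1) <= 2 * k m.
Proof.
move=> k0 kd x1 mn; rewrite -nrmM mulr_suml.
have -> : \sum_(m <= l < n) (k l)%:C%C * x ^+ l * (x - 1) =
          \sum_(m <= l < n) (k l)%:C%C * (x ^+ l.+1 - x ^+ l).
  by apply: eq_bigr => l _; rewrite exprS; ring.
have nk l j : nrm ((k l)%:C%C * x ^+ j) = k l.
  by rewrite nrmM nrmX x1 expr1n mulr1 nrm_real ger0_norm.
pose S j := \sum_(m <= l < j) (k l)%:C%C * (x ^+ l.+1 - x ^+ l).
(* Keeping the boundary term at [n] on both sides makes the bound inductive. *)
suff H : nrm (S n - (k n)%:C%C * x ^+ n) <= 2 * k m - k n.
  have := nrmD (S n - (k n)%:C%C * x ^+ n) ((k n)%:C%C * x ^+ n).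
  by rewrite subrK nk; move: H; rewrite -/(S n); lra.
elim: n mn => [|n IH].
  by rewrite leqn0 => /eqP ->; rewrite /S big_geq // sub0r nrmN nk; lra.
rewrite leq_eqVlt => /orP[/eqP <-|mn].
  by rewrite /S big_geq // sub0r nrmN nk; lra.
have -> : S n.+1 - (k n.+1)%:C%C * x ^+ n.+1 =
   (S n - (k n)%:C%C * x ^+ n) + (k n - k n.+1)%:C%C * x ^+ n.+1.
  by rewrite /S big_nat_recr //= rmorphB /=; ring.
apply: le_trans (nrmD _ _) _; rewrite nrmM nrmX x1 expr1n mulr1 nrm_real.
by rewrite ger0_norm ?subr_ge0 //; have := IH mn; lra.
Qed.

Lemma sum_inv_sqrt (m : nat) :
  \sum_(l < m) (Num.sqrt (1 + l%:R) : R)^-1 <= 2 * Num.sqrt m%:R.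
Proof.
elim: m => [|m IH]; first by rewrite big_ord0 mulr_ge0 ?sqrtr_ge0.
rewrite big_ord_recr /= -(natr1 m).
set a : R := Num.sqrt m%:R in IH *; rewrite [1 + m%:R]addrC.
set b : R := Num.sqrt (m%:R + 1).
have a0 : 0 <= a by exact: sqrtr_ge0.
have b0 : 0 < b by rewrite sqrtr_gt0 ltr_wpDl ?ler0n.
have ab : b ^+ 2 = a ^+ 2 + 1 by rewrite !sqr_sqrtr ?addr_ge0 ?ler0n.
have H : b^-1 <= 2 * b - 2 * a.
  rewrite -[leLHS]mul1r ler_pdivrMr //.
  have : 0 <= (b - a) ^+ 2 by exact: sqr_ge0.
  by nra.
by lra.
Qed.

(** Telescoping at half-integers: 1 / h^2 <= 4 / (4 h^2 - 1) = 2 / (2 h - 1) - 2 / (2 h + 1). *)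
Lemma sum_inv_sqr (m n : nat) : (0 < m)%N -> (m <= n)%N ->
  \sum_(m <= h < n) (h%:R ^+ 2 : R)^-1 <= 2 / m%:R.
Proof.
move=> m0 mn.
suff H : \sum_(m <= h < n) (h%:R ^+ 2 : R)^-1 <= 2 / (2 * m%:R - 1) - 2 / (2 * n%:R - 1).
  apply: le_trans H _; have m1 : 1 <= m%:R :> R by rewrite ler1n.
  have n1 : 1 <= n%:R :> R by rewrite ler1n (leq_trans m0).
  have : 0 <= 2 / (2 * n%:R - 1) :> R by rewrite divr_ge0 //; lra.
  suff : 2 / (2 * m%:R - 1) <= 2 / m%:R :> R by lra.
  by rewrite ler_pM2l ?ltr0n // lef_pV2 ?posrE; lra.
elim: n mn => [|n IH]; first by move: m0; case: m.
rewrite leq_eqVlt => /orP[/eqP <-|mn]; first by rewrite big_geq // subrr.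
rewrite big_nat_recr //=; have := IH mn.
have n1 : 1 <= n%:R :> R by rewrite ler1n (leq_trans m0).
suff : (n%:R ^+ 2)^-1 <= 2 / (2 * n%:R - 1) - 2 / (2 * n.+1%:R - 1) :> R by lra.
rewrite -(natr1 n); set t : R := n%:R in n1 *.
have -> : 2 / (2 * t - 1) - 2 / (2 * (t + 1) - 1) = 4 / (4 * t ^+ 2 - 1).
  by field; apply/and3P; split; apply/eqP; nra.
rewrite -[leLHS]mul1r ler_pdivlMr; last by nra.
rewrite mulrAC ler_pdivrMr; last by nra.
by lra.
Qed.

(** The sum is cut at m = floor (1 / |x - 1|): the head is bounded termwise by 2 A sqrt m, the tail
    by summation by parts, and both are of size |x - 1|^(-1/2). *)
Lemma fourier_bound (k : nat -> R) (A : R) (x : C) (n : nat) :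
  0 <= A -> (forall l, 0 <= k l) -> (forall l, k l.+1 <= k l) ->
  (forall l, k l * Num.sqrt (1 + l%:R) <= A) -> nrm x = 1 -> x != 1 ->
  nrm (\sum_(l < n) (k l)%:C%C * x ^+ l) * Num.sqrt (nrm (x - 1)) <= 4 * A.
Proof.
move=> A0 k0 kd kA x1 xn1; set a := nrm (x - 1); set s := Num.sqrt a.
have a0 : 0 < a.
  rewrite lt_def nrm_ge0 andbT; apply: contra xn1 => /eqP /nrm0_eq0 /eqP.
  by rewrite subr_eq0.
have s0 : 0 < s by rewrite sqrtr_gt0.
have ss : s ^+ 2 = a by rewrite sqr_sqrtr // ltW.
have kA' l : k l <= A * (Num.sqrt (1 + l%:R))^-1.
  by rewrite ler_pdivlMr // sqrtr_gt0 ltr_wpDr ?ler0n.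
have hd m : m%:R <= a^-1 -> (\sum_(l < m) k l) * s <= 2 * A.
  move=> ma; have ms : Num.sqrt m%:R * s <= 1.
    rewrite -sqrtrM ?ler0n // -[leRHS]sqrtr1 ler_wsqrtr //.
    by rewrite -ler_pdivlMr // mul1r.
  have : \sum_(l < m) k l <= A * (2 * Num.sqrt m%:R).
    apply: le_trans (ler_wpM2l A0 (sum_inv_sqrt m)); rewrite mulr_sumr.
    by apply: ler_sum => l _.
  move=> /(ler_wpM2r (ltW s0)) /le_trans; apply.
  by rewrite -!mulrA (mulrCA A) ler_wpM2l // ler_piMr.
have nk (r : seq nat) : nrm (\sum_(l <- r) (k l)%:C%C * x ^+ l) <= \sum_(l <- r) k l.
  apply: le_trans (nrm_sum _ _ _) _; apply: ler_sum => l _.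
  by rewrite nrmM nrmX x1 expr1n mulr1 nrm_real ger0_norm.
rewrite -(big_mkord xpredT (fun l => (k l)%:C%C * x ^+ l)).
set m := Num.truncn a^-1.
have /andP[m1 m2] : m%:R <= a^-1 < m.+1%:R.
  by apply: truncn_itv; rewrite invr_ge0 ltW.
have [nm|mn] := leqP n m.
  have := hd n; rewrite -(big_mkord xpredT k) => /(_ _) H.
  apply: le_trans (ler_wpM2r (ltW s0) (nk _)) _.
  by apply: le_trans (H _) _; rewrite ?(le_trans _ m1) ?ler_nat //; lra.
rewrite (big_cat_nat (n := m)) //=; last exact: ltnW.
apply: le_trans (ler_wpM2r (ltW s0) (nrmD _ _)) _; rewrite mulrDl.
have -> : 4 * A = 2 * A + 2 * A by ring.
apply: lerD.
  apply: le_trans (ler_wpM2r (ltW s0) (nk _)) _.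
  by rewrite big_mkord; exact: hd.
rewrite -(ler_pM2r s0) -mulrA -expr2 ss.
apply: le_trans (abel_bound k0 kd x1 (ltnW mn)) _.
rewrite -mulrA ler_wpM2l //; apply: le_trans (kA' m) _.
rewrite ler_wpM2l // -[leLHS]mul1r ler_pdivrMr ?sqrtr_gt0 ?ltr_wpDr ?ler0n //.
rewrite -sqrtrM ?(ltW a0) // -[leLHS]sqrtr1 ler_wsqrtr // [1 + _]addrC natr1.
by rewrite mulrC -ler_pdivrMr // mul1r ltW.
Qed.

(** The same cut: |x^h - 1| <= h |x - 1| for h up to 1 / |x - 1|, where the sum is at most |x - 1|;
    beyond, |x^h - 1| <= 2 leaves a tail of 4 / h^2, at most 8 |x - 1|. *)
Lemma sum_root_increments (x : C) (n : nat) : nrm x = 1 ->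
  \sum_(1 <= h < n) nrm (x ^+ h - 1) ^+ 2 / h%:R ^+ 2 <= 10 * nrm (x - 1).
Proof.
move=> x1; set a := nrm (x - 1).
have nX h : nrm (x ^+ h) = 1 by rewrite nrmX x1 expr1n.
have n1 : nrm (1 : C) = 1 by rewrite -(expr0 x) nX.
have b2 h : nrm (x ^+ h - 1) <= 2.
  by apply: le_trans (nrmB _ _) _; rewrite nX n1.
have bh h : nrm (x ^+ h - 1) <= h%:R * a.
  rewrite subrX1 nrmM mulrC ler_wpM2r ?nrm_ge0 //.
  apply: le_trans (nrm_sum _ _ _) _; under eq_bigr do rewrite nX.
  by rewrite sumr_const card_ord.
have [a0|a0] := eqVneq a 0.
  rewrite a0 mulr0 big1 // => h _; have := bh h; rewrite a0 mulr0 => hh.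
  have /eqP -> : nrm (x ^+ h - 1) == 0 by rewrite eq_le hh nrm_ge0.
  by rewrite expr0n mul0r.
have ap : 0 < a by rewrite lt_def a0 nrm_ge0.
have T1 h : (0 < h)%N -> nrm (x ^+ h - 1) ^+ 2 / h%:R ^+ 2 <= a ^+ 2.
  move=> h0; rewrite ler_pdivrMr ?exprn_gt0 ?ltr0n // -exprMn mulrC.
  by rewrite ler_sqr ?nnegrE ?nrm_ge0 ?mulr_ge0 ?nrm_ge0.
have T2 h : nrm (x ^+ h - 1) ^+ 2 / h%:R ^+ 2 <= 4 * (h%:R ^+ 2)^-1.
  rewrite ler_wpM2r ?invr_ge0 ?exprn_ge0 //.
  have -> : 4 = 2 ^+ 2 :> R by rewrite -natrX.
  by rewrite ler_sqr ?nnegrE ?nrm_ge0.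
set m := Num.truncn a^-1.
have /andP[m1 m2] : m%:R <= a^-1 < m.+1%:R.
  by apply: truncn_itv; rewrite invr_ge0 ltW.
have hd l : (l <= m)%N -> \sum_(1 <= h < l.+1) nrm (x ^+ h - 1) ^+ 2 / h%:R ^+ 2 <= a.
  move=> lm; apply: (@le_trans _ _ (\sum_(1 <= h < l.+1) a ^+ 2)).
    by apply: ler_sum_nat => h /andP[h0 _]; exact: T1.
  rewrite sumr_const_nat subn1 /= -mulr_natr expr2 -mulrA ler_piMr ?(ltW ap) //.
  by rewrite mulrC -ler_pdivlMr // mul1r (le_trans _ m1) // ler_nat.
case: n => [|n]; first by rewrite big_geq // mulr_ge0 // ltW.
have [nm|mn] := leqP n m; first by apply: le_trans (hd n nm) _; lra.
rewrite (big_cat_nat (n := m.+1)) //=; last exact: ltnW.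
have : \sum_(m.+1 <= h < n.+1) nrm (x ^+ h - 1) ^+ 2 / h%:R ^+ 2 <= 8 * a.
  apply: (@le_trans _ _ (4 * \sum_(m.+1 <= h < n.+1) (h%:R ^+ 2)^-1)).
    by rewrite mulr_sumr; apply: ler_sum => h _.
  have -> : 8 * a = 4 * (2 * a) by ring.
  rewrite ler_wpM2l //; apply: le_trans (@sum_inv_sqr m.+1 n.+1 _ (ltnW mn)) _ => //.
  by rewrite ler_wpM2l // -[a]invrK lef_pV2 ?posrE ?invr_gt0 ?ltr0n // ltW.
by have := hd m (leqnn _); lra.
Qed.
Definition dn (i j : nat) : nat := (i - j + (j - i))%N.

Lemma dnC i j : dn i j = dn j i. Proof. by rewrite /dn addnC. Qed.

Definition conv (k u : nat -> R) (n i : nat) : R := \sum_(j < n) k (dn i j) * u j.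

(** Used in [ceval_kpoly_bound]: each one-sided sum costs 4 A, and the doubly counted coefficient e
    = k 0 <= A costs 2 A because s = sqrt |x - 1| <= 2. *)
Lemma fourier_bound_arith (a b c d e s A : R) :
  0 <= s -> s <= 2 -> 0 <= e -> e <= A -> a <= b + c -> d <= a + e ->
  c * s <= 4 * A -> b * s <= 4 * A -> d * s <= 10 * A.
Proof.
move=> s0 s2 e0 eA h1 h2 h3 h4.
apply: (@le_trans _ _ (b * s + c * s + A * 2)); last by lra.
apply: (@le_trans _ _ ((b + c + e) * s)); first by rewrite ler_wpM2r //; lra.
by rewrite !mulrDl lerD2l ler_pM.
Qed.

Section SymmetricKernel.
Variables (k : nat -> R) (p : nat).

(** The even sequence k |l| for |l| <= p, shifted by p to nonnegative exponents. *)
Definition kpoly : {poly R} := \poly_(i < p + p.+1) k (dn i p).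
Definition upoly (u : nat -> R) : {poly R} := \poly_(i < p.+1) u i.

Lemma ceval_kpoly (x : C) : nrm x = 1 ->
  ceval kpoly x = x ^+ p * (\sum_(l < p.+1) (k l)%:C%C * x ^+ l
     + \sum_(l < p.+1) (k l)%:C%C * x^-1 ^+ l - (k 0)%:C%C).
Proof.
move=> x1; have x0 : x != 0.
  apply/eqP => x0; move: x1; rewrite x0 -[0]/(0%:C%C) nrm_real normr0 => /eqP.
  by rewrite eq_sym oner_eq0.
rewrite (@ceval_sum _ _ (p + p.+1)) ?size_poly // big_split_ord /=.
have -> : \sum_(i < p) (kpoly`_i)%:C%C * x ^+ i =
  x ^+ p * (\sum_(l < p.+1) (k l)%:C%C * x^-1 ^+ l - (k 0)%:C%C).
  rewrite big_ord_recl /= expr0 mulr1 addrAC subrr add0r mulr_sumr.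
  rewrite (reindex_inj rev_ord_inj) /=; apply: eq_bigr => i _.
  rewrite coef_poly; have -> : (p - i.+1 < p + p.+1)%N by lia.
  have -> : dn (p - i.+1) p = i.+1 by rewrite /dn; have := ltn_ord i; lia.
  have -> : x ^+ p = x ^+ (p - i.+1) * x ^+ i.+1.
    by rewrite -exprD subnK.
  by rewrite /bump /= add1n mulrCA -mulrA -exprMn divff // expr1n mulr1.
suff -> : \sum_(i < p.+1) (kpoly`_(p + i))%:C%C * x ^+ (p + i) =
  x ^+ p * \sum_(l < p.+1) (k l)%:C%C * x ^+ l by ring.
rewrite mulr_sumr; apply: eq_bigr => i _; rewrite coef_poly.
have -> : (p + i < p + p.+1)%N by rewrite ltn_add2l ltn_ord.
have -> : dn (p + i) p = i by rewrite /dn; lia.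
by rewrite exprD mulrCA.
Qed.

Lemma coef_kpoly_upoly (u : nat -> R) i : (i <= p)%N ->
  (upoly u * kpoly)`_(i + p) = conv k u p.+1 i.
Proof.
move=> ip; rewrite coefM /conv (big_ord_widen_cond (i + p).+1 xpredT (fun j => k (dn i j) * u j)); last by lia.
rewrite [RHS]big_mkcond /=; apply: eq_bigr => j _; rewrite !coef_poly.
case: ifP => jp; last by rewrite mul0r.
have -> : (i + p - j < p + p.+1)%N by lia.
by rewrite mulrC; congr (k _ * _); rewrite /dn; have := ltn_ord j; lia.
Qed.

(** Translation by [h] is multiplication by X^h, so differences of the convolution carry the Fourier
    factor x^h - 1 of [sum_root_increments]. *)
Lemma coef_shift_upoly (u : nat -> R) h i : (h <= i <= p)%N ->
  (('X^h - 1) * (upoly u * kpoly))`_(i + p) =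
  conv k u p.+1 (i - h) - conv k u p.+1 i.
Proof.
move=> /andP[hi ip]; rewrite mulrBl mul1r coefB coefXnM ltnNge.
have -> : (h <= i + p)%N by lia.
rewrite coef_kpoly_upoly //; have -> : (i + p - h = (i - h) + p)%N by lia.
by rewrite coef_kpoly_upoly //; lia.
Qed.

Hypotheses (k0 : forall l, 0 <= k l) (kd : forall l, k l.+1 <= k l).
Variable A : R.
Hypothesis kA : forall l, k l * Num.sqrt (1 + l%:R) <= A.

Lemma ceval_kpoly_bound (x : C) : nrm x = 1 ->
  nrm (ceval kpoly x) ^+ 2 * nrm (x - 1) <= 100 * A ^+ 2.
Proof.
move=> x1; have A0 : 0 <= A by apply: le_trans (kA 0); rewrite mulr_ge0 ?sqrtr_ge0.
have [->|xn1] := eqVneq x 1.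
  by rewrite subrr -[0]/(0%:C%C) nrm_real normr0 mulr0 mulr_ge0 ?sqr_ge0.
have x0 : x != 0.
  apply/eqP => x0; move: x1; rewrite x0 -[0]/(0%:C%C) nrm_real normr0 => /eqP.
  by rewrite eq_sym oner_eq0.
have xv1 : nrm x^-1 = 1.
  have : nrm (x * x^-1) = 1 by rewrite divff // -[1]/(1%:C%C) nrm_real normr1.
  by rewrite nrmM x1 mul1r.
have xv : nrm (x^-1 - 1) = nrm (x - 1).
  have -> : x^-1 - 1 = - (x^-1 * (x - 1)) by rewrite mulrBr mulVf // mulr1 opprB.
  by rewrite nrmN nrmM xv1 mul1r.
set s := Num.sqrt (nrm (x - 1)).
have s0 : 0 <= s by exact: sqrtr_ge0.
have ss : s ^+ 2 = nrm (x - 1) by rewrite sqr_sqrtr // nrm_ge0.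
have s2 : s <= 2.
  have n1 : nrm (1 : C) = 1 by rewrite -[1]/(1%:C%C) nrm_real normr1.
  have := nrmB x 1; rewrite x1 n1 -ss => h; rewrite leNgt; apply/negP => h2; nra.
rewrite -ss -exprMn; have -> : 100 * A ^+ 2 = (10 * A) ^+ 2 by ring.
rewrite ler_sqr ?nnegrE ?mulr_ge0 ?nrm_ge0 // ceval_kpoly // nrmM nrmX x1 expr1n mul1r.
have /= := @fourier_bound k A x p.+1 A0 k0 kd kA x1 xn1; rewrite -/s.
have xvn1 : x^-1 != 1 by apply: contra xn1 => /eqP h; rewrite -[x]invrK h invr1.
have /= := @fourier_bound k A x^-1 p.+1 A0 k0 kd kA xv1 xvn1; rewrite xv -/s.
have k0A : k 0 <= A by have := kA 0; rewrite addr0 sqrtr1 mulr1.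
move: (nrmB (\sum_(l < p.+1) (k l)%:C%C * x ^+ l
     + \sum_(l < p.+1) (k l)%:C%C * x^-1 ^+ l) (k 0)%:C%C).
move: (nrmD (\sum_(l < p.+1) (k l)%:C%C * x ^+ l)
   (\sum_(l < p.+1) (k l)%:C%C * x^-1 ^+ l)).
rewrite nrm_real (ger0_norm (k0 0)) => h1 h2 h3 h4.
exact: (fourier_bound_arith s0 s2 (k0 0) k0A h1 h2 h3 h4).
Qed.

(** Parseval for the product of X^h - 1, [upoly u] and [kpoly], whose degree is at most 4 p; hence
    the lower bound on N. Only the coefficients from p + h to 2 p are differences of the
    convolution; the others enter as nonnegative squares. *)
Lemma shift_energy (u : nat -> R) h N z : (h <= p)%N -> (4 * p.+1 <= N)%N ->
  N.-primitive_root z ->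
  \sum_(i < p.+1 | (h <= i)%N) (conv k u p.+1 i - conv k u p.+1 (i - h)) ^+ 2 <=
  N%:R^-1 * \sum_(b < N) (nrm ((z ^+ b) ^+ h - 1) ^+ 2 *
    (nrm (ceval (upoly u) (z ^+ b)) ^+ 2 * nrm (ceval kpoly (z ^+ b)) ^+ 2)).
Proof.
move=> hp pN zN; set q := ('X^h - 1) * (upoly u * kpoly).
have N0 : (0 < N)%N by lia.
have sq : (size q <= N)%N.
  apply: leq_trans (size_polyMleq _ _) _.
  have h1 : (size ('X^h - 1 : {poly R})%R <= h.+1)%N.
    by rewrite (leq_trans (size_polyD _ _)) // size_polyN size_poly1 size_polyXn maxnC /maxn; case: ifP.
  have h2 : (size (upoly u * kpoly)%R <= p.+1 + (p + p.+1))%N.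
    apply: leq_trans (size_polyMleq _ _) _.
    have := size_poly p.+1 u; have := size_poly (p + p.+1) (fun i => k (dn i p)).
    rewrite -/kpoly -/(upoly u); lia.
  have := leq_add h1 h2; rewrite -/q; set t := (size _ + size _)%N; move: t => t; lia.
have -> : \sum_(b < N) (nrm ((z ^+ b) ^+ h - 1) ^+ 2 *
    (nrm (ceval (upoly u) (z ^+ b)) ^+ 2 * nrm (ceval kpoly (z ^+ b)) ^+ 2)) =
    \sum_(b < N) nrm (ceval q (z ^+ b)) ^+ 2.
  apply: eq_bigr => b _; rewrite /ceval /q !rmorphM !hornerM !nrmM !exprMn.
  by rewrite rmorphB rmorph1 /= map_polyXn !hornerE.
rewrite (parseval zN sq) mulKf ?pnatr_eq0 -?lt0n //.
rewrite -(big_mkord xpredT (fun i => q`_i ^+ 2)) (big_cat_nat (n := p)) //=; last by lia.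
rewrite (big_cat_nat (n := p + p.+1) (m := p)) //=; [|lia|lia].
have P (a b : nat) : 0 <= \sum_(a <= i < b) q`_i ^+ 2.
  by apply: sumr_ge0 => i _; exact: sqr_ge0.
apply: (@le_trans _ _ (\sum_(p <= i < p + p.+1) q`_i ^+ 2)); last first.
  by have := P 0%N p; have := P (p + p.+1)%N N; lra.
have -> : \sum_(p <= i < p + p.+1) q`_i ^+ 2 = \sum_(i < p.+1) q`_(i + p) ^+ 2.
  by rewrite -{1}(add0n p) big_addn addKn big_mkord.
rewrite big_mkcond /=.
apply: ler_sum => i _; case: ifP => hi; last exact: sqr_ge0.
by rewrite coef_shift_upoly ?hi ?leq_ord // -sqrrN opprB.
Qed.

(** Pairs are grouped by their difference h, and after [shift_energy] the sum over h is taken on the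
    Fourier side, where 10 |x - 1| meets the multiplier bound 100 A^2 / |x - 1|. In 2000 = 2 * 10 *
    100 the factor 2 accounts for i < i' and i > i'; the diagonal terms are 0 / 0 = 0. *)
Lemma conv_energy (u : nat -> R) :
  \sum_(i < p.+1) \sum_(i' < p.+1)
     (conv k u p.+1 i - conv k u p.+1 i') ^+ 2 / (dn i i')%:R ^+ 2 <=
  2000 * A ^+ 2 * \sum_(j < p.+1) u j ^+ 2.
Proof.
set W := conv k u p.+1; pose f i i' := (W i - W i') ^+ 2 / (dn i i')%:R ^+ 2.
have [z zN] := @prim_root_exists R (4 * p.+1) isT.
set N := (4 * p.+1)%N in zN; have N0 : (0 : R) < N%:R by rewrite ltr0n.
have -> : \sum_(i < p.+1) \sum_(i' < p.+1) f i i' =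
          2 * \sum_(i < p.+1) \sum_(i' < p.+1 | (i' < i)%N) f i i'.
  have fC i i' : f i i' = f i' i by rewrite /f dnC -sqrrN opprB.
  have -> : \sum_(i < p.+1) \sum_(i' < p.+1) f i i' =
     \sum_(i < p.+1) \sum_(i' < p.+1 | (i' < i)%N) f i i' +
     \sum_(i < p.+1) \sum_(i' < p.+1 | (i < i')%N) f i i'.
    rewrite -big_split; apply: eq_bigr => i _ /=.
    rewrite (bigID (fun i' : 'I_p.+1 => (i' < i)%N)) /=; congr (_ + _).
    rewrite (bigD1 i) /= ?ltnn //.
    rewrite {1}/f subrr expr0n mul0r add0r; apply: eq_bigl => i'.
    by rewrite -leqNgt ltn_neqAle andbC eq_sym.
  suff -> : \sum_(i < p.+1) \sum_(i' < p.+1 | (i < i')%N) f i i' =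
            \sum_(i < p.+1) \sum_(i' < p.+1 | (i' < i)%N) f i i'.
    by rewrite mulr_natl mulr2n.
  rewrite (exchange_big_dep xpredT) //=; apply: eq_bigr => i _.
  by apply: eq_bigr => i' _.
have -> : \sum_(i < p.+1) \sum_(i' < p.+1 | (i' < i)%N) f i i' =
  \sum_(1 <= h < p.+1) (\sum_(i < p.+1 | (h <= i)%N) (W i - W (i - h)%N) ^+ 2) / h%:R ^+ 2.
  under [RHS]eq_bigr => h _ do rewrite mulr_suml.
  rewrite [RHS](exchange_big_dep xpredT) //=; apply: eq_bigr => i _.
  transitivity (\sum_(0 <= i' < i) f i i').
    by rewrite (big_nat_widen _ _ p.+1) ?(ltnW (ltn_ord i)) // big_mkord.
  transitivity (\sum_(1 <= h < i.+1) (W i - W (i - h)%N) ^+ 2 / h%:R ^+ 2); last first.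
    by rewrite [LHS](big_nat_widen _ _ p.+1) ?ltn_ord.
  rewrite big_add1 /= big_nat_rev /= add0n; apply: eq_big_nat => j /andP[_ ji].
  by rewrite /f; congr (_ / _%:R ^+ 2); rewrite /dn; lia.
have -> : 2000 * A ^+ 2 * \sum_(j < p.+1) u j ^+ 2 =
          2 * (1000 * A ^+ 2 * \sum_(j < p.+1) u j ^+ 2) by ring.
rewrite ler_wpM2l //.
pose P b := nrm (ceval (upoly u) (z ^+ b)) ^+ 2.
pose K b := nrm (ceval kpoly (z ^+ b)) ^+ 2.
have z1 b : nrm (z ^+ b) = 1.
  by rewrite nrmX (nrm_unit (prim_order_gt0 zN) (prim_expr_order zN)) expr1n.
apply: (@le_trans _ _ (\sum_(1 <= h < p.+1) (N%:R^-1 *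
   \sum_(b < N) (nrm ((z ^+ b) ^+ h - 1) ^+ 2 * (P b * K b))) / h%:R ^+ 2)).
  apply: ler_sum_nat => h /andP[h0 hp]; rewrite ler_wpM2r ?invr_ge0 ?exprn_ge0 //.
  exact: shift_energy.
have -> : \sum_(1 <= h < p.+1) (N%:R^-1 *
   \sum_(b < N) (nrm ((z ^+ b) ^+ h - 1) ^+ 2 * (P b * K b))) / h%:R ^+ 2 =
   N%:R^-1 * \sum_(b < N) (\sum_(1 <= h < p.+1) nrm ((z ^+ b) ^+ h - 1) ^+ 2 / h%:R ^+ 2) * (P b * K b).
  under eq_bigr => h _ do rewrite -mulrA mulr_suml mulr_sumr.
  rewrite exchange_big mulr_sumr /=; apply: eq_bigr => b _.
  rewrite mulr_suml mulr_sumr; apply: eq_bigr => h _; ring.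
rewrite mulrC ler_pdivrMr //.
have -> : 1000 * A ^+ 2 * (\sum_(j < p.+1) u j ^+ 2) * N%:R =
    \sum_(b < N) 1000 * A ^+ 2 * P b.
  rewrite -mulr_sumr -mulrA; congr (_ * _).
  rewrite /P (parseval zN) ?(leq_trans (size_poly _ _)) ?leq_pmull // mulrC; congr (_ * _).
  rewrite (big_ord_widen N (fun j => u j ^+ 2)) ?leq_pmull // big_mkcond /=.
  by apply: eq_bigr => j _; rewrite coef_poly; case: ifP => // _; rewrite expr0n.
apply: ler_sum => b _.
apply: (@le_trans _ _ (10 * nrm (z ^+ b - 1) * (P b * K b))).
  by rewrite ler_wpM2r ?sum_root_increments // mulr_ge0 // sqr_ge0.
have := ceval_kpoly_bound (z1 b); rewrite -/(K b).
have : 0 <= P b by exact: sqr_ge0.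
move=> p0 kb; have -> : 10 * nrm (z ^+ b - 1) * (P b * K b) =
  10 * (P b * (K b * nrm (z ^+ b - 1))) by ring.
by have := ler_wpM2l p0 kb; lra.
Qed.

End SymmetricKernel.

End ConvolutionEnergy.

(** * Comparison rules for x^(-1/2) *)

Section InverseSqrt.
Variable R : realType.

(** For x <= 0 the square root is 0 and so is its inverse: [isq x = 0]. *)
Definition isq (x : R) : R := (Num.sqrt x)^-1.

Lemma isq_ge0 x : 0 <= isq x.
Proof. by rewrite invr_ge0 sqrtr_ge0. Qed.

Lemma isq_gt0 x : 0 < x -> 0 < isq x.
Proof. by move=> x0; rewrite invr_gt0 sqrtr_gt0. Qed.

Lemma isqM x y : 0 <= x -> isq (x * y) = isq x * isq y.
Proof. by move=> x0; rewrite /isq sqrtrM // invfM. Qed.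

Lemma isq_sqr x : 0 <= x -> isq x ^+ 2 = x^-1.
Proof. by move=> x0; rewrite exprVn sqr_sqrtr. Qed.

Lemma isq_le K x y : 0 < x -> 0 <= K -> x <= K ^+ 2 * y -> isq y <= K * isq x.
Proof.
move=> x0 K0 xy.
have y0 : 0 < y.
  rewrite ltNge; apply/negP => y0; have : K ^+ 2 * y <= 0 by rewrite mulr_ge0_le0 ?sqr_ge0.
  by lra.
rewrite -ler_sqr ?nnegrE ?mulr_ge0 ?isq_ge0 // exprMn !isq_sqr ?(ltW x0) ?(ltW y0) //.
by rewrite ler_pdivlMr // mulrC ler_pdivrMr.
Qed.

Lemma isq_anti x y : 0 < x -> x <= y -> isq y <= isq x.
Proof. by move=> x0 xy; rewrite -[leRHS]mul1r isq_le // expr1n mul1r. Qed.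

End InverseSqrt.

(** * Schur's test *)

Section Schur.
Variable R : realType.

Lemma cauchy_schwarz_weight (I : finType) (p v : I -> R) : (forall i, 0 <= p i) ->
  (\sum_i p i * v i) ^+ 2 <= (\sum_i p i) * \sum_i p i * v i ^+ 2.
Proof.
move=> p0; have := cauchy_schwarz (fun i => Num.sqrt (p i)) (fun i => Num.sqrt (p i) * v i).
under eq_bigr => i _ do rewrite mulrA -expr2 sqr_sqrtr //.
under [X in _ <= X * _ -> _]eq_bigr => i _ do rewrite sqr_sqrtr //.
by under [X in _ <= _ * X -> _]eq_bigr => i _ do rewrite exprMn sqr_sqrtr //.
Qed.

Lemma schur_test (X Y : finType) (T : X -> Y -> R) (u : Y -> R) (B D : R) :
  (forall x y, 0 <= T x y) -> 0 <= B ->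
  (forall x, \sum_y T x y <= B) -> (forall y, \sum_x T x y <= D) ->
  \sum_x (\sum_y T x y * u y) ^+ 2 <= B * D * \sum_y u y ^+ 2.
Proof.
move=> T0 B0 hB hD.
apply: (@le_trans _ _ (\sum_x B * \sum_y T x y * u y ^+ 2)).
  apply: ler_sum => x _; apply: le_trans (cauchy_schwarz_weight _ _) _ => //.
  by rewrite ler_wpM2r // sumr_ge0 // => y _; rewrite mulr_ge0 ?sqr_ge0.
rewrite -mulr_sumr -mulrA ler_wpM2l // exchange_big mulr_sumr /=.
by apply: ler_sum => y _; rewrite -mulr_suml ler_wpM2r ?sqr_ge0.
Qed.

(* Schur's test with weights [isq a], [isq b], after integrating out [x']. *)
Lemma schur_test3 (X X' Y : finType) (m : X -> Y -> R) (a : X -> R) (a' : X' -> R)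
    (b : Y -> R) (u : Y -> R) (C : R) :
  0 <= C -> (forall x y, 0 <= m x y) ->
  (forall x, 0 < a x) -> (forall x', 0 < a' x') -> (forall y, 0 < b y) ->
  (forall x y, \sum_x' ((a x + b y + a' x') ^+ 2)^-1 <= C / (a x + b y)) ->
  (forall x, \sum_y m x y * isq ((a x + b y) * b y) <= C * isq (a x)) ->
  (forall y, \sum_x m x y * isq ((a x + b y) * a x) <= C * isq (b y)) ->
  \sum_x \sum_x' (\sum_y m x y / (a x + b y + a' x') * u y) ^+ 2 <=
  C ^+ 3 * \sum_y u y ^+ 2.
Proof.
move=> C0 m0 a0 a'0 b0 h1 h2 h3.
have ab0 x y : 0 < a x + b y by rewrite addr_gt0.
(* Cauchy-Schwarz is applied with the measure m / g, whose row sums are those of [h2], to the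
   function g u / (a + b + a'). *)
pose g x y := Num.sqrt ((a x + b y) * b y).
have g0 x y : 0 < g x y by rewrite sqrtr_gt0 mulr_gt0.
apply: (@le_trans _ _ (\sum_x \sum_x' C * isq (a x) *
    \sum_y m x y * g x y * u y ^+ 2 * ((a x + b y + a' x') ^+ 2)^-1)).
  apply: ler_sum => x _; apply: ler_sum => x' _.
  have -> : \sum_y m x y / (a x + b y + a' x') * u y =
     \sum_y (m x y * isq ((a x + b y) * b y)) * (g x y * u y / (a x + b y + a' x')).
    apply: eq_bigr => y _; rewrite /isq -/(g x y).
    by field; rewrite !gt_eqF ?addr_gt0.
  apply: le_trans (cauchy_schwarz_weight _ _) _.
    by move=> y; rewrite mulr_ge0 ?isq_ge0.
  apply: (@le_trans _ _ (C * isq (a x) * \sum_y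
      m x y * isq ((a x + b y) * b y) * (g x y * u y / (a x + b y + a' x')) ^+ 2)).
    rewrite ler_wpM2r // sumr_ge0 // => y _.
    by apply: mulr_ge0; [apply: mulr_ge0; rewrite ?isq_ge0|exact: sqr_ge0].
  rewrite le_eqVlt; apply/orP; left; apply/eqP; congr (_ * _).
  apply: eq_bigr => y _; rewrite /isq -/(g x y).
  by field; rewrite !gt_eqF ?addr_gt0.
apply: (@le_trans _ _ (\sum_x C * isq (a x) *
    \sum_y m x y * g x y * u y ^+ 2 * (C / (a x + b y)))).
  apply: ler_sum => x _; rewrite -mulr_sumr ler_wpM2l ?mulr_ge0 ?isq_ge0 //.
  rewrite exchange_big; apply: ler_sum => y _ /=; rewrite -mulr_sumr ler_wpM2l //.
  by apply: mulr_ge0; [apply: mulr_ge0; rewrite ?(ltW (g0 _ _))|exact: sqr_ge0].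
(* Since g / (a + b) = sqrt b * isq (a + b), the sum over x is the one in [h3], and sqrt b then
   cancels isq b. *)
apply: (@le_trans _ _ (\sum_y C ^+ 2 * Num.sqrt (b y) * u y ^+ 2 *
   \sum_x m x y * isq ((a x + b y) * a x))).
  under eq_bigr => x _ do rewrite mulr_sumr.
  rewrite exchange_big; apply: ler_sum => y _ /=; rewrite mulr_sumr.
  apply: ler_sum => x _; rewrite le_eqVlt; apply/orP; left; apply/eqP.
  rewrite isqM ?(ltW (ab0 _ _)) // -(isq_sqr (ltW (ab0 x y))) /g sqrtrM ?(ltW (ab0 _ _)) //.
  have e : Num.sqrt (a x + b y) * isq (a x + b y) = 1.
    by rewrite divff // gt_eqF // sqrtr_gt0.
  rewrite -[RHS]mulr1 -e; ring.
apply: (@le_trans _ _ (\sum_y C ^+ 2 * Num.sqrt (b y) * u y ^+ 2 * (C * isq (b y)))).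
  apply: ler_sum => y _; rewrite ler_wpM2l //.
  by apply: mulr_ge0; [apply: mulr_ge0; rewrite ?sqr_ge0 ?sqrtr_ge0|exact: sqr_ge0].
rewrite mulr_sumr; apply: ler_sum => y _; rewrite le_eqVlt; apply/orP; left; apply/eqP.
have e : Num.sqrt (b y) * isq (b y) = 1 by rewrite divff // gt_eqF // sqrtr_gt0.
by rewrite -[RHS]mulr1 -e; ring.
Qed.

End Schur.

(** * Sums over equidistant points *)

Section LatticeSums.
Variable R : realType.

(** The k-th lattice point at or beyond [s], counted from 0, has distance at least k from [s]. *)
Lemma sum_right_le (f : R -> R) n (s : R) : (forall t, 0 <= f t) ->
  (forall t t', 0 <= t -> t <= t' -> f t' <= f t) ->
  \sum_(j < n | s <= j%:R) f (j%:R - s) <= \sum_(k < n) f k%:R.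
Proof.
move=> f0 fd; elim: n s => [|n IH] s; first by rewrite !big_ord0.
have [s0|s0] := leP s 0.
  rewrite big_mkcond; apply: ler_sum => j _; case: ifP => // _.
  by apply: fd; rewrite ?ler0n //; lra.
rewrite big_mkcond big_ord_recl /= ifN ?add0r -?ltNge // -big_mkcond /=.
apply: (@le_trans _ _ (\sum_(k < n) f k%:R)); last first.
  by rewrite [leRHS]big_ord_recr /= lerDl.
apply: le_trans (IH (s - 1)); rewrite le_eqVlt; apply/orP; left; apply/eqP.
by apply: eq_big => j; rewrite /bump /= add1n -natr1 ?lerBlDr // => _; congr (f _); ring.
Qed.

(** The reflection j -> n - 1 - j turns the points left of [s] into points right of n - 1 - s. *)
Lemma sum_dist_le (f : R -> R) n (s : R) : (forall t, 0 <= f t) ->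
  (forall t t', 0 <= t -> t <= t' -> f t' <= f t) ->
  \sum_(j < n) f `|j%:R - s| <= 2 * \sum_(k < n) f k%:R.
Proof.
move=> f0 fd; rewrite (bigID (fun j : 'I_n => s <= j%:R)) /= mulr_natl mulr2n.
apply: lerD.
  apply: le_trans (sum_right_le n s f0 fd).
  by apply: ler_sum => j js; rewrite ger0_norm // subr_ge0.
apply: le_trans (sum_right_le n (n%:R - 1 - s) f0 fd).
rewrite (reindex_inj rev_ord_inj) /= big_mkcond [leRHS]big_mkcond.
apply: ler_sum => j _; rewrite natrB ?ltn_ord // -natr1.
have [h|h] := leP s (n%:R - (j%:R + 1)); first by case: ifP => // _; exact: f0.
rewrite ifT; last by lra.
by rewrite ltr0_norm ?subr_lt0 // le_eqVlt; apply/orP; left; apply/eqP; congr f; ring.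
Qed.

Variable L : R.
Hypothesis L0 : 0 < L.

Lemma sum_isq_near (n : nat) (T : R) : 1 <= T ->
  \sum_(k < n) (if 1 + L * k%:R <= T then isq (1 + L * k%:R) else 0) <=
  (1 + 2 / L) * Num.sqrt T.
Proof.
move=> T1; have l0 := L0; have T0 : 0 < T by lra.
have L2 : 0 < 2 / L by rewrite divr_gt0.
case: n => [|n]; first by rewrite big_ord0 mulr_ge0 ?sqrtr_ge0 //; lra.
set S := \sum_(_ < _) _.
(* Following the last point until it passes [T] gives a bound that can be proved by induction: a
   step of length L raises the square root by at least L / (2 x), where x is the new root. *)
suff : S <= 1 + 2 / L * Num.sqrt (Num.min T (1 + L * n%:R)).
  have h1 : 1 <= Num.sqrt T by rewrite -[leLHS]sqrtr1 ler_sqrt // ltW.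
  have h2 : Num.sqrt (Num.min T (1 + L * n%:R)) <= Num.sqrt T.
    by rewrite ler_sqrt ?(ltW T0) // ge_min lexx.
  by have := ler_wpM2l (ltW L2) h2; rewrite mulrDl mul1r; lra.
rewrite {}/S; elim: n => [|n IH].
  rewrite big_ord_recr big_ord0 /= mulr0 addr0 T1 add0r /isq sqrtr1 invr1.
  by rewrite lerDl mulr_ge0 ?sqrtr_ge0 // ltW.
rewrite big_ord_recr /=.
have Ln : 0 <= L * n%:R by rewrite mulr_ge0 ?ler0n // ltW.
have Ln1 : L * n.+1%:R = L * n%:R + L by rewrite -natr1; ring.
case: ifP => [h|_]; last first.
  rewrite addr0; apply: le_trans IH _; rewrite lerD2l ler_wpM2l ?(ltW L2) //.
  apply: ler_wsqrtr; rewrite le_min ge_min lexx /= ge_min Ln1; apply/orP; right.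
  by rewrite lerD2l lerDl ltW.
rewrite (min_idPr h); apply: le_trans (lerD IH (lexx _)) _.
rewrite min_r; last by apply: le_trans h; rewrite lerD2l Ln1 lerDl ltW.
rewrite -addrA lerD2l Ln1.
set y := Num.sqrt (1 + L * n%:R); rewrite /isq; set x := Num.sqrt _.
have y0 : 0 <= y by exact: sqrtr_ge0.
have x0 : 0 < x by rewrite sqrtr_gt0; lra.
have xy : x ^+ 2 = y ^+ 2 + L by rewrite !sqr_sqrtr; lra.
have Li : 0 < L^-1 by rewrite invr_gt0.
suff H : L * x^-1 <= 2 * x - 2 * y.
  have := ler_wpM2r (ltW Li) H; rewrite mulrAC mulfV ?gt_eqF // mul1r.
  by rewrite mulrBl; lra.
rewrite ler_pdivrMr //.
have : 0 <= (x - y) ^+ 2 by exact: sqr_ge0.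
by nra.
Qed.

Lemma sum_isq_far (n : nat) (T : R) : 1 <= T ->
  \sum_(k < n) isq (T + L * k%:R) / (T + L * k%:R) <= (1 + 2 / L) * isq T.
Proof.
move=> T1; have l0 := L0; have T0 : 0 < T by lra.
have L2 : 0 < 2 / L by rewrite divr_gt0.
case: n => [|n]; first by rewrite big_ord0 mulr_ge0 ?isq_ge0 //; lra.
set S := \sum_(_ < _) _.
(* Each further term (T + L k)^(-3/2) is at most 2 / L times the last decrease of [isq], so the sum
   telescopes. *)
suff : S <= isq T + 2 / L * (isq T - isq (T + L * n%:R)).
  have := isq_ge0 (T + L * n%:R) => h.
  have := mulr_ge0 (ltW L2) h; rewrite mulrBr mulrDl mul1r; lra.
rewrite {}/S; elim: n => [|n IH].
  rewrite big_ord_recr big_ord0 /= mulr0 addr0 add0r subrr mulr0 addr0.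
  by rewrite ler_pdivrMr // ler_peMr ?isq_ge0.
rewrite big_ord_recr /=; apply: le_trans (lerD IH (lexx _)) _.
rewrite -addrA lerD2l.
have Ln : 0 <= L * n%:R by rewrite mulr_ge0 ?ler0n // ltW.
have Ln1 : L * n.+1%:R = L * n%:R + L by rewrite -natr1; ring.
suff : isq (T + L * n.+1%:R) / (T + L * n.+1%:R) <=
  2 / L * (isq (T + L * n%:R) - isq (T + L * n.+1%:R)) by lra.
rewrite Ln1 /isq; set y := Num.sqrt (T + L * n%:R).
have xx : T + (L * n%:R + L) = Num.sqrt (T + (L * n%:R + L)) ^+ 2.
  by rewrite sqr_sqrtr; lra.
rewrite [X in _ / X <= _]xx; set x := Num.sqrt _.
have y0 : 0 < y by rewrite sqrtr_gt0; lra.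
have x0 : 0 < x by rewrite sqrtr_gt0; lra.
have xy : x ^+ 2 = y ^+ 2 + L by rewrite !sqr_sqrtr; lra.
have yx : y <= x by rewrite ler_wsqrtr //; lra.
have -> : y^-1 - x^-1 = (x - y) / (x * y).
  by field; rewrite !gt_eqF.
have -> : L = (x - y) * (x + y) by rewrite -subr_sqr; lra.
have xyp : 0 < x - y by rewrite subr_gt0 -ltr_sqr ?nnegrE ?(ltW x0) ?(ltW y0) //; lra.
have xyq : 0 < x + y by lra.
have -> : 2 / ((x - y) * (x + y)) * ((x - y) / (x * y)) = 2 / ((x + y) * (x * y)).
  by field; rewrite !gt_eqF.
rewrite -invfM -[leLHS]mul1r ler_pdivrMr ?mulr_gt0 ?exprn_gt0 // mulrAC.
rewrite ler_pdivlMr ?mulr_gt0 // mul1r.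
have -> : 2 * (x * x ^+ 2) = (x * x) * (2 * x) by ring.
have -> : (x + y) * (x * y) = (x * y) * (x + y) by ring.
apply: ler_pM; rewrite ?mulr_ge0 ?(ltW x0) ?(ltW y0) ?(ltW xyq) //; last by lra.
by rewrite ler_wpM2l // ltW.
Qed.

Let C := 2 * (1 + 2 / L).

Lemma sum_isq_near_dist (n : nat) (s T : R) : 1 <= T ->
  \sum_(j < n) (if 1 + L * `|j%:R - s| <= T then isq (1 + L * `|j%:R - s|) else 0)
  <= C * Num.sqrt T.
Proof.
move=> T1; have l0 := L0.
pose f (t : R) := if 1 + L * t <= T then isq (1 + L * t) else 0.
apply: le_trans (@sum_dist_le f n s _ _) _.
- by move=> t; rewrite /f; case: ifP => // _; exact: isq_ge0.
- move=> t t' t0 tt'; rewrite /f.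
  have h : L * t <= L * t' by rewrite ler_wpM2l // ltW.
  have h0 : 0 <= L * t by rewrite mulr_ge0 // ltW.
  case: ifP => [h'|_]; last by case: ifP => // _; exact: isq_ge0.
  by rewrite ifT; [apply: isq_anti; lra|lra].
by rewrite /C -mulrA ler_wpM2l // sum_isq_near.
Qed.

Lemma sum_isq_far_dist (n : nat) (s T : R) : 1 <= T ->
  \sum_(j < n) isq (T + L * `|j%:R - s|) / (T + L * `|j%:R - s|) <= C * isq T.
Proof.
move=> T1; have l0 := L0.
pose f (t : R) := isq (T + L * `|t|) / (T + L * `|t|).
rewrite (eq_bigr (fun j : 'I_n => f `|j%:R - s|)); last first.
  by move=> j _; rewrite /f normr_id.
apply: le_trans (@sum_dist_le f n s _ _) _.
- move=> t; have h0 : 0 <= L * `|t| by rewrite mulr_ge0 // ltW.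
  by rewrite /f mulr_ge0 ?isq_ge0 // invr_ge0; lra.
- move=> t t' t0 tt'; rewrite /f !ger0_norm //; last by lra.
  have h : L * t <= L * t' by rewrite ler_wpM2l // ltW.
  have h0 : 0 <= L * t by rewrite mulr_ge0 // ltW.
  apply: ler_pM; rewrite ?isq_ge0 ?invr_ge0 //; [lra|apply: isq_anti; lra|].
  by rewrite lef_pV2 ?posrE; lra.
rewrite /C -mulrA ler_wpM2l //; under eq_bigr do rewrite /f ger0_norm ?ler0n //.
exact: sum_isq_far.
Qed.

Lemma sum_isq_dist (n : nat) (s : R) :
  \sum_(j < n) isq (1 + L * `|j%:R - s|) <= C * Num.sqrt (1 + L * n%:R).
Proof.
have l0 := L0; pose f (t : R) := isq (1 + L * `|t|).
rewrite (eq_bigr (fun j : 'I_n => f `|j%:R - s|)); last first.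
  by move=> j _; rewrite /f normr_id.
apply: le_trans (@sum_dist_le f n s _ _) _.
- by move=> t; exact: isq_ge0.
- move=> t t' t0 tt'; rewrite /f !ger0_norm //; last by lra.
  have h : L * t <= L * t' by rewrite ler_wpM2l // ltW.
  have h0 : 0 <= L * t by rewrite mulr_ge0 // ltW.
  by apply: isq_anti; lra.
rewrite /C -mulrA ler_wpM2l //.
have Ln : 0 <= L * n%:R by rewrite mulr_ge0 ?ler0n // ltW.
have Ln1 : 1 <= 1 + L * n%:R by lra.
apply: le_trans (sum_isq_near n Ln1).
apply: ler_sum => k _; rewrite /f ger0_norm ?ler0n // ifT //.
by rewrite lerD2l ler_wpM2l ?(ltW L0) // ler_nat ltnW.
Qed.

(** The inequality (A + 1 + x)^-2 <= (A + x)^(-3/2) A^(-1/2) reduces this to [sum_isq_far_dist]. *)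
Lemma sum_inv_sqr_dist (n : nat) (s A : R) : 1 <= A ->
  \sum_(j < n) ((A + (1 + L * `|j%:R - s|)) ^+ 2)^-1 <= C / A.
Proof.
move=> A1; have l0 := L0; have A0 : 0 < A by lra.
have -> : C / A = (C * isq A) * isq A by rewrite -mulrA -expr2 isq_sqr // ltW.
apply: le_trans (ler_wpM2r (isq_ge0 A) (@sum_isq_far_dist n s A A1)).
rewrite mulr_suml; apply: ler_sum => j _; set x := L * _.
have x0 : 0 <= x by rewrite mulr_ge0 // ltW.
have -> : isq (A + x) / (A + x) * isq A = isq (A + x) * isq A * (A + x)^-1 by ring.
rewrite expr2 invfM; apply: ler_pM; rewrite ?invr_ge0; try lra; last first.
  by rewrite lef_pV2 ?posrE; lra.
rewrite -[leLHS]isq_sqr; last by lra.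
by rewrite expr2; apply: ler_pM; rewrite ?isq_ge0 //; apply: isq_anti; lra.
Qed.

(** Here a and b are distances to a corner and d is the distance between the two points, so d >= |a
    - b|; c <= 1 + d and f <= a + b are lower bounds that can be summed. If b <= a / 2 then d >= a /
    2. If b > 2 a then d >= b / 2 and the product decays like b^(-3/2). If a and b are comparable,
    (a + b) b is of order a^2 and isq (1 + d) is left, bounded by isq c or, when c > a, by 2 isq
    b. *)
Lemma isq_prod_le (a b d c f : R) : 1 <= a -> 1 <= b -> 1 <= c -> 0 <= d ->
  c <= 1 + d -> `|a - b| <= d -> 0 < f -> f <= a + b ->
  isq (1 + d) * isq ((a + b) * b) <=
  4 / a * ((if c <= a then isq c else 0) + (if b <= 2 * a then isq b else 0)) +
  16 * (isq f / f).
Proof.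
move=> a1 b1 c1 d0 cd abd f0 fab.
have a0 : 0 < a by lra.
have Ai : 0 < a^-1 by rewrite invr_gt0.
have b0 : 0 < b by lra.
have [abd1 abd2] : a - b <= d /\ b - a <= d by move: abd; rewrite ler_norml; lra.
have g0 x : 0 <= isq x by exact: isq_ge0.
set t := isq f / f; have t0 : 0 <= t by apply: divr_ge0; [exact: g0|exact: ltW].
set N2 := if c <= a then _ else _; have N20 : 0 <= N2 by rewrite /N2; case: ifP.
set N3 := if b <= _ then _ else _; have N30 : 0 <= N3 by rewrite /N3; case: ifP.
have P2 : 0 <= a^-1 * N2 by rewrite mulr_ge0 // ltW.
have P3 : 0 <= a^-1 * N3 by rewrite mulr_ge0 // ltW.
have -> : 4 / a * (N2 + N3) = 4 * (a^-1 * N2) + 4 * (a^-1 * N3) by ring.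
have iaa : isq a * isq a = a^-1 by rewrite -expr2 isq_sqr // ltW.
have ibb : isq b * isq b = b^-1 by rewrite -expr2 isq_sqr // ltW.
have [ba|ba] := leP (2 * b) a.
  apply: (@le_trans _ _ (2 * (a^-1 * N3))); last by lra.
  rewrite /N3 ifT; last by lra.
  have -> : 2 * (a^-1 * isq b) = (2 * isq a) * (isq a * isq b) by rewrite -iaa; ring.
  apply: ler_pM; rewrite ?g0 //.
    by apply: isq_le => //; lra.
  rewrite -isqM ?(ltW a0) //; apply: isq_anti; first exact: mulr_gt0.
  by rewrite ler_wpM2r ?(ltW b0) //; lra.
have [ab|ab] := leP b (2 * a).
  have h : isq ((a + b) * b) <= 2 * a^-1.
    rewrite -iaa -isqM ?(ltW a0) //; apply: isq_le; [exact: mulr_gt0|by []|].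
    have e1 := mulr_gt0 a0 b0; have e2 := mulr_gt0 b0 b0.
    by have := ler_wpM2l (ltW a0) (ltW ba); clear -e1 e2; nra.
  have [ca|ca] := leP c a.
    apply: (@le_trans _ _ (2 * (a^-1 * N2))); last by lra.
    rewrite /N2 ifT // mulrC mulrA; apply: ler_pM; rewrite ?g0 //.
    by apply: isq_anti; lra.
  apply: (@le_trans _ _ (4 * (a^-1 * N3))); last by lra.
  rewrite /N3 ifT // mulrC; have -> : 4 * (a^-1 * isq b) = (2 * a^-1) * (2 * isq b) by ring.
  by apply: ler_pM; rewrite ?mulr_ge0 ?g0 ?(ltW Ai) //; apply: isq_le => //; lra.
apply: (@le_trans _ _ (16 * t)); last by lra.
apply: (@le_trans _ _ (2 * isq b * b^-1)).
  apply: ler_pM; rewrite ?g0 ?invr_ge0 ?(ltW b0) //; first by apply: isq_le => //; lra.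
  rewrite -ibb -isqM ?(ltW b0) //; apply: isq_anti; first exact: mulr_gt0.
  by rewrite ler_wpM2r ?(ltW b0) //; lra.
have -> : 16 * t = 2 * (2 * isq f) * (4 / f) by rewrite /t; ring.
apply: ler_pM; rewrite ?mulr_ge0 ?g0 ?invr_ge0 ?(ltW b0) //.
  by rewrite ler_wpM2l //; apply: isq_le => //; lra.
by rewrite ler_pdivlMr // mulrC ler_pdivrMr //; lra.
Qed.

(** In lattice units [s] is the position of the corner and [s'] the foot of the fixed point. The
    near sums up to a and up to 2 a give sqrt a and sqrt (2 a) <= 2 sqrt a, the far sum gives isq a;
    hence 28 = 4 * (1 + 2) + 16. *)
Lemma sum_isq_corner (n : nat) (s s' a : R) (d : nat -> R) : 1 <= a ->
  (forall j, L * `|j%:R - s'| <= d j) ->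
  (forall j, `|a - (1 + L * `|j%:R - s|)| <= d j) ->
  \sum_(j < n) isq (1 + d j) *
     isq ((a + (1 + L * `|j%:R - s|)) * (1 + L * `|j%:R - s|)) <= 28 * C * isq a.
Proof.
move=> a1 hd hb; have l0 := L0; have a0 : 0 < a by lra.
have nn (t : R) : 0 <= L * `|t| by rewrite mulr_ge0 // ltW.
apply: (@le_trans _ _ (\sum_(j < n) (4 / a *
  ((if 1 + L * `|j%:R - s'| <= a then isq (1 + L * `|j%:R - s'|) else 0) +
   (if 1 + L * `|j%:R - s| <= 2 * a then isq (1 + L * `|j%:R - s|) else 0)) +
   16 * (isq (a + L * `|j%:R - s|) / (a + L * `|j%:R - s|))))).
  apply: ler_sum => j _; have n1 := nn (j%:R - s); have n2 := nn (j%:R - s').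
  have h1 := hd j; have h2 := hb j.
  by apply: isq_prod_le => //; lra.
rewrite big_split /= -!mulr_sumr big_split /=.
have C0 : 0 <= C by rewrite /C mulr_ge0 // addr_ge0 // divr_ge0 // ltW.
have h1 := @sum_isq_near_dist n s' a a1.
have a2 : 1 <= 2 * a by lra.
have h2 := @sum_isq_near_dist n s (2 * a) a2.
have h3 := @sum_isq_far_dist n s a a1.
have h4 : Num.sqrt (2 * a) <= 2 * Num.sqrt a.
  have {2}-> : 2 = Num.sqrt (2 ^+ 2) :> R by rewrite sqrtr_sqr ger0_norm.
  by rewrite -sqrtrM ?sqr_ge0 // ler_wsqrtr //; lra.
have h5 := ler_wpM2l C0 h4.
have h6 : a^-1 * Num.sqrt a = isq a.
  by rewrite -isq_sqr ?(ltW a0) // expr2 -mulrA mulVf ?mulr1 // gt_eqF // sqrtr_gt0.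
have Ai : 0 <= 4 / a by rewrite divr_ge0 // ltW.
apply: le_trans (lerD (ler_wpM2l Ai (lerD h1 (le_trans h2 h5))) (ler_wpM2l _ h3)) _ => //.
by rewrite le_eqVlt; apply/orP; left; apply/eqP; rewrite -h6; ring.
Qed.

End LatticeSums.

(** * Geometry of segments and corners *)

Section Geometry.
Local Open Scope classical_set_scope.
Variable R : realType.
Notation pt := (R * R)%type.
Implicit Types (x y z P : pt) (g h : segment R).

(** Identifying the plane with R[i] makes the triangle inequality that of the modulus. *)
Lemma edistE x y : edist x y = nrm ((x.1 - y.1) +i* (x.2 - y.2))%C.
Proof. by apply: complexI; rewrite -nrmE normc_def. Qed.

Lemma edist_ge0 x y : 0 <= edist x y.
Proof. exact: sqrtr_ge0. Qed.

Lemma edist_sqr x y : edist x y ^+ 2 = (x.1 - y.1) ^+ 2 + (x.2 - y.2) ^+ 2.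
Proof. by rewrite sqr_sqrtr // addr_ge0 ?sqr_ge0. Qed.

Lemma edistC x y : edist x y = edist y x.
Proof. by rewrite /edist; congr Num.sqrt; ring. Qed.

Lemma edistxx x : edist x x = 0.
Proof. by rewrite /edist !subrr expr0n addr0 sqrtr0. Qed.

Lemma edist_tri x y z : edist x z <= edist x y + edist y z.
Proof.
rewrite !edistE; apply: le_trans (nrmD _ _); rewrite le_eqVlt; apply/orP; left.
by apply/eqP; congr nrm; rewrite -[RHS]/(_ +i* _)%C; congr (_ +i* _)%C; ring.
Qed.

Lemma edist_eq0 x y : edist x y = 0 -> x = y.
Proof.
move=> h; have := edist_sqr x y; rewrite h expr0n => /esym/eqP.
rewrite paddr_eq0 ?sqr_ge0 // !sqrf_eq0 !subr_eq0 => /andP[/eqP h1 /eqP h2].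
by case: x y h1 h2 {h} => [? ?] [? ?] /= -> ->.
Qed.

Lemma edist_diff x y z : `|edist x z - edist y z| <= edist x y.
Proof.
rewrite ler_norml; have := edist_tri x y z; have := edist_tri y x z.
rewrite (edistC y x); lra.
Qed.

Lemma seg_len_gt0 g : g.1 <> g.2 -> 0 < seg_len g.
Proof. by move=> h; rewrite lt_def edist_ge0 andbT; apply/eqP => /edist_eq0. Qed.

Lemma edist_gam g (t t' : R) : edist (gam g t) (gam g t') = seg_len g * `|t - t'|.
Proof.
apply/eqP; rewrite -(eqrXn2 (n := 2)) ?edist_ge0 ?mulr_ge0 ?edist_ge0 //.
by rewrite exprMn real_normK ?num_real // /seg_len !edist_sqr /=; apply/eqP; ring.
Qed.

(** [s] is the parameter of the foot of the perpendicular from [x] to the line of [g], possibly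
    outside [0, 1]; orthogonal projection does not increase distances. *)
Lemma edist_proj g x : g.1 <> g.2 ->
  exists s : R, forall t, seg_len g * `|t - s| <= edist x (gam g t).
Proof.
move=> /seg_len_gt0 L0; have L2 := edist_sqr g.1 g.2; rewrite -/(seg_len g) in L2.
set L := seg_len g in L0 L2 *.
pose e1 := g.2.1 - g.1.1; pose e2 := g.2.2 - g.1.2.
exists (((x.1 - g.1.1) * e1 + (x.2 - g.1.2) * e2) / L ^+ 2) => t.
set s := _ / _; have sL : s * L ^+ 2 = (x.1 - g.1.1) * e1 + (x.2 - g.1.2) * e2.
  by rewrite divfK // gt_eqF // exprn_gt0.
rewrite -ler_sqr ?nnegrE ?edist_ge0 ?mulr_ge0 ?(ltW L0) //.
rewrite exprMn real_normK ?num_real // (edist_sqr x (gam g t)).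
rewrite -(ler_pM2r (exprn_gt0 2 L0)).
pose v1 := x.1 - (gam g t).1; pose v2 := x.2 - (gam g t).2.
have -> : L ^+ 2 * (t - s) ^+ 2 * L ^+ 2 = (v1 * e1 + v2 * e2) ^+ 2.
  have -> : L ^+ 2 * (t - s) ^+ 2 * L ^+ 2 = (t * L ^+ 2 - s * L ^+ 2) ^+ 2 by ring.
  by rewrite sL L2 /v1 /v2 /e1 /e2 /=; ring.
have -> : L ^+ 2 = e1 ^+ 2 + e2 ^+ 2 by rewrite L2 /e1 /e2; ring.
rewrite -/v1 -/v2 -subr_ge0.
have -> : (v1 ^+ 2 + v2 ^+ 2) * (e1 ^+ 2 + e2 ^+ 2) - (v1 * e1 + v2 * e2) ^+ 2 =
  (v1 * e2 - v2 * e1) ^+ 2 by ring.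
exact: sqr_ge0.
Qed.

(** For nonparallel directions the cross product [D] bounds from below the distance from a point of
    one segment to the line of the other. Parallel segments with a single common point leave it in
    opposite directions, so that c = 1. *)
Lemma corner_angle g h (p q : R) : g.1 <> g.2 -> h.1 <> h.2 ->
  0 <= p <= 1 -> 0 <= q <= 1 -> gam h p = gam g q ->
  (forall z, seg_set g z -> seg_set h z -> z = gam h p) ->
  exists2 c : R, 0 < c & forall t t', 0 <= t <= 1 -> 0 <= t' <= 1 ->
    c * (edist (gam h t) (gam h p) + edist (gam g t') (gam h p)) <=
    edist (gam h t) (gam g t').
Proof.
move=> gn hn p01 q01 pq huniq.
have Lg := seg_len_gt0 gn; have Lh := seg_len_gt0 hn.
have Lg2 := edist_sqr g.1 g.2; rewrite -/(seg_len g) in Lg2.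
have Lh2 := edist_sqr h.1 h.2; rewrite -/(seg_len h) in Lh2.
pose e1 := h.2.1 - h.1.1; pose e2 := h.2.2 - h.1.2.
pose f1 := g.2.1 - g.1.1; pose f2 := g.2.2 - g.1.2.
have {}Lh2 : seg_len h ^+ 2 = e1 ^+ 2 + e2 ^+ 2 by rewrite Lh2 /e1 /e2; ring.
have {}Lg2 : seg_len g ^+ 2 = f1 ^+ 2 + f2 ^+ 2 by rewrite Lg2 /f1 /f2; ring.
move: (pq) => [pq1 pq2].
have xy t t' : edist (gam h t) (gam g t') ^+ 2 =
   ((t - p) * e1 - (t' - q) * f1) ^+ 2 + ((t - p) * e2 - (t' - q) * f2) ^+ 2.
  rewrite edist_sqr /=; congr (_ ^+ 2 + _ ^+ 2).
    rewrite [LHS](_ : _ = h.1.1 + p * e1 - (g.1.1 + q * f1) + ((t - p) * e1 - (t' - q) * f1)).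
      by rewrite pq1 subrr add0r.
    by rewrite /e1 /f1; ring.
  rewrite [LHS](_ : _ = h.1.2 + p * e2 - (g.1.2 + q * f2) + ((t - p) * e2 - (t' - q) * f2)).
    by rewrite pq2 subrr add0r.
  by rewrite /e2 /f2; ring.
pose D := e1 * f2 - e2 * f1.
have dx t : edist (gam h t) (gam h p) = seg_len h * `|t - p| by rewrite edist_gam.
have dy t : edist (gam g t) (gam h p) = seg_len g * `|t - q| by rewrite pq edist_gam.
have [D0|D0] := eqVneq D 0; last first.
  have Da : 0 < `|D| by rewrite normr_gt0.
  have LL : 0 < seg_len h * seg_len g by rewrite mulr_gt0.
  exists (`|D| / (2 * (seg_len h * seg_len g))).
    by rewrite divr_gt0 // mulr_gt0.
  move=> t t' _ _; rewrite dx dy; set d := edist _ _.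
  have d0 : 0 <= d by exact: edist_ge0.
  have h1 : `|D| * `|t - p| <= d * seg_len g.
    rewrite -ler_sqr ?nnegrE ?mulr_ge0 ?(ltW Lg) // -normrM real_normK ?num_real //.
    rewrite [in leRHS]exprMn /d xy Lg2 /D.
    set a := t - p; set b := t' - q.
    by have := sqr_ge0 ((a * e1 - b * f1) * f1 + (a * e2 - b * f2) * f2); lra.
  have h2 : `|D| * `|t' - q| <= d * seg_len h.
    rewrite -ler_sqr ?nnegrE ?mulr_ge0 ?(ltW Lh) // -normrM real_normK ?num_real //.
    rewrite [in leRHS]exprMn /d xy Lh2 /D.
    set a := t - p; set b := t' - q.
    by have := sqr_ge0 ((a * e1 - b * f1) * e1 + (a * e2 - b * f2) * e2); lra.
  rewrite mulrAC ler_pdivrMr ?mulr_gt0 //.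
  have := ler_wpM2l (ltW Lh) h1; have := ler_wpM2l (ltW Lg) h2; lra.
pose l := (e1 * f1 + e2 * f2) / seg_len g ^+ 2.
have g2 : seg_len g ^+ 2 != 0 by rewrite gt_eqF // exprn_gt0.
have lL : l * seg_len g ^+ 2 = e1 * f1 + e2 * f2 by rewrite divfK.
have E1 : e1 = l * f1.
  apply: (mulIf g2); rewrite mulrAC lL Lg2.
  have -> : (e1 * f1 + e2 * f2) * f1 = e1 * (f1 ^+ 2 + f2 ^+ 2) - f2 * D by rewrite /D; ring.
  by rewrite D0 mulr0 subr0.
have E2 : e2 = l * f2.
  apply: (mulIf g2); rewrite mulrAC lL Lg2.
  have -> : (e1 * f1 + e2 * f2) * f2 = e2 * (f1 ^+ 2 + f2 ^+ 2) + f1 * D by rewrite /D; ring.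
  by rewrite D0 mulr0 addr0.
have l0 : l != 0.
  apply/eqP => l0; move: Lh2; rewrite E1 E2 l0 !mul0r expr0n addr0 => /eqP.
  by rewrite sqrf_eq0 gt_eqF.
have ggam a : gam g (q + a * l) = gam h (p + a).
  have -> : gam h (p + a) = ((gam h p).1 + a * e1, (gam h p).2 + a * e2).
    by rewrite /gam /=; congr pair; rewrite /e1 /e2; ring.
  rewrite pq E1 E2 /gam /=; congr pair; rewrite /f1 /f2; ring.
(* In the parameter of [g] the displacements from the corner are (t - p) l and t' - q. If they had
   the same sign, the shorter one would end at a second common point of the segments. *)
have key t t' : 0 <= t <= 1 -> 0 <= t' <= 1 -> (t - p) * l * (t' - q) <= 0.
  move=> t01 t'01; rewrite leNgt; apply/negP => pos.
  move: (t01) (t'01) (p01) (q01) => ht ht' hp hq.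
  set a := (t - p) * l in pos; set b := t' - q in pos.
  have bt : t' = q + b by rewrite /b; ring.
  have a0 : a != 0 by apply/eqP => a0; move: pos; rewrite a0 mul0r ltxx.
  have b0 : b != 0 by apply/eqP => b0; move: pos; rewrite b0 mulr0 ltxx.
  have [ab|ab] := leP `|a| `|b|.
    have : gam h t = gam h p.
      apply: huniq; last by exists t; rewrite //= in_itv.
      exists (q + a); last by rewrite /a ggam; congr gam; ring.
      rewrite /= ?in_itv /=; move: ab pos ht' hq; rewrite bt.
      by case: (ltrgt0P a) a0; case: (ltrgt0P b) b0 => //; nra.
    move=> e; have := edist_gam h t p; rewrite e edistxx => /esym/eqP.
    rewrite mulf_eq0 gt_eqF //= normr_eq0 => /eqP tp.
    by move: a0; rewrite /a tp mul0r eqxx.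
  have ta : t = p + a / l by rewrite /a mulfK //; ring.
  have al : a / l = t - p by rewrite /a mulfK.
  pose w := b / l.
  have : gam g t' = gam h p.
    apply: huniq; first by exists t'; rewrite //= in_itv.
    exists (p + w); last by rewrite -ggam /w divfK // bt.
    have wa : 0 < w * (t - p).
      have -> : w * (t - p) = a * b * (l^-1) ^+ 2 by rewrite -al /w; ring.
      by rewrite mulr_gt0 // exprn_even_gt0 //= invr_eq0.
    have wl : `|w| <= `|t - p|.
      rewrite -al /w (normrM b) (normrM a); apply: ler_wpM2r; [exact: normr_ge0|exact: ltW].
    rewrite /= ?in_itv /=; move: wl wa ht hp; clear; move: w => w.
    have [tp|tp] := leP 0 (t - p).
      have [w0|w0] := leP 0 w; first by rewrite !ger0_norm // => *; lra.
      by have := mulr_le0_ge0 (ltW w0) tp => hh _; rewrite ltNge hh.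
    have [w0|w0] := leP 0 w; last by rewrite !ltr0_norm // => *; lra.
    by have := mulr_ge0_le0 w0 (ltW tp) => hh _; rewrite ltNge hh.
  move=> e; have := dy t'; rewrite e edistxx => /esym/eqP.
  rewrite mulf_eq0 gt_eqF //= normr_eq0 => /eqP tp.
  by move: b0; rewrite /b tp eqxx.
exists 1 => // t t' t01 t'01; rewrite mul1r dx dy.
have := key t t' t01 t'01 => k.
have : (seg_len h * `|t - p|) ^+ 2 = seg_len g ^+ 2 * ((t - p) * l) ^+ 2.
  rewrite exprMn real_normK ?num_real // Lh2 E1 E2 Lg2; ring.
rewrite -[((t - p) * l) ^+ 2]real_normK ?num_real // -[RHS]exprMn => /eqP.
rewrite eqrXn2 ?mulr_ge0 ?(ltW Lg) ?(ltW Lh) // => /eqP ->.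
rewrite -ler_sqr ?nnegrE ?edist_ge0 ?addr_ge0 ?mulr_ge0 ?(ltW Lg) //.
rewrite xy E1 E2 -mulrDr exprMn.
have -> : ((t - p) * (l * f1) - (t' - q) * f1) ^+ 2 + ((t - p) * (l * f2) - (t' - q) * f2) ^+ 2 =
  seg_len g ^+ 2 * ((t - p) * l - (t' - q)) ^+ 2 by rewrite Lg2; ring.
rewrite ler_wpM2l ?sqr_ge0 //.
move: k; move: ((t - p) * l) (t' - q) => a b ab.
rewrite sqrrD !real_normK ?num_real // sqrrB -normrM ler0_norm //.
by rewrite mulNrn.
Qed.

Lemma continuous_edist (T : topologicalType) (f g : T -> pt) :
  continuous f -> continuous g -> continuous (fun t => edist (f t) (g t)).
Proof.
move=> cf cg.
have c1 (k : T -> pt) : continuous k -> continuous (fun t => (k t).1).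
  by move=> ck t; apply: (@continuous_comp _ _ _ k fst); [exact: ck|exact: cvg_fst].
have c2 (k : T -> pt) : continuous k -> continuous (fun t => (k t).2).
  by move=> ck t; apply: (@continuous_comp _ _ _ k snd); [exact: ck|exact: cvg_snd].
pose F t := ((f t).1 - (g t).1) * ((f t).1 - (g t).1) +
            ((f t).2 - (g t).2) * ((f t).2 - (g t).2).
have cF : continuous F.
  move=> t; apply: cvgD; apply: cvgM; apply: cvgB;
    by [exact: c1|exact: c2].
move=> t; have -> : (fun t => edist (f t) (g t)) = (fun t => Num.sqrt (F t)).
  by apply/funext => x; rewrite /edist /F !expr2.
by apply: (@continuous_comp _ _ _ F (@Num.sqrt R)); [exact: cF|exact: sqrt_continuous].
Qed.

Lemma continuous_gam g : continuous (gam g).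
Proof.
have lin (a b : R) : continuous (fun t : R => a + t * b).
  move=> t; apply: cvgD; first exact: cvg_cst.
  by apply: (@cvgM _ _ _ _ id (fun=> b)); [exact: cvg_id|exact: cvg_cst].
by move=> t; exact: cvg_pair (lin _ _ t) (lin _ _ t).
Qed.

(** The sum is continuous on a compact cube and vanishes only where all three points coincide. Two
    of the segments may still meet. *)
Lemma separated_triple h h' g :
  ~ (exists z, [/\ seg_set h z, seg_set h' z & seg_set g z]) ->
  exists2 c : R, 0 < c & forall t t' r, 0 <= t <= 1 -> 0 <= t' <= 1 ->
    0 <= r <= 1 ->
    c <= edist (gam h t) (gam g r) + edist (gam h' t') (gam g r).
Proof.
move=> no; pose I := `[(0 : R), 1]%classic.
pose F (v : (R * R) * R) : R :=
  edist (gam h v.1.1) (gam g v.2) + edist (gam h' v.1.2) (gam g v.2).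
have cF : continuous F.
  have g1 (s : segment R) (pr : (R * R) * R -> R) : continuous pr ->
      continuous (fun v => gam s (pr v)).
    by move=> cpr v; apply: (@continuous_comp _ _ _ pr (gam s)); [exact: cpr|exact: continuous_gam].
  have p11 : continuous (fun v : (R * R) * R => v.1.1).
    by move=> v; apply: (@continuous_comp _ _ _ fst fst); exact: cvg_fst.
  have p12 : continuous (fun v : (R * R) * R => v.1.2).
    by move=> v; apply: (@continuous_comp _ _ _ fst snd); [exact: cvg_fst|exact: cvg_snd].
  have p2 : continuous (fun v : (R * R) * R => v.2) by move=> v; exact: cvg_snd.
  have cA := continuous_edist (g1 h _ p11) (g1 g _ p2).
  have cB := continuous_edist (g1 h' _ p12) (g1 g _ p2).
  by move=> v; exact: cvgD (cA v) (cB v).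
have cK : compact ((I `*` I) `*` I).
  by apply: compact_setX; [apply: compact_setX|]; exact: segment_compact.
have K0 : ((I `*` I) `*` I) !=set0.
  by exists ((0, 0), 0); rewrite /I /= !in_itv /= lexx ler01.
have [m] := compact_EVT_min K0 cK (continuous_subspaceT cF).
rewrite inE => -[[m1 m2] m3] hm; exists (F m).
  rewrite lt_def addr_ge0 ?edist_ge0 // andbT; apply/eqP => /eqP.
  rewrite paddr_eq0 ?edist_ge0 // => /andP[/eqP/edist_eq0 e1 /eqP/edist_eq0 e2].
  apply: no; exists (gam g m.2); split; [exists m.1.1|exists m.1.2|exists m.2] => //.
move=> t t' r t01 t'01 r01; have := hm ((t, t'), r); apply.
by rewrite inE /I /= !in_itv.
Qed.

End Geometry.

(** * Discrete energy estimates, uniform in the mesh *)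

Section DiscreteEstimate.
Variable R : realType.
Notation pt := (R * R)%type.
Implicit Types (g h : segment R) (x y P : pt) (n : nat).

Definition sample g n (j : nat) : pt := gam g (j%:R / n%:R).

(* Kernels that behave like [d^(-1/2)] beyond the unit scale, uniformly. *)
Definition kernel_class (A : R) (k : R -> R) : Prop :=
  [/\ forall d, 0 <= d -> 0 <= k d,
      forall d d', 0 <= d -> d <= d' -> k d' <= k d,
      forall d, 0 <= d -> k d <= A * isq (1 + d) &
      forall d d', 0 <= d -> d <= d' ->
        (k d - k d') * (1 + d) <= A * (1 + d' - d) * isq (1 + d)].

Lemma kernel_class_ge0 A k : kernel_class A k -> 0 <= A.
Proof.
move=> [k0 _ kA _]; have := le_trans (k0 0 (lexx 0)) (kA 0 (lexx 0)).
by rewrite pmulr_lge0 // isq_gt0 // addr0.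
Qed.

(** For d <= d' write 1 + d' = (1 + d) + (d' - d): the first part is controlled by the slope
    estimate of the class, the second by the size of k d. The factor 1 + d + d' is what the geometry
    later bounds from below. *)
Lemma kernel_diff A k d d' D : kernel_class A k -> 0 <= d -> 0 <= d' ->
  `|d - d'| <= D ->
  `|k d - k d'| * (1 + d + d') <= 4 * A * (1 + D) * (isq (1 + d) + isq (1 + d')).
Proof.
move=> kc; have A0 := kernel_class_ge0 kc; case: kc => k0 kd kA kL.
wlog dd' : d d' / d <= d' => [wl|] d0 d'0 dD.
  have [dd'|dd'] := leP d d'; first exact: wl.
  have dD' : `|d' - d| <= D by rewrite distrC.
  have := wl d' d (ltW dd') d'0 d0 dD'.
  by rewrite (distrC (k d')) (addrC (isq (1 + d'))) [1 + d' + d]addrAC.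
have D0 : d' - d <= D by move: dD; rewrite distrC ger0_norm ?subr_ge0.
have i0 := isq_ge0 (1 + d); have i0' := isq_ge0 (1 + d').
rewrite ger0_norm ?subr_ge0 ?kd //.
have h1 := kL d d' d0 dd'; have h2 := kA d d0; have h3 := k0 d' d'0.
have h4 := kd _ _ d0 dd'.
have dd0 : 0 <= d' - d by rewrite subr_ge0.
set kd1 := k d in h1 h2 h4 *; set kd2 := k d' in h1 h3 h4 *.
set I := isq (1 + d) in i0 h1 h2 *; set I' := isq (1 + d') in i0' *.
apply: (@le_trans _ _ (2 * ((kd1 - kd2) * (1 + d) + (kd1 - kd2) * (d' - d)))).
  have -> : 2 * ((kd1 - kd2) * (1 + d) + (kd1 - kd2) * (d' - d)) =
    (kd1 - kd2) * (2 * (1 + d')) by ring.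
  by rewrite ler_wpM2l ?subr_ge0 //; lra.
have h5 : (kd1 - kd2) * (d' - d) <= A * I * (d' - d) by rewrite ler_wpM2r //; lra.
have AI : 0 <= A * I by rewrite mulr_ge0.
have AI' : 0 <= A * I' by rewrite mulr_ge0.
have h6 : A * I * (1 + (d' - d)) <= A * I * (1 + D) by rewrite ler_wpM2l // lerD2l.
have h7 : 0 <= A * I' * (1 + D) by rewrite mulr_ge0 //; lra.
lra.
Qed.

(** In units of 1/n the points of [g] are spaced by [seg_len g], and [edist_proj] moves [x] to their
    line; this turns sums over sample points into lattice sums. *)
Lemma row_sum_bound g : g.1 <> g.2 -> exists2 C : R, 0 <= C &
  forall n x, (0 < n)%N ->
    \sum_(j < n) isq (1 + n%:R * edist x (sample g n j)) <= C * Num.sqrt n%:R.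
Proof.
move=> gn; have L0 := seg_len_gt0 gn; set L := seg_len g in L0.
have C0 : 0 <= 2 * (1 + 2 / L) by rewrite mulr_ge0 // addr_ge0 // divr_ge0 // ltW.
exists (2 * (1 + 2 / L) * Num.sqrt (1 + L)); first by rewrite mulr_ge0 ?sqrtr_ge0.
move=> n x n0; have nr : (0 : R) < n%:R by rewrite ltr0n.
have [s hs] := edist_proj x gn.
have d1 (j : nat) : L * `|j%:R - n%:R * s| <= n%:R * edist x (sample g n j).
  apply: le_trans (ler_wpM2l (ltW nr) (hs _)).
  rewrite mulrCA ler_wpM2l ?(ltW L0) // -[X in X * `|_ - s|]ger0_norm ?(ltW nr) // -normrM.
  by rewrite mulrBr mulrCA mulfV ?mulr1 // gt_eqF.
apply: le_trans (_ : _ <= 2 * (1 + 2 / L) * Num.sqrt (1 + L * n%:R)) _.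
  apply: le_trans (sum_isq_dist L0 n (n%:R * s)); apply: ler_sum => j _.
  have h0 : 0 <= L * `|j%:R - n%:R * s| by rewrite mulr_ge0 // ltW.
  by apply: isq_anti; [lra|rewrite lerD2l].
rewrite -[leRHS]mulrA ler_wpM2l // -sqrtrM; last by lra.
rewrite ler_wsqrtr // mulrDl mul1r lerD2r.
by rewrite ler1n.
Qed.

Lemma corner_row_bound g q : g.1 <> g.2 -> exists2 C : R, 0 <= C &
  forall n x, (0 < n)%N ->
    \sum_(j < n) isq (1 + n%:R * edist x (sample g n j)) *
      isq ((1 + n%:R * edist x (gam g q) + (1 + n%:R * edist (sample g n j) (gam g q))) *
           (1 + n%:R * edist (sample g n j) (gam g q))) <=
    C * isq (1 + n%:R * edist x (gam g q)).
Proof.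
move=> gn; have L0 := seg_len_gt0 gn; set L := seg_len g in L0.
exists (28 * (2 * (1 + 2 / L))).
  by rewrite !mulr_ge0 // addr_ge0 // divr_ge0 // ltW.
move=> n x n0; have nr : (0 : R) < n%:R by rewrite ltr0n.
have [s hs] := edist_proj x gn.
have d1 (j : nat) : L * `|j%:R - n%:R * s| <= n%:R * edist x (sample g n j).
  apply: le_trans (ler_wpM2l (ltW nr) (hs _)).
  rewrite mulrCA ler_wpM2l ?(ltW L0) // -[X in X * `|_ - s|]ger0_norm ?(ltW nr) // -normrM.
  by rewrite mulrBr mulrCA mulfV ?mulr1 // gt_eqF.
have d2 (j : nat) : n%:R * edist (sample g n j) (gam g q) = L * `|j%:R - n%:R * q|.
  rewrite /sample edist_gam mulrCA -/L; congr (_ * _).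
  rewrite -[X in X * _]ger0_norm ?(ltW nr) // -normrM.
  by rewrite mulrBr mulrCA mulfV ?mulr1 // gt_eqF.
under eq_bigr => j _ do rewrite d2.
apply: (@sum_isq_corner _ _ L0 n (n%:R * q) (n%:R * s) _
   (fun j => n%:R * edist x (sample g n j))).
- by rewrite lerDl mulr_ge0 ?edist_ge0 // ltW.
- exact: d1.
- move=> j; rewrite -d2 opprD addrACA subrr add0r -mulrBr normrM ger0_norm ?(ltW nr) //.
  by rewrite ler_wpM2l ?(ltW nr) // edist_diff.
Qed.

Lemma corner_inv_sqr_bound g q : g.1 <> g.2 -> exists2 C : R, 0 <= C &
  forall n (A : R), (0 < n)%N -> 1 <= A ->
    \sum_(j < n) ((A + (1 + n%:R * edist (sample g n j) (gam g q))) ^+ 2)^-1 <= C / A.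
Proof.
move=> gn; have L0 := seg_len_gt0 gn; set L := seg_len g in L0.
exists (2 * (1 + 2 / L)).
  by rewrite !mulr_ge0 // addr_ge0 // divr_ge0 // ltW.
move=> n A n0 A1; have nr : (0 : R) < n%:R by rewrite ltr0n.
apply: le_trans (sum_inv_sqr_dist L0 n (n%:R * q) A1).
apply: ler_sum => j _; rewrite le_eqVlt; apply/orP; left; apply/eqP.
congr (_ ^+ 2)^-1; congr (_ + (_ + _)).
rewrite /sample edist_gam mulrCA -/L; congr (_ * _).
rewrite -[X in X * _]ger0_norm ?(ltW nr) // -normrM.
by rewrite mulrBr mulrCA mulfV ?mulr1 // gt_eqF.
Qed.

Lemma sqrD_le2 (a b : R) : (a + b) ^+ 2 <= 2 * (a ^+ 2 + b ^+ 2).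
Proof. by have := sqr_ge0 (a - b); nra. Qed.

(** Squaring the factor 1 + D of [kernel_diff] costs 2 (1 + D^2), which the denominator cancels;
    hence 64 = 4^2 * 2 * 2. [S] stands for the lower bound of 1 + d + d', up to the factor K, that
    the position of the three segments provides. *)
Lemma triple_reduce (A K : R) (k : R -> R) (h h' g : segment R) n (u : nat -> R)
    (S : nat -> nat -> nat -> R) :
  kernel_class A k -> 0 <= K -> (forall i i' j, 0 < S i i' j) ->
  (forall i i' j, (i < n)%N -> (i' < n)%N -> (j < n)%N ->
     S i i' j <= K * (1 + n%:R * edist (sample h n i) (sample g n j)
                        + n%:R * edist (sample h' n i') (sample g n j))) ->
  \sum_(i < n) \sum_(i' < n)
    (\sum_(j < n) (k (n%:R * edist (sample h n i) (sample g n j))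
                 - k (n%:R * edist (sample h' n i') (sample g n j))) * u j) ^+ 2
    / ((n%:R * edist (sample h n i) (sample h' n i')) ^+ 2 + 1) <=
  64 * A ^+ 2 * K ^+ 2 *
  (\sum_(i < n) \sum_(i' < n)
     (\sum_(j < n) isq (1 + n%:R * edist (sample h n i) (sample g n j)) / S i i' j * `|u j|) ^+ 2
 + \sum_(i < n) \sum_(i' < n)
     (\sum_(j < n) isq (1 + n%:R * edist (sample h' n i') (sample g n j)) / S i i' j * `|u j|) ^+ 2).
Proof.
move=> kc K0 S0 SK; have A0 := kernel_class_ge0 kc.
rewrite -big_split mulr_sumr; apply: ler_sum => i _ /=.
rewrite -big_split mulr_sumr; apply: ler_sum => i' _ /=.
set D := n%:R * edist (sample h n i) (sample h' n i').
have D0 : 0 <= D by rewrite mulr_ge0 ?edist_ge0.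
have D1 : 0 < D ^+ 2 + 1 by rewrite ltr_wpDl ?sqr_ge0.
set s1 := \sum_(j < n) _ / _ * _; set s2 := \sum_(j < n) _ / _ * _.
have H : `|\sum_(j < n) (k (n%:R * edist (sample h n i) (sample g n j))
                 - k (n%:R * edist (sample h' n i') (sample g n j))) * u j|
     <= 4 * A * K * (1 + D) * (s1 + s2).
  apply: le_trans (ler_norm_sum _ _ _) _; rewrite -big_split mulr_sumr /=.
  apply: ler_sum => j _; rewrite normrM.
  set d := n%:R * edist (sample h n i) _; set d' := n%:R * edist (sample h' n i') _.
  have d0 : 0 <= d by rewrite mulr_ge0 ?edist_ge0.
  have d0' : 0 <= d' by rewrite mulr_ge0 ?edist_ge0.
  have dD : `|d - d'| <= D.
    by rewrite -mulrBr normrM ger0_norm // ler_wpM2l // edist_diff.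
  have kk := kernel_diff kc d0 d0' dD.
  have sk := SK i i' j (ltn_ord i) (ltn_ord i') (ltn_ord j); rewrite -/d -/d' in sk.
  rewrite -mulrDl mulrA ler_wpM2r // -mulrDl mulrA ler_pdivlMr //.
  apply: (@le_trans _ _ (`|k d - k d'| * (K * (1 + d + d')))).
    by rewrite ler_wpM2l.
  rewrite mulrCA; apply: le_trans (ler_wpM2l K0 kk) _.
  by rewrite le_eqVlt; apply/orP; left; apply/eqP; ring.
rewrite ler_pdivrMr // -real_normK ?num_real //.
have s0 : 0 <= s1 + s2.
  by rewrite addr_ge0 // sumr_ge0 // => j _; rewrite !mulr_ge0 ?isq_ge0 // invr_ge0 ltW.
have c0 : 0 <= 4 * A * K * (1 + D) * (s1 + s2).
  by rewrite !mulr_ge0 // addr_ge0.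
apply: (@le_trans _ _ ((4 * A * K * (1 + D) * (s1 + s2)) ^+ 2)).
  by rewrite ler_sqr ?nnegrE.
apply: (@le_trans _ _ (16 * A ^+ 2 * K ^+ 2 * (2 * (s1 ^+ 2 + s2 ^+ 2)) * (2 * (1 + D ^+ 2)))).
  have -> : (4 * A * K * (1 + D) * (s1 + s2)) ^+ 2 =
    16 * A ^+ 2 * K ^+ 2 * (s1 + s2) ^+ 2 * (1 + D) ^+ 2 by ring.
  have AK : 0 <= 16 * A ^+ 2 * K ^+ 2 by rewrite mulr_ge0 ?sqr_ge0 // mulr_ge0 ?sqr_ge0.
  apply: ler_pM; rewrite ?sqr_ge0 //.
  - by rewrite mulr_ge0 ?sqr_ge0.
  - by rewrite ler_wpM2l // sqrD_le2.
  - by have := sqrD_le2 1 D; rewrite expr1n.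
by rewrite le_eqVlt; apply/orP; left; apply/eqP; ring.
Qed.

(** A discrete Gagliardo seminorm in units of 1/n. The added 1 regularises the diagonal and amounts
    to n^-2 in the original scale. *)
Definition energy (k : R -> R) (h h' g : segment R) n (u : nat -> R) : R :=
  \sum_(i < n) \sum_(i' < n)
    (\sum_(j < n) (k (n%:R * edist (sample h n i) (sample g n j))
                 - k (n%:R * edist (sample h' n i') (sample g n j))) * u j) ^+ 2
    / ((n%:R * edist (sample h n i) (sample h' n i')) ^+ 2 + 1).

Lemma sample_itv n j : (j < n)%N -> 0 <= (j%:R / n%:R : R) <= 1.
Proof.
move=> jn; have n0 : (0 : R) < n%:R by rewrite ltr0n (leq_trans _ jn).
by rewrite divr_ge0 //= ler_pdivrMr // mul1r ler_nat ltnW.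
Qed.

Lemma schur_sample h g : h.1 <> h.2 -> g.1 <> g.2 -> exists2 C : R, 0 <= C &
  forall n (u : nat -> R), (0 < n)%N ->
    \sum_(i < n) (\sum_(j < n)
      isq (1 + n%:R * edist (sample h n i) (sample g n j)) * u j) ^+ 2 <=
    C * n%:R * \sum_(j < n) u j ^+ 2.
Proof.
move=> hn gn; have [C1 C10 hC1] := row_sum_bound gn.
have [C2 C20 hC2] := row_sum_bound hn.
exists (C1 * C2); first exact: mulr_ge0.
move=> n u n0; have -> : C1 * C2 * n%:R = C1 * Num.sqrt n%:R * (C2 * Num.sqrt n%:R).
  by rewrite mulrACA -expr2 sqr_sqrtr ?ler0n.
apply: (@schur_test _ _ _ (fun (i j : 'I_n) =>
   isq (1 + n%:R * edist (sample h n i) (sample g n j))) (fun j => u j)).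
- by move=> *; exact: isq_ge0.
- by rewrite mulr_ge0 ?sqrtr_ge0.
- by move=> i; exact: hC1.
- by move=> j; under eq_bigr do rewrite edistC; exact: hC2.
Qed.

(** Here d + d' >= c n, so [S] can be n. The sum over the index absent from the summand gives n and
    [schur_sample] another n, against n^-2. *)
Lemma energy_separated (A : R) h h' g : h.1 <> h.2 -> h'.1 <> h'.2 -> g.1 <> g.2 ->
  ~ (exists z, [/\ seg_set h z, seg_set h' z & seg_set g z]) ->
  exists2 C : R, 0 <= C & forall n k (u : nat -> R), (0 < n)%N -> kernel_class A k ->
    energy k h h' g n u <= C * \sum_(j < n) u j ^+ 2.
Proof.
move=> hn h'n gn no; have [c c0 hc] := separated_triple no.
have [C1 C10 hC1] := schur_sample hn gn; have [C2 C20 hC2] := schur_sample h'n gn.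
have ci : 0 <= c^-1 by rewrite invr_ge0 ltW.
exists (64 * A ^+ 2 * c^-1 ^+ 2 * (C1 + C2)).
  by rewrite mulr_ge0 ?addr_ge0 // mulr_ge0 ?sqr_ge0 // mulr_ge0 ?sqr_ge0.
move=> n k u n0 kc; have nr : (0 : R) < n%:R by rewrite ltr0n.
apply: le_trans (@triple_reduce A c^-1 k h h' g n u (fun _ _ _ => n%:R) kc ci _ _) _ => //.
  move=> i i' j il i'l jl; rewrite mulrC ler_pdivlMr // -addrA -mulrDr.
  apply: (@le_trans _ _ (n%:R * (edist (sample h n i) (sample g n j)
     + edist (sample h' n i') (sample g n j)))); last by rewrite lerDr.
  by rewrite ler_wpM2l ?(ltW nr) // hc ?sample_itv.
rewrite -[leRHS]mulrA; apply: ler_wpM2l.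
  by rewrite mulr_ge0 ?sqr_ge0 // mulr_ge0 ?sqr_ge0.
have uu : \sum_(j < n) u j ^+ 2 = \sum_(j < n) `|u j| ^+ 2.
  by apply: eq_bigr => j _; rewrite real_normK ?num_real.
rewrite mulrDl; apply: lerD.
  have -> : \sum_(i < n) \sum_(i' < n) (\sum_(j < n)
     isq (1 + n%:R * edist (sample h n i) (sample g n j)) / n%:R * `|u j|) ^+ 2 =
    n%:R^-1 * \sum_(i < n) (\sum_(j < n)
     isq (1 + n%:R * edist (sample h n i) (sample g n j)) * `|u j|) ^+ 2.
    rewrite mulr_sumr; apply: eq_bigr => i _; rewrite sumr_const card_ord.
    under eq_bigr do rewrite mulrAC; rewrite -mulr_suml exprMn -mulr_natl.
    by field; rewrite gt_eqF.
  rewrite mulrC ler_pdivrMr // mulrAC; apply: le_trans (hC1 n (fun j => `|u j|) n0) _.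
  by rewrite uu.
have -> : \sum_(i < n) \sum_(i' < n) (\sum_(j < n)
     isq (1 + n%:R * edist (sample h' n i') (sample g n j)) / n%:R * `|u j|) ^+ 2 =
    n%:R^-1 * \sum_(i < n) (\sum_(j < n)
     isq (1 + n%:R * edist (sample h' n i) (sample g n j)) * `|u j|) ^+ 2.
  rewrite exchange_big /=.
  rewrite mulr_sumr; apply: eq_bigr => i _; rewrite sumr_const card_ord.
  under eq_bigr do rewrite mulrAC; rewrite -mulr_suml exprMn -mulr_natl.
  by field; rewrite gt_eqF.
rewrite mulrC ler_pdivrMr // mulrAC; apply: le_trans (hC2 n (fun j => `|u j|) n0) _.
by rewrite uu.
Qed.

Lemma schur_corner h h' g (p p' q : R) : h.1 <> h.2 -> h'.1 <> h'.2 -> g.1 <> g.2 ->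
  gam h p = gam g q -> gam h' p' = gam g q ->
  exists2 C : R, 0 <= C & forall n (u : nat -> R), (0 < n)%N ->
  \sum_(i < n) \sum_(i' < n)
     (\sum_(j < n) isq (1 + n%:R * edist (sample h n i) (sample g n j)) /
       ((1 + n%:R * edist (sample h n i) (gam g q)) +
        (1 + n%:R * edist (sample g n j) (gam g q)) +
        (1 + n%:R * edist (sample h' n i') (gam g q))) * u j) ^+ 2 <=
  C * \sum_(j < n) u j ^+ 2.
Proof.
move=> hn h'n gn hp h'p; have [C1 C10 hC1] := corner_row_bound q gn.
have [C2 C20 hC2] := corner_row_bound p hn; have [C3 C30 hC3] := corner_inv_sqr_bound p' h'n.
rewrite hp in hC2; rewrite h'p in hC3.
pose C := C1 + C2 + C3.
exists (C ^+ 3); first by rewrite exprn_ge0 // !addr_ge0.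
move=> n u n0.
have p1 (x y : pt) : 1 <= 1 + n%:R * edist x y.
  by rewrite lerDl mulr_ge0 ?edist_ge0.
have pp (x y : pt) : 0 < 1 + n%:R * edist x y by apply: lt_le_trans (p1 x y).
apply: (@schur_test3 _ _ _ _ (fun (i j : 'I_n) => isq (1 + n%:R * edist (sample h n i) (sample g n j)))
   (fun i : 'I_n => 1 + n%:R * edist (sample h n i) (gam g q))
   (fun i' : 'I_n => 1 + n%:R * edist (sample h' n i') (gam g q))
   (fun j : 'I_n => 1 + n%:R * edist (sample g n j) (gam g q)) (fun j => u j)) => //.
- by rewrite !addr_ge0.
- by move=> *; exact: isq_ge0.
- move=> i j; apply: le_trans (hC3 n _ n0 _) _.
    by rewrite -[leLHS]addr0; apply: lerD; [exact: p1|exact: ltW (pp _ _)].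
  by rewrite ler_wpM2r ?invr_ge0 ?(addr_ge0 (ltW (pp _ _)) (ltW (pp _ _))) // /C; lra.
- move=> i; apply: le_trans (hC1 n (sample h n i) n0) _.
  by rewrite ler_wpM2r ?isq_ge0 // /C; lra.
- move=> j; under eq_bigr do rewrite edistC (addrC (1 + _)).
  apply: le_trans (hC2 n (sample g n j) n0) _.
  by rewrite ler_wpM2r ?isq_ge0 // /C; lra.
Qed.

(** [S] is the sum of the three rescaled distances to the corner, each raised by 1 to stay positive;
    these three units explain 3 + K. *)
Lemma energy_corner (A K : R) h h' g (p p' q : R) :
  h.1 <> h.2 -> h'.1 <> h'.2 -> g.1 <> g.2 ->
  gam h p = gam g q -> gam h' p' = gam g q -> 0 <= K ->
  (forall t t' r, 0 <= t <= 1 -> 0 <= t' <= 1 -> 0 <= r <= 1 ->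
    edist (gam h t) (gam g q) + edist (gam h' t') (gam g q) + edist (gam g r) (gam g q) <=
    K * (edist (gam h t) (gam g r) + edist (gam h' t') (gam g r))) ->
  exists2 C : R, 0 <= C & forall n k (u : nat -> R), (0 < n)%N -> kernel_class A k ->
    energy k h h' g n u <= C * \sum_(j < n) u j ^+ 2.
Proof.
move=> hn h'n gn hp h'p K0 hK.
have [C1 C10 hC1] := schur_corner hn h'n gn hp h'p.
have [C2 C20 hC2] := schur_corner h'n hn gn h'p hp.
exists (64 * A ^+ 2 * (3 + K) ^+ 2 * (C1 + C2)).
  by rewrite mulr_ge0 ?addr_ge0 // mulr_ge0 ?sqr_ge0 // mulr_ge0 ?sqr_ge0.
move=> n k u n0 kc; have nr : (0 : R) < n%:R by rewrite ltr0n.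
have pp (x y : pt) : 0 < 1 + n%:R * edist x y.
  have h0 : 0 <= n%:R * edist x y by rewrite mulr_ge0 ?edist_ge0.
  by lra.
have K3 : 0 <= 3 + K by rewrite addr_ge0.
apply: le_trans (@triple_reduce A (3 + K) k h h' g n u (fun i i' j =>
  ((1 + n%:R * edist (sample h n i) (gam g q)) +
   (1 + n%:R * edist (sample g n j) (gam g q)) +
   (1 + n%:R * edist (sample h' n i') (gam g q)))) kc K3 _ _) _ => //.
- by move=> i i' j; rewrite addr_gt0 ?pp // addr_gt0 ?pp.
- move=> i i' j il i'l jl.
  have := ler_wpM2l (ltW nr) (hK _ _ _ (sample_itv il) (sample_itv i'l) (sample_itv jl)).
  rewrite -/(sample h n i) -/(sample h' n i') -/(sample g n j).
  set a := edist (sample h n i) (gam _ _); set b := edist (sample g n j) _.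
  set c := edist (sample h' n i') (gam _ _); set d := edist _ _; set d' := edist _ _.
  have d0 : 0 <= n%:R * d by rewrite mulr_ge0 ?edist_ge0 // ltW.
  have d0' : 0 <= n%:R * d' by rewrite mulr_ge0 ?edist_ge0 // ltW.
  have -> : n%:R * (K * (d + d')) = K * (n%:R * d + n%:R * d') by ring.
  by rewrite !mulrDr; lra.
rewrite -[leRHS]mulrA; apply: ler_wpM2l.
  by rewrite mulr_ge0 ?sqr_ge0 // mulr_ge0 ?sqr_ge0.
have uu : \sum_(j < n) u j ^+ 2 = \sum_(j < n) `|u j| ^+ 2.
  by apply: eq_bigr => j _; rewrite real_normK ?num_real.
rewrite uu mulrDl; apply: lerD; first exact: (hC1 n (fun j => `|u j|) n0).
apply: le_trans (hC2 n (fun j => `|u j|) n0).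
rewrite exchange_big le_eqVlt; apply/orP; left; apply/eqP.
apply: eq_bigr => i' _; apply: eq_bigr => i _; congr (_ ^+ 2).
by apply: eq_bigr => j _; congr (_ / _ * _); ring.
Qed.

Lemma energy_same (A : R) g : g.1 <> g.2 ->
  exists2 C : R, 0 <= C & forall n k (u : nat -> R), (0 < n)%N -> kernel_class A k ->
    energy k g g g n u <= C * \sum_(j < n) u j ^+ 2.
Proof.
move=> gn; have L0 := seg_len_gt0 gn; set L := seg_len g in L0.
(* From 1 <= B^2 and 1 <= B^2 L follows 1 + l <= B^2 (1 + L l): decay in the distance L l becomes
   decay in the index l. *)
pose B := 1 + L^-1; have Li : 0 < L^-1 by rewrite invr_gt0.
exists (L ^- 2 * (2000 * (A * B) ^+ 2)).
  apply: mulr_ge0; first by rewrite invr_ge0 sqr_ge0.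
  by apply: mulr_ge0; [exact: ler0n|exact: sqr_ge0].
move=> n k u n0 kc; have A0 := kernel_class_ge0 kc; case: kc => k0 kd kA _.
case: n n0 => // p _; have nr : (0 : R) < p.+1%:R by rewrite ltr0n.
have dL (i j : nat) : p.+1%:R * edist (sample g p.+1 i) (sample g p.+1 j) = L * (dn i j)%:R.
  rewrite /sample edist_gam mulrCA -/L; congr (_ * _).
  rewrite -[X in X * _]ger0_norm ?(ltW nr) // -normrM mulrBr !(mulrCA p.+1%:R) mulfV ?gt_eqF // !mulr1.
  have [ij|ji] := leP i j.
    rewrite distrC -natrB // ger0_norm // /dn; congr (_%:R); move: ij; clear; lia.
  rewrite -natrB ?(ltnW ji) // ger0_norm // /dn; congr (_%:R); move: ji; clear; lia.
pose k' (l : nat) := k (L * l%:R).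
have Ll (l : nat) : 0 <= L * l%:R by rewrite mulr_ge0 // ltW.
have B2 : 1 <= B ^+ 2 /\ 1 <= B ^+ 2 * L.
  have e : B ^+ 2 * L = L + 2 + L^-1 by rewrite /B; field; rewrite gt_eqF.
  by rewrite e /B; split; nra.
have -> : energy k g g g p.+1 u = \sum_(i < p.+1) \sum_(i' < p.+1)
   (conv k' u p.+1 i - conv k' u p.+1 i') ^+ 2 / ((L * (dn i i')%:R) ^+ 2 + 1).
  apply: eq_bigr => i _; apply: eq_bigr => i' _; rewrite dL; congr (_ ^+ 2 / _).
  rewrite /conv -sumrB; apply: eq_bigr => j _; rewrite !dL mulrBl //.
have kA' l : k' l * Num.sqrt (1 + l%:R) <= A * B.
  have s0 : 0 <= Num.sqrt (1 + l%:R) :> R by exact: sqrtr_ge0.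
  apply: le_trans (ler_wpM2r s0 (kA _ (Ll l))) _; rewrite -mulrA ler_wpM2l //.
  have l1 : 0 < 1 + l%:R :> R by rewrite ltr_pwDl.
  rewrite -ler_pdivlMr ?sqrtr_gt0 //; apply: isq_le => //.
    by rewrite /B addr_ge0 // ltW.
  case: B2 => b1 b2; rewrite mulrDr mulr1 mulrA; apply: lerD => //.
  by rewrite ler_peMl.
apply: (@le_trans _ _ (L ^- 2 * \sum_(i < p.+1) \sum_(i' < p.+1)
   (conv k' u p.+1 i - conv k' u p.+1 i') ^+ 2 / (dn i i')%:R ^+ 2)); last first.
  rewrite -[leRHS]mulrA ler_wpM2l ?invr_ge0 ?sqr_ge0 //; apply: conv_energy => // l.
    exact: k0.
  by apply: kd => //; rewrite ler_wpM2l ?(ltW L0) // ler_nat.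
rewrite mulr_sumr; apply: ler_sum => i _; rewrite mulr_sumr; apply: ler_sum => i' _.
have [d0|d0] := posnP (dn i i').
  have -> : (i : nat) = i' by move: d0; rewrite /dn; lia.
  by rewrite subrr expr0n !mul0r mulr0.
rewrite mulrCA ler_wpM2l ?sqr_ge0 // -invfM -exprMn lef_pV2 ?posrE ?lerDl //.
  by rewrite ltr_wpDl ?sqr_ge0.
by rewrite exprn_gt0 // mulr_gt0 // ltr0n.
Qed.

(** A corner between [g] and [h] suffices, whatever [h'] is: [corner_angle] bounds |x - P| + |y - P|
    by |x - y| / c, and |x' - P| <= |x' - y| + |y - P|. *)
Lemma corner_excess h h' g (p q : R) : g.1 <> g.2 -> h.1 <> h.2 ->
  0 <= p <= 1 -> 0 <= q <= 1 -> gam h p = gam g q ->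
  (forall z, seg_set g z -> seg_set h z -> z = gam h p) ->
  exists2 K : R, 0 <= K & forall t t' r, 0 <= t <= 1 -> 0 <= t' <= 1 -> 0 <= r <= 1 ->
    edist (gam h t) (gam g q) + edist (gam h' t') (gam g q) + edist (gam g r) (gam g q) <=
    K * (edist (gam h t) (gam g r) + edist (gam h' t') (gam g r)).
Proof.
move=> gn hn p01 q01 hp uniq; have [c c0 hc] := corner_angle gn hn p01 q01 hp uniq.
exists (1 + 2 / c); first by rewrite addr_ge0 // divr_ge0 // ltW.
move=> t t' r t01 t'01 r01; have := hc t r t01 r01; rewrite hp.
have := edist_tri (gam h' t') (gam g r) (gam g q).
have := edist_ge0 (gam h t) (gam g q); have := edist_ge0 (gam h t) (gam g r).
have := edist_ge0 (gam h' t') (gam g r).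
set a := edist _ _; set b := edist _ _; set d := edist _ _; set e := edist _ _.
set f := edist _ _ => a0 b0 d0 he hf.
have h1 : d + f <= b / c by rewrite ler_pdivlMr // mulrC.
have h2 : 0 <= a / c by rewrite divr_ge0 // ltW.
have -> : (1 + 2 / c) * (b + a) = b + a + 2 * (b / c) + 2 * (a / c) by ring.
by lra.
Qed.

(** A common point of the three segments serves as the corner as soon as [h] or [h'] differs from
    [g]; otherwise all three coincide and the convolution estimate applies. *)
Lemma energy_triple (A : R) (s : seq (segment R)) h h' g :
  (forall g, g \in s -> g.1 <> g.2) ->
  (forall g h, g \in s -> h \in s -> g <> h ->
     forall p q, seg_set g p -> seg_set h p -> seg_set g q -> seg_set h q -> p = q) ->
  h \in s -> h' \in s -> g \in s ->
  exists2 C : R, 0 <= C & forall n k (u : nat -> R), (0 < n)%N -> kernel_class A k ->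
    energy k h h' g n u <= C * \sum_(j < n) u j ^+ 2.
Proof.
move=> nd uq hs h's gs; have gn := nd _ gs; have hn := nd _ hs; have h'n := nd _ h's.
have [[z [zh zh' zg]]|no] := pselect (exists z, [/\ seg_set h z, seg_set h' z & seg_set g z]);
  last exact: energy_separated.
have [p p01 hp] := zh; have [p' p'01 h'p] := zh'; have [q q01 hq] := zg.
move: p01 p'01 q01; rewrite /= !in_itv /= => p01 p'01 q01.
have [hg|/eqP hg] := eqVneq h g; last first.
  have [|K K0 hK] := corner_excess h' gn hn p01 q01 (etrans hp (esym hq)).
    by move=> y yg yh; rewrite hp; apply: (uq g h) => //; exact: nesym.
  by apply: (@energy_corner A K h h' g p p' q) => //; rewrite ?hp ?h'p ?hq.
have [h'g|/eqP h'g] := eqVneq h' g; last first.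
  have [|K K0 hK] := corner_excess h gn h'n p'01 q01 (etrans h'p (esym hq)).
    by move=> y yg yh; rewrite h'p; apply: (uq g h') => //; exact: nesym.
  apply: (@energy_corner A K h h' g p p' q) => //; rewrite ?hp ?h'p ?hq //.
  move=> t t' r t01 t'01 r01; have := hK t' t r t'01 t01 r01; rewrite hq.
  by rewrite [X in X + _ <= _]addrC [X in _ <= _ * X]addrC.
by rewrite hg h'g; exact: energy_same.
Qed.

Lemma seq_uniform_bound (T : eqType) (s : seq T) (P : T -> R -> Prop) :
  (forall (x : T) C C', P x C -> C <= C' -> P x C') ->
  (forall x : T, x \in s -> exists2 C, 0 <= C & P x C) ->
  exists2 C, 0 <= C & forall x : T, x \in s -> P x C.
Proof.
move=> mono; elim: s => [|x s IH] H; first by exists 0.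
have [|C C0 hC] := IH; first by move=> z zs; apply: H; rewrite inE zs orbT.
have [|C' C'0 hC'] := H x; first by rewrite inE eqxx.
exists (C + C'); first exact: addr_ge0.
move=> z; rewrite inE => /orP[/eqP ->|zs]; first by apply: mono hC' _; rewrite lerDr.
by apply: mono (hC z zs) _; rewrite lerDl.
Qed.

Lemma energy_bound (A : R) (s : seq (segment R)) :
  (forall g, g \in s -> g.1 <> g.2) ->
  (forall g h, g \in s -> h \in s -> g <> h ->
     forall p q, seg_set g p -> seg_set h p -> seg_set g q -> seg_set h q -> p = q) ->
  exists2 C : R, 0 <= C & forall h h' g, h \in s -> h' \in s -> g \in s ->
    forall n k (u : nat -> R), (0 < n)%N -> kernel_class A k ->
    energy k h h' g n u <= C * \sum_(j < n) u j ^+ 2.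
Proof.
move=> nd uq.
have M n k h h' g (u : nat -> R) C C' : energy k h h' g n u <= C * \sum_(j < n) u j ^+ 2 ->
    C <= C' -> energy k h h' g n u <= C' * \sum_(j < n) u j ^+ 2.
  move=> H CC; apply: le_trans H _; rewrite ler_wpM2r // sumr_ge0 // => j _.
  exact: sqr_ge0.
have [|h hs|C C0 hC] := @seq_uniform_bound _ s (fun h C => forall h' g, h' \in s -> g \in s ->
    forall n k (u : nat -> R), (0 < n)%N -> kernel_class A k ->
    energy k h h' g n u <= C * \sum_(j < n) u j ^+ 2).
- by move=> h C C' H CC h' g *; apply: M CC; exact: H.
- have [|h' h's|C C0 hC] := @seq_uniform_bound _ s (fun h' C => forall g, g \in s ->
      forall n k (u : nat -> R), (0 < n)%N -> kernel_class A k ->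
      energy k h h' g n u <= C * \sum_(j < n) u j ^+ 2).
  + by move=> h' C C' H CC g *; apply: M CC; exact: H.
  + have [|g gs|C C0 hC] := @seq_uniform_bound _ s (fun g C =>
        forall n k (u : nat -> R), (0 < n)%N -> kernel_class A k ->
        energy k h h' g n u <= C * \sum_(j < n) u j ^+ 2).
    * by move=> g C C' H CC *; apply: M CC; exact: H.
    * exact: energy_triple nd uq hs h's gs.
    * by exists C => // g gs; exact: hC.
  + by exists C => // h' g h's; exact: hC.
by exists C => // h h' g hs; exact: hC.
Qed.

Lemma mass_bound (A : R) h g : 0 <= A -> h.1 <> h.2 -> g.1 <> g.2 ->
  exists2 C : R, 0 <= C & forall n k (u : nat -> R), (0 < n)%N -> kernel_class A k ->
    \sum_(i < n) (\sum_(j < n)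
      k (n%:R * edist (sample h n i) (sample g n j)) * u j) ^+ 2 <=
    C * n%:R * \sum_(j < n) u j ^+ 2.
Proof.
move=> A0 hn gn; have [C C0 hC] := schur_sample hn gn.
exists (A ^+ 2 * C); first by rewrite mulr_ge0 ?sqr_ge0.
move=> n k u n0 [k0 _ kA _].
have uu : \sum_(j < n) u j ^+ 2 = \sum_(j < n) `|u j| ^+ 2.
  by apply: eq_bigr => j _; rewrite real_normK ?num_real.
rewrite uu.
apply: (@le_trans _ _ (A ^+ 2 * (C * n%:R * \sum_(j < n) `|u j| ^+ 2))); last by rewrite !mulrA.
apply: le_trans (ler_wpM2l (sqr_ge0 A) (hC n (fun j => `|u j|) n0)).
rewrite mulr_sumr; apply: ler_sum => i _.
rewrite -exprMn -[leLHS]real_normK ?num_real // ler_sqr ?nnegrE //; last first.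
  by rewrite mulr_ge0 // sumr_ge0 // => j _; rewrite mulr_ge0 ?isq_ge0.
apply: le_trans (ler_norm_sum _ _ _) _; rewrite mulr_sumr; apply: ler_sum => j _.
have d0 : 0 <= n%:R * edist (sample h n i) (sample g n j).
  by rewrite mulr_ge0 ?edist_ge0.
by rewrite normrM ger0_norm ?k0 // mulrA ler_wpM2r // kA.
Qed.

Lemma kernel_row_bound (A : R) g : 0 <= A -> g.1 <> g.2 -> exists2 C : R, 0 <= C &
  forall n k x, (0 < n)%N -> kernel_class A k ->
    \sum_(j < n) k (n%:R * edist x (sample g n j)) <= C * Num.sqrt n%:R.
Proof.
move=> A0 gn; have [C C0 hC] := row_sum_bound gn.
exists (A * C); first exact: mulr_ge0.
move=> n k x n0 [k0 _ kA _]; rewrite -mulrA.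
apply: le_trans (ler_wpM2l A0 (hC n x n0)); rewrite mulr_sumr; apply: ler_sum => j _.
by apply: kA; rewrite mulr_ge0 ?edist_ge0.
Qed.

End DiscreteEstimate.

(** * Truncated binomial kernels *)

Section BinomialKernel.
Variable R : realType.
Implicit Types (N m : nat) (t z r : R).

(* Taylor coefficients of [(1 - t)^(-1/4)]. *)
Definition bcoef m : R := \prod_(i < m) ((i%:R + 4^-1) / i.+1%:R).

Lemma bcoef_gt0 m : 0 < bcoef m.
Proof. by apply: prodr_gt0 => i _; rewrite divr_gt0 // addr_ge0. Qed.

Lemma bcoefS m : bcoef m.+1 * m.+1%:R = bcoef m * (m%:R + 4^-1).
Proof. by rewrite /bcoef big_ord_recr /= -mulrA divfK. Qed.

Definition bpoly N : {poly R} := \poly_(m < N.+1) bcoef m.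

(** The full series f = (1 - t)^(-1/4) satisfies (1 - t) f' = f / 4; truncation leaves a single
    monomial as remainder. *)
Lemma bpoly_ode N : (1 - 'X) * (bpoly N)^`() =
  4^-1 *: bpoly N - (bcoef N * (N%:R + 4^-1)) *: 'X^N.
Proof.
apply/polyP => m; rewrite mulrBl mul1r coefB coefXM !coef_deriv.
rewrite coefB !coefZ coefXn !coef_poly.
case: m => [|m] /=.
  rewrite subr0 ltnS; case: N => [|N] /=; first by rewrite mul0rn /bcoef big_ord0; ring.
  by rewrite mulr0 subr0 /bcoef big_ord_recl big_ord0 big_ord0 /=; field.
rewrite !ltnS; have e := bcoefS m.+1.
have nr x (j : nat) : x *+ j = x * j%:R :> R by rewrite mulr_natr.
rewrite (nr _ m.+2) (nr _ m.+1).
case: (ltngtP m.+1 N) => [mN|Nm|<-].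
- by rewrite mulr0 subr0 e; ring.
- by rewrite !mul0r !mulr0 subrr.
- by rewrite mul0r mulr1; ring.
Qed.

Lemma bpoly_nneg N m : 0 <= (bpoly N)`_m.
Proof. by rewrite coef_poly; case: ifP => // _; exact/ltW/bcoef_gt0. Qed.

Lemma coefM_nneg (p q : {poly R}) : (forall m, 0 <= p`_m) -> (forall m, 0 <= q`_m) ->
  forall m, 0 <= (p * q)`_m.
Proof. by move=> p0 q0 m; rewrite coefM sumr_ge0 // => i _; rewrite mulr_ge0. Qed.

Lemma horner_nneg (p : {poly R}) t : (forall m, 0 <= p`_m) -> 0 <= t -> 0 <= p.[t].
Proof.
by move=> p0 t0; rewrite horner_coef sumr_ge0 // => i _; rewrite mulr_ge0 ?exprn_ge0.
Qed.

(* The derivative of [p^4 (1 - t)] is [- a p^3 t^N]: all coefficients of [p^4 (1 - t)] beyond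
   the constant one are nonpositive and they start at degree [N + 1]. *)
Lemma bpoly4_bounds N t : 0 <= t <= 1 ->
  1 - t ^+ N.+1 <= (bpoly N).[t] ^+ 4 * (1 - t) <= 1.
Proof.
move=> /andP[t0 t1]; set p := bpoly N; pose g := p ^+ 4 * (1 - 'X).
pose a := 4 * (bcoef N * (N%:R + 4^-1)).
have a0 : 0 <= a by rewrite /a !mulr_ge0 ?(ltW (bcoef_gt0 _)) // addr_ge0.
have dg : g^`() = - (a *: (p ^+ 3 * 'X^N)).
  have -> : g^`() = p ^+ 3 * (4%:R *: ((1 - 'X) * p^`()) - p).
    rewrite /g derivM derivB derivX -[1]/(1%:P) derivC sub0r.
    rewrite !exprS !derivM expr0 derivC -mul_polyC; ring.
  rewrite /p bpoly_ode -/p scalerBr !scalerA mulfV ?pnatr_eq0 // scale1r addrAC subrr sub0r.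
  by rewrite mulrN -/a scalerAr.
have gE : g.[t] = p.[t] ^+ 4 * (1 - t) by rewrite /g !hornerE.
have g1 : g.[1] = 0 by rewrite /g !hornerE subrr mulr0.
have coefg m : g`_m.+1 <= 0 /\ ((m < N)%N -> g`_m.+1 = 0).
  have := congr1 (fun q : {poly R} => q`_m) dg.
  rewrite coef_deriv coefN coefZ coefMXn => h.
  have h0 : 0 <= (if (m < N)%N then 0 else (p ^+ 3)`_(m - N)).
    case: ifP => // _; rewrite exprS expr2.
    by do 2?[apply: coefM_nneg => ?]; exact: bpoly_nneg.
  split.
    have : g`_m.+1 *+ m.+1 <= 0 by rewrite h oppr_le0 mulr_ge0.
    by rewrite pmulrn_lle0.
  by move=> mN; move: h; rewrite mN mulr0 oppr0 => /eqP; rewrite mulrn_eq0 => /eqP.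
have g0 : g`_0 = 1.
  rewrite -horner_coef0 /g !hornerE subr0 mulr1 horner_coef0 coef_poly /=.
  by rewrite /bcoef big_ord0 expr1n.
have hE s : g.[s] = 1 + \sum_(i < (size g).-1) g`_i.+1 * s ^+ i.+1.
  rewrite (@horner_coef_wide _ (size g).-1.+1) ?leqSpred // big_ord_recl /=.
  by rewrite expr0 mulr1 g0; congr (_ + _); apply: eq_bigr.
rewrite -gE; apply/andP; split; last first.
  rewrite hE gerDl; apply: sumr_le0 => i _.
  by rewrite mulr_le0_ge0 ?exprn_ge0 //; case: (coefg i).
(* [g] vanishes at 1, so its nonconstant coefficients add up to -1. As they are nonpositive and
   start at degree N + 1, replacing every power of [t] by t^(N + 1) gives the lower bound. *)
have h1 : \sum_(i < (size g).-1) g`_i.+1 = -1.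
  have := hE 1; rewrite g1 => /eqP; rewrite eq_sym addrC addr_eq0 => /eqP <-.
  by apply: eq_bigr => i _; rewrite expr1n mulr1.
rewrite hE lerD2l -mulN1r -h1 mulr_suml; apply: ler_sum => i _.
case: (coefg i) => c1 c2; have [iN|Ni] := ltnP i N; first by rewrite c2 ?mul0r.
rewrite ler_wnM2l // ler_wiXn2l //.
Qed.

(** [bpoly_ode] gives (1 - t) p'(t) <= p(t) / 4, and the nonnegative coefficients give p(t) - p(t')
    <= (t - t') p'(t). *)
Lemma bpoly_slope N t t' : 0 <= t' -> t' <= t -> t <= 1 ->
  ((bpoly N).[t] - (bpoly N).[t']) * (1 - t) <= (t - t') * ((bpoly N).[t] / 4).
Proof.
move=> t'0 tt' t1; set p := bpoly N; have t0 : 0 <= t by apply: le_trans tt'.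
have h1 : (1 - t) * p^`().[t] <= p.[t] / 4.
  have := congr1 (fun q : {poly R} => q.[t]) (bpoly_ode N).
  rewrite -/p !hornerE /= => ->; rewrite mulrC gerBl mulr_ge0 ?exprn_ge0 //.
  by rewrite mulr_ge0 ?(ltW (bcoef_gt0 _)) // addr_ge0.
have h2 : p.[t] - p.[t'] <= (t - t') * p^`().[t].
  have -> : p = \sum_(i < N.+1) bcoef i *: 'X^i by rewrite /p /bpoly poly_def.
  rewrite [X in _ * X.[_] ]raddf_sum /= !horner_sum -sumrB mulr_sumr; apply: ler_sum => i _.
  rewrite derivZ derivXn !hornerZ !hornerXn hornerMn hornerXn -mulrBr mulrCA ler_wpM2l ?(ltW (bcoef_gt0 _)) //.
  rewrite subrXX ler_wpM2l ?subr_ge0 //.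
  apply: (@le_trans _ _ (\sum_(j < i) t ^+ i.-1)); last by rewrite sumr_const card_ord.
  apply: ler_sum => j _; have -> : t ^+ i.-1 = t ^+ (i.-1 - j) * t ^+ j.
    by rewrite -exprD subnK // -ltnS prednK // (leq_trans _ (ltn_ord j)).
  by rewrite ler_wpM2l ?exprn_ge0 // lerXn2r // nnegrE.
rewrite mulrC; apply: le_trans (ler_wpM2l _ h2) _; first by rewrite subr_ge0.
by rewrite mulrCA ler_wpM2l ?subr_ge0.
Qed.

Lemma bpoly_le N t t' : 0 <= t' -> t' <= t -> (bpoly N).[t'] <= (bpoly N).[t].
Proof.
move=> t'0 tt'; rewrite !horner_coef; apply: ler_sum => i _.
have h := bpoly_nneg N i.
by rewrite ler_wpM2l // lerXn2r // nnegrE // (le_trans t'0).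
Qed.

Lemma bpoly0 N : (bpoly N).[0] = 1.
Proof. by rewrite horner_coef0 coef_poly /= /bcoef big_ord0. Qed.

(* A polynomial in [z ^ 2] on the range of distances; the other branch makes
   the monotonicity and decay estimates hold for all [z]. *)
Definition bker N r z : R :=
  if z <= r ^+ 2 then r^-1 * (bpoly N).[1 - z ^+ 2 / r ^+ 4] else isq z.

Section Bker.
Variables (N : nat) (r : R).
Hypothesis r0 : 0 < r.
Notation k := (bker N r).

Let tz z := 1 - z ^+ 2 / r ^+ 4.

Lemma bker_arg z : 0 <= z -> z <= r ^+ 2 -> 0 <= tz z <= 1.
Proof.
move=> z0 zr; have r4 : 0 < r ^+ 4 by rewrite exprn_gt0.
rewrite /tz gerBl divr_ge0 ?sqr_ge0 ?(ltW r4) // andbT subr_ge0 ler_pdivrMr // mul1r.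
have -> : r ^+ 4 = (r ^+ 2) ^+ 2 by ring.
by rewrite ler_sqr // nnegrE sqr_ge0.
Qed.

Lemma bker_out z : r ^+ 2 < z -> k z = isq z.
Proof. by move=> rz; rewrite /bker leNgt rz. Qed.

Lemma bker_ge0 z : 0 <= z -> 0 <= k z.
Proof.
move=> z0; rewrite /bker; case: ifP => [zr|_]; last exact: isq_ge0.
have /andP[t0 t1] := bker_arg z0 zr.
by rewrite mulr_ge0 ?invr_ge0 ?(ltW r0) // horner_nneg // => m; exact: bpoly_nneg.
Qed.

Lemma isq_r : isq (r ^+ 2) = r^-1.
Proof. by rewrite /isq sqrtr_sqr ger0_norm // ltW. Qed.

Lemma bker_r : k (r ^+ 2) = isq (r ^+ 2).
Proof.
rewrite /bker lexx isq_r; have -> : 1 - (r ^+ 2) ^+ 2 / r ^+ 4 = 0.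
  by rewrite -exprM divff ?subrr // expf_neq0 // gt_eqF.
by rewrite bpoly0 mulr1.
Qed.

(** This is [bpoly4_bounds] at t = 1 - z^2 / r^4, where k^4 z^2 = p^4 (1 - t). Fourth powers keep
    fractional exponents out. *)
Lemma bker_pow4 z : 0 < z -> z <= r ^+ 2 ->
  isq z ^+ 4 * (1 - tz z ^+ N.+1) <= k z ^+ 4 <= isq z ^+ 4.
Proof.
move=> z0 zr; have t01 := bker_arg (ltW z0) zr.
have := bpoly4_bounds N t01; rewrite /bker zr -/(tz z) exprMn.
set p := (bpoly N).[_]; have e1 : 1 - tz z = z ^+ 2 / r ^+ 4 by rewrite /tz; ring.
have e2 : isq z ^+ 4 = (z ^+ 2)^-1.
  by rewrite -[4%N]/(2 * 2)%N exprM isq_sqr ?(ltW z0) // exprVn.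
have z2 : 0 < z ^+ 2 by rewrite exprn_gt0.
rewrite e1 e2 => /andP[h1 h2].
have e3 : r^-1 ^+ 4 * p ^+ 4 = p ^+ 4 * (z ^+ 2 / r ^+ 4) / z ^+ 2.
  by field; rewrite !gt_eqF.
by rewrite e3 mulrC ler_pM2r ?invr_gt0 // h1 /= ler_pdivrMr // mulVf ?gt_eqF.
Qed.

Lemma bker_le z : 0 < z -> k z <= isq z.
Proof.
move=> z0; have [zr|zr] := leP z (r ^+ 2); last by rewrite bker_out.
have /andP[_] := bker_pow4 z0 zr.
by rewrite ler_pXn2r // nnegrE ?bker_ge0 ?isq_ge0 // ltW.
Qed.

(** The fourth root of a number b in [0, 1] is at least b. *)
Lemma bker_ge z : 0 < z -> z <= r ^+ 2 -> isq z * (1 - tz z ^+ N.+1) <= k z.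
Proof.
move=> z0 zr; have /andP[h _] := bker_pow4 z0 zr.
have /andP[t0 t1] := bker_arg (ltW z0) zr.
have I0 : 0 < isq z by exact: isq_gt0.
set b := 1 - _ in h *.
have b0 : 0 <= b by rewrite subr_ge0 exprn_ile1.
have b1 : b <= 1 by rewrite gerBl exprn_ge0.
rewrite -(ler_pXn2r (n := 4)) ?nnegrE ?bker_ge0 ?mulr_ge0 ?(ltW z0) ?(ltW I0) //.
apply: le_trans h; rewrite exprMn ler_wpM2l ?exprn_ge0 ?(ltW I0) //.
by rewrite exprS ler_piMr // exprn_ile1.
Qed.

Lemma bker_anti z z' : 0 <= z -> z <= z' -> k z' <= k z.
Proof.
move=> z0 zz'; have z'0 := le_trans z0 zz'.
have inn (x y : R) : 0 <= x -> x <= y -> y <= r ^+ 2 -> k y <= k x.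
  move=> x0 xy yr; rewrite /bker yr (le_trans xy yr) ler_wpM2l ?invr_ge0 ?(ltW r0) //.
  have /andP[t0 _] := bker_arg (le_trans x0 xy) yr.
  apply: bpoly_le => //; rewrite lerD2l lerN2 ler_wpM2r ?invr_ge0 ?exprn_ge0 ?(ltW r0) //.
  by rewrite ler_sqr // nnegrE // (le_trans x0).
have [z'r|rz'] := leP z' (r ^+ 2); first exact: inn.
have r2 : 0 < r ^+ 2 by rewrite exprn_gt0.
have [zr|rz] := leP z (r ^+ 2).
  apply: le_trans (inn _ _ z0 zr (lexx _)); rewrite bker_r (bker_out rz').
  by apply: isq_anti => //; exact: ltW.
by rewrite !bker_out //; apply: isq_anti => //; exact: lt_trans rz.
Qed.

(** Up to r^2 the estimate comes from the size of the kernel when z' >= 2 z and from [bpoly_slope]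
    otherwise; beyond r^2 it is elementary for [isq]. A pair on both sides is split at r^2, where
    the two branches agree. *)
Lemma bker_slope z z' : 0 < z -> z <= z' -> (k z - k z') * z <= (z' - z) * isq z.
Proof.
have inn (x y : R) : 0 < x -> x <= y -> y <= r ^+ 2 -> (k x - k y) * x <= (y - x) * isq x.
  move=> x0 xy yr; have y0 := lt_le_trans x0 xy; have xr := le_trans xy yr.
  have [xy2|xy2] := leP (2 * x) y.
    apply: (@le_trans _ _ (k x * x)).
      by rewrite ler_wpM2r ?(ltW x0) // gerBl bker_ge0 // ltW.
    rewrite mulrC; apply: ler_pM; rewrite ?bker_ge0 ?(ltW x0) ?bker_le //; lra.
  have /andP[tx0 tx1] := bker_arg (ltW x0) xr; have /andP[ty0 ty1] := bker_arg (ltW y0) yr.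
  have txy : tz y <= tz x.
    rewrite lerD2l lerN2 ler_wpM2r ?invr_ge0 ?exprn_ge0 ?(ltW r0) //.
    by rewrite ler_sqr // nnegrE ltW.
  have := bpoly_slope N ty0 txy tx1.
  have kx : k x = r^-1 * (bpoly N).[tz x] by rewrite /bker xr.
  have ky : k y = r^-1 * (bpoly N).[tz y] by rewrite /bker yr.
  have ri : 0 <= r ^+ 3 by rewrite exprn_ge0 // ltW.
  move=> /(ler_wpM2l ri) h.
  have rn : r != 0 by rewrite gt_eqF.
  have e1 : r ^+ 3 * (((bpoly N).[tz x] - (bpoly N).[tz y]) * (1 - tz x)) =
     (k x - k y) * x ^+ 2 by rewrite kx ky /tz; field.
  have e2 : r ^+ 3 * ((tz x - tz y) * ((bpoly N).[tz x] / 4)) =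
     (y ^+ 2 - x ^+ 2) * k x / 4 by rewrite kx {1 2}/tz; field.
  rewrite e1 e2 in h.
  rewrite -(ler_pM2r x0) -[leLHS]mulrA -expr2; apply: le_trans h _.
  have kl := bker_le x0; have k0 := bker_ge0 (ltW x0).
  have -> : (y ^+ 2 - x ^+ 2) * k x / 4 = (y - x) * ((y + x) * k x / 4) by ring.
  rewrite -[leRHS]mulrA ler_wpM2l ?subr_ge0 // mulrAC mulrC ler_pM //.
    by rewrite divr_ge0 // addr_ge0 // ltW.
  lra.
have out (x y : R) : 0 < x -> x <= y -> (isq x - isq y) * x <= (y - x) * isq x.
  move=> x0 xy; have y0 := lt_le_trans x0 xy.
  set a := Num.sqrt x; set b := Num.sqrt y.
  have a0 : 0 < a by rewrite sqrtr_gt0. have b0 : 0 < b by rewrite sqrtr_gt0.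
  have ab : a <= b by rewrite ler_wsqrtr.
  have -> : x = a ^+ 2 by rewrite sqr_sqrtr // ltW.
  have -> : y = b ^+ 2 by rewrite sqr_sqrtr // ltW.
  rewrite /isq !sqrtr_sqr !ger0_norm ?(ltW a0) ?(ltW b0) //.
  have -> : (a^-1 - b^-1) * a ^+ 2 = (b - a) * (a / b) by field; rewrite !gt_eqF.
  have -> : (b ^+ 2 - a ^+ 2) * a^-1 = (b - a) * ((b + a) / a) by ring.
  rewrite ler_wpM2l ?subr_ge0 //; apply: (@le_trans _ _ 1).
    by rewrite ler_pdivrMr // mul1r.
  by rewrite ler_pdivlMr // mul1r; lra.
move=> z0 zz'; have [z'r|rz'] := leP z' (r ^+ 2); first exact: inn.
have r2 : 0 < r ^+ 2 by rewrite exprn_gt0.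
have kz' := bker_out rz'.
have [zr|rz] := leP z (r ^+ 2); last first.
  by rewrite (bker_out rz) kz' out.
have h1 := inn _ _ z0 zr (lexx _); have h2 := out _ _ r2 (ltW rz').
rewrite -bker_r in h2; rewrite kz'.
set K0 := k (r ^+ 2) in h1 h2.
have h3 : (K0 - isq z') * z <= (z' - r ^+ 2) * isq z.
  have K00 : 0 <= K0 - isq z'.
    by rewrite subr_ge0 /K0 bker_r; apply: isq_anti => //; exact: ltW.
  apply: (@le_trans _ _ ((K0 - isq z') * r ^+ 2)); first by rewrite ler_wpM2l.
  apply: le_trans h2 _; rewrite ler_wpM2l //; first by rewrite subr_ge0 ltW.
  by rewrite /K0 bker_r; apply: isq_anti.
have -> : (k z - isq z') * z = (k z - K0) * z + (K0 - isq z') * z by ring.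
by apply: le_trans (lerD h1 h3) _; rewrite -mulrDl addrC subrKA.
Qed.

(* [n] is chosen so large that the kernel at distance 0 is harmless at scale [1/n]. *)
Lemma bker_kernel_class n : (0 < n)%N -> k 0 ^+ 2 <= n%:R ->
  kernel_class 4 (fun d => k (d / n%:R) * isq n%:R).
Proof.
move=> n0 kn; have nr : (0 : R) < n%:R by rewrite ltr0n.
have dn (d : R) : 0 <= d -> 0 <= d / n%:R by move=> d0; rewrite divr_ge0 // ltW.
have In : 0 < isq (n%:R : R) by exact: isq_gt0.
have k1 (d : R) : 0 <= d -> k (d / n%:R) * isq n%:R <= 1.
  move=> d0; apply: (@le_trans _ _ (k 0 * isq n%:R)).
    by rewrite ler_wpM2r ?(ltW In) // bker_anti // dn.
  rewrite ler_pdivrMr ?sqrtr_gt0 // mul1r -ler_sqr ?nnegrE ?bker_ge0 ?sqrtr_ge0 //.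
  by rewrite sqr_sqrtr // ltW.
have k2 (d : R) : 0 < d -> k (d / n%:R) * isq n%:R <= isq d.
  move=> d0; have h : 0 < d / n%:R by rewrite divr_gt0.
  apply: (@le_trans _ _ (isq (d / n%:R) * isq n%:R)).
    by rewrite ler_wpM2r ?(ltW In) // bker_le.
  by rewrite -isqM ?(ltW h) // divfK // gt_eqF.
have i1 (d : R) : 0 <= d -> d <= 1 -> 1 <= 2 * isq (1 + d).
  move=> d0 d1; have h : 0 < 1 + d by lra.
  rewrite ler_pdivlMr ?sqrtr_gt0 // mul1r -ler_sqr ?nnegrE ?sqrtr_ge0 //.
  by rewrite sqr_sqrtr ?(ltW h) //; lra.
have i2 (d : R) : 1 <= d -> isq d <= 2 * isq (1 + d).
  by move=> d1; apply: isq_le => //; lra.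
split.
- by move=> d d0; rewrite mulr_ge0 ?(ltW In) // bker_ge0 // dn.
- move=> d d' d0 dd'; rewrite ler_wpM2r ?(ltW In) // bker_anti ?dn //.
  by rewrite ler_wpM2r // invr_ge0 ltW.
- move=> d d0; have I0 := isq_ge0 (1 + d).
  have [d1|d1] := leP d 1; first by have := k1 d d0; have := i1 d d0 d1; lra.
  by have := k2 d (lt_trans ltr01 d1); have := i2 d (ltW d1); lra.
move=> d d' d0 dd'; have I0 := isq_ge0 (1 + d).
have d'0 := le_trans d0 dd'.
have kd' : 0 <= k (d' / n%:R) * isq n%:R by rewrite mulr_ge0 ?(ltW In) // bker_ge0 // dn.
have [d1|d1] := leP d 1.
  apply: (@le_trans _ _ (2 * isq (1 + d) * 2)).
    apply: ler_pM; try lra.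
      by rewrite subr_ge0 ler_wpM2r ?(ltW In) // bker_anti ?dn // ler_wpM2r // invr_ge0 ltW.
    by have := k1 d d0; have := i1 d d0 d1; lra.
  have -> : 2 * isq (1 + d) * 2 = 4 * isq (1 + d) by ring.
  by rewrite ler_wpM2r //; lra.
have dp : 0 < d by lra.
have dnp : 0 < d / n%:R by rewrite divr_gt0.
have ddn : d / n%:R <= d' / n%:R by rewrite ler_wpM2r // invr_ge0 ltW.
have h := bker_slope dnp ddn.
have In2 : 0 <= n%:R * isq n%:R :> R by rewrite mulr_ge0 // ltW.
have {}h := ler_wpM2l In2 h.
have e1 : n%:R * isq n%:R * ((k (d / n%:R) - k (d' / n%:R)) * (d / n%:R)) =
  (k (d / n%:R) * isq n%:R - k (d' / n%:R) * isq n%:R) * d by field; rewrite gt_eqF.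
have e2 : n%:R * isq n%:R * ((d' / n%:R - d / n%:R) * isq (d / n%:R)) = (d' - d) * isq d.
  have -> : isq d = isq (d / n%:R) * isq n%:R by rewrite -isqM ?(ltW dnp) // divfK // gt_eqF.
  by field; rewrite gt_eqF.
rewrite e1 e2 in h.
set X := _ - _ in h *.
have X0 : 0 <= X by rewrite subr_ge0 ler_wpM2r ?(ltW In) // bker_anti ?dn.
apply: (@le_trans _ _ (2 * (X * d))).
  by rewrite mulrCA ler_wpM2l //; lra.
have dd0 : 0 <= d' - d by lra.
have := ler_wpM2l dd0 (i2 d (ltW d1)); lra.
Qed.

End Bker.

End BinomialKernel.

(** * Riemann sums and integrals of continuous functions *)

Section RiemannSums.
Local Open Scope classical_set_scope.
Variable R : realType.
Notation mu := (@lebesgue_measure R).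
Implicit Types f g : R -> R.

Lemma continuous_integrable f (a b : R) : continuous f ->
  mu.-integrable `[a, b] (EFin \o f).
Proof.
move=> cf; apply: continuous_compact_integrable; first exact: segment_compact.
exact: continuous_subspaceT.
Qed.

Definition int01 f : R := \int[mu]_(x in `[0%R, 1%R]) f x.

Lemma int01E f : continuous f ->
  (\int[mu]_(x in `[0%R, 1%R]) (f x)%:E)%E = (int01 f)%:E.
Proof.
move=> cf; rewrite /int01 /Rintegral fineK //; apply: integrable_fin_num => //.
exact: continuous_integrable.
Qed.

Definition rsum (n : nat) f : R := n%:R^-1 * \sum_(i < n) f (i%:R / n%:R).

Lemma rsum_error (n : nat) f (e : R) : continuous f -> (0 < n)%N ->
  (forall s t, 0 <= s <= 1 -> 0 <= t <= 1 -> `|s - t| <= n%:R^-1 -> `|f s - f t| <= e) ->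
  `|rsum n f - int01 f| <= e.
Proof.
move=> cf n0 fe; have nr : (0 : R) < n%:R by rewrite ltr0n.
(* A primitive based at -1 is differentiable on a neighbourhood of [0, 1], so the mean value theorem
   applies up to the endpoints. *)
pose F (x : R) : R := \int[mu]_(t in `[(-1)%R, x]) f t.
have dF (x : R) : -1 < x -> x < 2 -> is_derive x 1 F (f x).
  move=> x1 x2.
  have [d1 d2] := @continuous_FTC1_closed R f (-1) x 2 x2 (continuous_integrable _ _ cf) x1 (cf x).
  by split => //; rewrite -derive1E.
have cF (x : R) : -1 < x -> x < 2 -> {for x, continuous F}.
  by move=> x1 x2; apply: differentiable_continuous; apply/derivable1_diffP; have [] := dF x x1 x2.
have I01 : int01 f = F 1 - F 0.
  rewrite /F (@Rintegral_itvB _ f (BLeft (-1)) (BRight 1) 0).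
  - rewrite Rintegral_itv_obnd_cbnd //.
    apply: integrableS (continuous_integrable 0 1 cf) => //.
    exact: subset_itv_oc_cc.
  - exact: continuous_integrable.
  - by rewrite bnd_simp; lra.
  - by rewrite bnd_simp.
pose x (i : nat) : R := i%:R / n%:R.
have xS i : x i.+1 = x i + n%:R^-1 by rewrite /x -natr1 mulrDl mul1r.
have x01 i : (i <= n)%N -> 0 <= x i <= 1.
  by move=> i_n; rewrite divr_ge0 //= ler_pdivrMr // mul1r ler_nat.
have ni : 0 < n%:R^-1 :> R by rewrite invr_gt0.
have step (i : 'I_n) : `|n%:R^-1 * f (x i) - (F (x i.+1) - F (x i))| <= e * n%:R^-1.
  have /andP[a0 a1] := x01 i (ltnW (ltn_ord i)); have /andP[b0 b1] := x01 i.+1 (ltn_ord i).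
  have [|y yi||c ci ->] := @MVT R F f (x i) (x i.+1); first by rewrite xS ltrDl.
  - by move: yi; rewrite in_itv /= => /andP[y1 y2]; apply: dF; lra.
  - apply: continuous_in_subspaceT => y; rewrite inE /= in_itv /= => /andP[y1 y2].
    by apply: cF; lra.
  move: ci; rewrite in_itv /= => /andP[c1 c2].
  have -> : n%:R^-1 * f (x i) - f c * (x i.+1 - x i) = (f (x i) - f c) * n%:R^-1.
    by rewrite xS; ring.
  rewrite normrM (ger0_norm (ltW ni)) ler_wpM2r ?(ltW ni) //.
  apply: fe; try (apply/andP; split; lra).
  by rewrite ltr0_norm ?subr_lt0 //; rewrite xS in c2; lra.
have -> : rsum n f - int01 f = \sum_(i < n) (n%:R^-1 * f (x i) - (F (x i.+1) - F (x i))).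
  rewrite sumrB -mulr_sumr I01; congr (_ - _).
  rewrite -(big_mkord xpredT (fun i => F (x i.+1) - F (x i))) telescope_sumr //.
  by rewrite /x mul0r divff // gt_eqF.
apply: le_trans (ler_norm_sum _ _ _) _.
apply: (@le_trans _ _ (\sum_(i < n) e * n%:R^-1)); first by apply: ler_sum => i _.
by rewrite sumr_const card_ord -[(e / _) *+ _]mulr_natr -mulrA mulVf ?mulr1 // gt_eqF.
Qed.

(** Only [x] is confined to [K]: in [continuous_int01_slice] the compact set is one slice and [y]
    lies on a neighbouring one. *)
Lemma heine (X : pseudoMetricType R) (K : set X) (F : X -> R) (e : R) :
  compact K -> continuous F -> 0 < e ->
  exists2 d : R, 0 < d & forall x y, K x -> ball x d y -> `|F x - F y| < e.
Proof.
move=> /compact_near_coveringP cK cF e0.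
have := cK R (0 : R)^'+ (fun d x => forall y, ball x d y -> `|F x - F y| < e) _.
case.
  move=> x Kx; have e2 : 0 < e / 2 by rewrite divr_gt0.
  have /nbhs_ballP[d /= d0 hd] : \forall y \near x, `|F x - F y| < e / 2.
    by have /cvgr_dist_lt := cF x; apply.
  have d2 : 0 < d / 2 by rewrite divr_gt0.
  exists (ball x (d / 2), [set c | c < d / 2]).
    split; first exact: nbhsx_ballx.
    by exists (d / 2) => // c /= h1 h2; move: h1; rewrite sub0r normrN gtr0_norm.
  move=> [x' c] /= [bx' cd] y by'.
  have h1 : `|F x - F x'| < e / 2.
    by apply: hd; apply: le_ball bx'; rewrite ler_pdivrMr //; lra.
  have h2 : `|F x - F y| < e / 2.
    apply: hd; have -> : d = d / 2 + d / 2 by lra.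
    by apply: ball_triangle bx' _; apply: le_ball by'; exact: ltW.
  have -> : F x' - F y = (F x - F y) - (F x - F x') by ring.
  by apply: le_lt_trans (ler_normB _ _) _; lra.
move=> d /= d0 hd; exists (d / 2); first by rewrite divr_gt0.
move=> x y Kx; apply: (hd (d / 2)) => //=; last by rewrite divr_gt0.
by rewrite sub0r normrN gtr0_norm ?divr_gt0 // ltr_pdivrMr //; lra.
Qed.

Lemma int01D f g : continuous f -> continuous g ->
  int01 (fun t => f t + g t) = int01 f + int01 g.
Proof. by move=> cf cg; apply: RintegralD => //; exact: continuous_integrable. Qed.

Lemma int01_cst (c : R) : int01 (fun=> c) = c.
Proof.
rewrite /int01 Rintegral_cst //= lebesgue_measure_itv /=.
by rewrite lte_fin ltr01 sube0 /= mulr1.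
Qed.

Lemma le_int01 f g : continuous f -> continuous g ->
  (forall t, 0 <= t <= 1 -> f t <= g t) -> int01 f <= int01 g.
Proof.
move=> cf cg fg; by apply: le_Rintegral => //; exact: continuous_integrable.
Qed.

Lemma int01_dist f g (e : R) : continuous f -> continuous g ->
  (forall t, 0 <= t <= 1 -> `|f t - g t| <= e) -> `|int01 f - int01 g| <= e.
Proof.
move=> cf cg fg.
have H (h1 h2 : R -> R) : continuous h1 -> continuous h2 ->
    (forall t, 0 <= t <= 1 -> `|h1 t - h2 t| <= e) -> int01 h1 - int01 h2 <= e.
  move=> c1 c2 h; rewrite lerBlDl -[X in _ + X]int01_cst -int01D //; last by move=> ?; exact: cvg_cst.
  apply: le_int01 => //.
    by move=> t; apply: cvgD; [exact: c2|exact: cvg_cst].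
  by move=> t t01; have := h t t01; rewrite ler_norml => /andP[_]; lra.
rewrite ler_norml; have := H f g cf cg fg; have := H g f cg cf.
move=> /(_ _) h1 h2; rewrite h2 andbT lerNl opprB; apply: h1.
by move=> t t01; rewrite distrC; exact: fg.
Qed.

Lemma rsum_dist n f g (e : R) : (0 < n)%N ->
  (forall t, 0 <= t <= 1 -> `|f t - g t| <= e) -> `|rsum n f - rsum n g| <= e.
Proof.
move=> n0 fg; have nr : (0 : R) < n%:R by rewrite ltr0n.
rewrite /rsum -mulrBr -sumrB normrM ger0_norm ?invr_ge0 ?(ltW nr) //.
rewrite mulrC ler_pdivrMr //; apply: le_trans (ler_norm_sum _ _ _) _.
apply: (@le_trans _ _ (\sum_(i < n) e)); last by rewrite sumr_const card_ord mulr_natr.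
by apply: ler_sum => i _; apply: fg; apply: sample_itv.
Qed.

Lemma near_invn (d : R) : 0 < d -> \forall n \near \oo, (0 < n)%N /\ n%:R^-1 < d :> R.
Proof.
move=> d0; near=> n; have n0 : (0 < n)%N by near: n; exists 1%N.
split=> //; rewrite -[d]invrK ltf_pV2 ?posrE ?invr_gt0 ?ltr0n //.
by near: n; exact: nbhs_infty_gtr.
Unshelve. all: by end_near. Qed.

Lemma rsum_cvg f : continuous f -> rsum n f @[n --> \oo] --> int01 f.
Proof.
move=> cf; apply/cvgrPdist_le => e e0.
have [d d0 hd] := heine (@segment_compact R 0 1) cf e0.
near=> n; have [n0 nd] : (0 < n)%N /\ n%:R^-1 < d :> R by near: n; exact: near_invn.
rewrite distrC; apply: rsum_error => // s t s01 t01 st; apply: ltW.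
by apply: hd; [rewrite /= in_itv|exact: le_lt_trans st nd].
Unshelve. all: by end_near. Qed.

Lemma continuous_slice (G : R * R -> R) t : continuous G -> continuous (fun s => G (t, s)).
Proof.
move=> cG s; apply: (@continuous_comp _ _ _ (fun s => (t, s)) G); last exact: cG.
have h1 : (fun=> t) x @[x --> s] --> t by exact: cvg_cst.
have h2 : id x @[x --> s] --> s by exact: cvg_id.
exact: cvg_pair h1 h2.
Qed.

Lemma continuous_int01_slice (G : R * R -> R) : continuous G ->
  continuous (fun t => int01 (fun s => G (t, s))).
Proof.
move=> cG t; apply/cvgrPdist_le => e e0.
have cK : compact (`[t, t] `*` `[(0 : R), 1]).
  by apply: compact_setX; exact: segment_compact.
have [d d0 hd] := heine cK cG e0.
near=> t'; have bt : ball t d t' by near: t'; exact: (nbhsx_ballx t d d0).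
apply: int01_dist; [exact: continuous_slice..|] => s s01; apply: ltW.
apply: hd; first by split; rewrite /= in_itv /= ?lexx.
by split => //=; exact: ballxx.
Unshelve. all: by end_near. Qed.

Definition rsum2 n (G : R * R -> R) : R := rsum n (fun t => rsum n (fun s => G (t, s))).
Definition int01_2 (G : R * R -> R) : R := int01 (fun t => int01 (fun s => G (t, s))).

Lemma rsum2_cvg (G : R * R -> R) : continuous G -> rsum2 n G @[n --> \oo] --> int01_2 G.
Proof.
move=> cG; apply/cvgrPdist_le => e e0; have e2 : 0 < e / 2 by rewrite divr_gt0.
have cK : compact (`[(0 : R), 1] `*` `[(0 : R), 1]).
  by apply: compact_setX; exact: segment_compact.
have [d d0 hd] := heine cK cG e2.
have /cvgrPdist_le/(_ _ e2) cH := rsum_cvg (continuous_int01_slice cG).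
near=> n; have [n0 nd] : (0 < n)%N /\ n%:R^-1 < d :> R by near: n; exact: near_invn.
have h1 : `|int01_2 G - rsum n (fun t => int01 (fun s => G (t, s)))| <= e / 2 by near: n.
have h2 : `|rsum2 n G - rsum n (fun t => int01 (fun s => G (t, s)))| <= e / 2.
  apply: rsum_dist => // t t01; apply: rsum_error => //; first exact: continuous_slice.
  move=> s s' s01 s'01 ss'; apply: ltW; apply: hd; first by split; rewrite /= in_itv.
  by split => /=; [exact: ballxx|exact: le_lt_trans ss' nd].
rewrite -(subrKA (rsum n (fun t => int01 (fun s => G (t, s))))).
apply: le_trans (ler_normD _ _) _; rewrite [X in _ + X]distrC; lra.
Unshelve. all: by end_near. Qed.

Lemma measurable_continuous f (D : set R) : continuous f -> measurable_fun D f.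
Proof. by move=> cf; apply: measurable_funTS; exact: continuous_measurable_fun. Qed.

Lemma cvg_int01 (F : nat -> R -> R) (f : R -> R) : (forall k, continuous (F k)) ->
  (forall k t, 0 <= F k t) -> (forall k t, F k t <= F k.+1 t) ->
  (forall t, F k t @[k --> \oo] --> f t) ->
  (int01 (F k))%:E @[k --> \oo] --> (\int[mu]_(t in `[0%R, 1%R]) (f t)%:E)%E.
Proof.
move=> cF F0 Fnd Ff.
have -> : (\int[mu]_(t in `[0%R, 1%R]) (f t)%:E)%E =
          (\int[mu]_(t in `[0%R, 1%R]) limn (fun k => (F k t)%:E))%E.
  apply: eq_integral => t _; apply/esym/cvg_lim => //.
  by apply: cvg_EFin; [exact: nearW|exact: Ff].
under eq_fun do rewrite -int01E //.
apply: (@cvg_monotone_convergence _ _ _ mu `[0%R, 1%R] _ (fun k t => (F k t)%:E)) => //.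
- by move=> k; apply/measurable_EFinP; exact: measurable_continuous.
- by move=> k t _; rewrite lee_fin.
- move=> t _; apply/nondecreasing_seqP => k; by rewrite lee_fin.
Qed.

(* The inner integral of the limit may be infinite, hence the detour through [\bar R]. *)
Lemma int2_monotone_le (G : nat -> R * R -> R) (g : R -> R -> R) (C : R) :
  (forall k, continuous (G k)) -> (forall k p, 0 <= G k p) ->
  (forall k p, G k p <= G k.+1 p) ->
  (forall t s, G k (t, s) @[k --> \oo] --> g t s) ->
  (forall k, int01_2 (G k) <= C) ->
  (\int[mu]_(t in `[0%R, 1%R]) \int[mu]_(s in `[0%R, 1%R]) (g t s)%:E <= C%:E)%E.
Proof.
move=> cG G0 Gnd Gg GC.
pose H k t : \bar R := (int01 (fun s => G k (t, s)))%:E.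
have Hnd t : nondecreasing_seq (H ^~ t).
  apply/nondecreasing_seqP => k; rewrite lee_fin; apply: le_int01 => //; exact: continuous_slice.
have -> : (\int[mu]_(t in `[0%R, 1%R]) \int[mu]_(s in `[0%R, 1%R]) (g t s)%:E =
          \int[mu]_(t in `[0%R, 1%R]) limn (H ^~ t))%E.
  apply: eq_integral => t _; apply/esym/cvg_lim => //.
  apply: (@cvg_int01 (fun k s => G k (t, s)) (g t)) => // k; exact: continuous_slice.
have cvgH : (\int[mu]_(t in `[0%R, 1%R]) H k t)%E @[k --> \oo] -->
            (\int[mu]_(t in `[0%R, 1%R]) limn (H ^~ t))%E.
  apply: (@cvg_monotone_convergence _ _ _ mu `[0%R, 1%R] _ H) => //.
  - by move=> k; apply/measurable_EFinP; apply: measurable_continuous; exact: continuous_int01_slice.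
  - move=> k t _; rewrite lee_fin -[leLHS]int01_cst; apply: le_int01 => //.
      by move=> ?; exact: cvg_cst.
    exact: continuous_slice.
rewrite -(cvg_lim _ cvgH) //; apply: lime_le; first by apply/cvg_ex; eexists; exact: cvgH.
apply: nearW => k; rewrite /H int01E; last exact: continuous_int01_slice.
by rewrite lee_fin; exact: GC.
Qed.

End RiemannSums.

(** * Polynomial test functions and separable kernels *)

Section PolynomialFunctions.
Local Open Scope classical_set_scope.
Variable R : realType.
Notation pt := (R * R)%type.

(** A class stable under directional derivatives, as the recursion in [Ck] requires. *)
Inductive polyfun : (pt -> R) -> Prop :=
| polyfun_cst (c : R) : polyfun (fun=> c)
| polyfun_fst : polyfun (fun x => x.1)
| polyfun_snd : polyfun (fun x => x.2)
| polyfun_add f g : polyfun f -> polyfun g -> polyfun (fun x => f x + g x)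
| polyfun_mul f g : polyfun f -> polyfun g -> polyfun (fun x => f x * g x).

Lemma polyfun_sum (I : Type) (r : seq I) (F : I -> pt -> R) :
  (forall i, polyfun (F i)) -> polyfun (fun x => \sum_(i <- r) F i x).
Proof.
move=> HF; elim: r => [|i r IH].
  by under eq_fun do rewrite big_nil; exact: polyfun_cst.
by under eq_fun do rewrite big_cons; apply: polyfun_add.
Qed.

Lemma differentiable_fst (x : pt) : differentiable (fun y : pt => y.1) x.
Proof.
apply: (@linear_differentiable _ _ _ (fst : {linear (R * R)%type -> R})).
by move=> y; exact: cvg_fst.
Qed.

Lemma differentiable_snd (x : pt) : differentiable (fun y : pt => y.2) x.
Proof.
apply: (@linear_differentiable _ _ _ (snd : {linear (R * R)%type -> R})).
by move=> y; exact: cvg_snd.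
Qed.

Lemma derive_fst (x v : pt) : 'D_v (fun y : pt => y.1) x = v.1.
Proof.
rewrite deriveE; last exact: differentiable_fst.
by rewrite (@diff_lin _ _ _ (fst : {linear (R * R)%type -> R})) // => y; exact: cvg_fst.
Qed.

Lemma derive_snd (x v : pt) : 'D_v (fun y : pt => y.2) x = v.2.
Proof.
rewrite deriveE; last exact: differentiable_snd.
by rewrite (@diff_lin _ _ _ (snd : {linear (R * R)%type -> R})) // => y; exact: cvg_snd.
Qed.

Lemma polyfun_differentiable f : polyfun f -> forall x, differentiable f x.
Proof.
elim=> [c x|x|x|g h _ dg _ dh x|g h _ dg _ dh x].
- exact: differentiable_cst.
- exact: differentiable_fst.
- exact: differentiable_snd.
- by apply: differentiableD; [exact: dg|exact: dh].
- by apply: differentiableM; [exact: dg|exact: dh].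
Qed.

Lemma polyfun_derive f v : polyfun f -> polyfun (fun x => 'D_v f x).
Proof.
have D g x : polyfun g -> derivable g x v.
  by move=> pg; apply: diff_derivable; exact: polyfun_differentiable.
elim=> [c|||g h pg dg ph dh|g h pg dg ph dh].
- under eq_fun do rewrite derive_cst; exact: polyfun_cst.
- under eq_fun do rewrite derive_fst; exact: polyfun_cst.
- under eq_fun do rewrite derive_snd; exact: polyfun_cst.
- rewrite (_ : (fun x => _) = (fun x => 'D_v g x + 'D_v h x)).
    exact: polyfun_add.
  by apply/funext => x; rewrite (@deriveD _ _ _ g h x v) //; exact: D.
- rewrite (_ : (fun x => _) = (fun x => g x * 'D_v h x + h x * 'D_v g x)).
    by apply: polyfun_add; exact: polyfun_mul.
  by apply/funext => x; rewrite (@deriveM _ _ g h x v) //; exact: D.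
Qed.

Lemma polyfun_continuous f : polyfun f -> continuous f.
Proof. by move=> pf x; apply: differentiable_continuous; exact: polyfun_differentiable. Qed.

Lemma polyfun_smooth f : polyfun f -> smooth f.
Proof.
move=> pf k; elim: k f pf => [|k IH] f pf /=; first exact: polyfun_continuous.
split; first exact: polyfun_differentiable.
by move=> v; apply: IH; exact: polyfun_derive.
Qed.

(** Kernels of finite rank: integration against a density in [y] yields a combination of the fixed
    polynomials [p i], with moments of the density as coefficients. *)
Definition separable_kernel (F : pt -> pt -> R) : Prop :=
  exists (I : finType) (p q : I -> pt -> R),
    [/\ forall i, polyfun (p i), forall i, polyfun (q i) &
        forall x y, F x y = \sum_i p i x * q i y].

Lemma separable_cst (c : R) : separable_kernel (fun _ _ => c).
Proof.
exists 'I_1, (fun _ _ => c), (fun _ _ => 1); split; try by move=> ?; exact: polyfun_cst.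
by move=> x y; rewrite big_ord1 mulr1.
Qed.

Lemma separable_prod f g : polyfun f -> polyfun g -> separable_kernel (fun x y => f x * g y).
Proof.
move=> pf pg; exists 'I_1, (fun _ => f), (fun _ => g); split => // x y.
by rewrite big_ord1.
Qed.

Lemma separable_add F G : separable_kernel F -> separable_kernel G ->
  separable_kernel (fun x y => F x y + G x y).
Proof.
move=> [I [p [q [hp hq hF]]]] [J [p' [q' [hp' hq' hG]]]].
exists (I + J)%type, (fun i => match i with inl a => p a | inr b => p' b end),
  (fun i => match i with inl a => q a | inr b => q' b end).
by split; [case|case|move=> x y; rewrite big_sumType hF hG].
Qed.

Lemma separable_mul F G : separable_kernel F -> separable_kernel G ->
  separable_kernel (fun x y => F x y * G x y).
Proof.
move=> [I [p [q [hp hq hF]]]] [J [p' [q' [hp' hq' hG]]]].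
exists (I * J)%type, (fun i x => p i.1 x * p' i.2 x), (fun i x => q i.1 x * q' i.2 x).
split; [by move=> i; exact: polyfun_mul|by move=> i; exact: polyfun_mul|].
move=> x y; rewrite hF hG mulr_suml -(pair_bigA _ (fun i j => p i x * p' j x * (q i y * q' j y))) /=.
by apply: eq_bigr => i _; rewrite mulr_sumr; apply: eq_bigr => j _; rewrite mulrACA.
Qed.

Lemma separable_horner (P : {poly R}) F : separable_kernel F ->
  separable_kernel (fun x y => P.[F x y]).
Proof.
move=> sF; elim/poly_ind: P => [|P c IH].
  by under eq_fun do under eq_fun do rewrite horner0; exact: separable_cst.
under eq_fun do under eq_fun do rewrite hornerMXaddC.
by apply: separable_add; [exact: separable_mul|exact: separable_cst].
Qed.

(** The first branch of [bker], written in the squared distance and hence polynomial in the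
    coordinates. The two agree at distances up to r^2, and r will be chosen so large that no others
    occur on the segments. *)
Definition pkernel (N : nat) (r : R) (x y : pt) : R :=
  r^-1 * (bpoly R N).[1 - ((x.1 - y.1) ^+ 2 + (x.2 - y.2) ^+ 2) / r ^+ 4].

Lemma separable_pkernel N r : separable_kernel (pkernel N r).
Proof.
apply: separable_mul; first exact: separable_cst.
apply: separable_horner.
have s1 : separable_kernel (fun x y => x.1 - y.1).
  rewrite (_ : (fun x y => _) = (fun x y => x.1 * 1 + (-1) * y.1)).
    by apply: separable_add; apply: separable_prod; (exact: polyfun_fst || exact: polyfun_cst).
  by apply/funext => x; apply/funext => y; ring.
have s2 : separable_kernel (fun x y => x.2 - y.2).
  rewrite (_ : (fun x y => _) = (fun x y => x.2 * 1 + (-1) * y.2)).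
    by apply: separable_add; apply: separable_prod; (exact: polyfun_snd || exact: polyfun_cst).
  by apply/funext => x; apply/funext => y; ring.
rewrite (_ : (fun x y => _) = (fun x y =>
   1 + ((x.1 - y.1) * (x.1 - y.1) + (x.2 - y.2) * (x.2 - y.2)) * - (r ^- 4))).
  apply: separable_add; first exact: separable_cst.
  by apply: separable_mul; [apply: separable_add; exact: separable_mul|exact: separable_cst].
by apply/funext => x; apply/funext => y; ring.
Qed.

Lemma pkernelE N r x y : edist x y <= r ^+ 2 -> pkernel N r x y = bker N r (edist x y).
Proof. by move=> h; rewrite /pkernel /bker h edist_sqr. Qed.

End PolynomialFunctions.

(** * Limits of Riemann sums with varying coefficients *)

Section RiemannAlgebra.
Local Open Scope classical_set_scope.
Variable R : realType.
Notation pt := (R * R)%type.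

Lemma continuous_sum (T : topologicalType) (I : Type) (r : seq I) (F : I -> T -> R) :
  (forall i, continuous (F i)) -> continuous (fun x => \sum_(i <- r) F i x).
Proof.
move=> HF; elim: r => [|i r IH].
  rewrite (_ : (fun x => _) = fun=> 0); first by move=> x; exact: cvg_cst.
  by apply/funext => x; rewrite big_nil.
rewrite (_ : (fun x => _) = fun x => F i x + \sum_(j <- r) F j x).
  by move=> x; apply: cvgD; [exact: HF|exact: IH].
by apply/funext => x; rewrite big_cons.
Qed.

Lemma continuous_scale (T : topologicalType) (a : R) (F : T -> R) :
  continuous F -> continuous (fun x => a * F x).
Proof.
by move=> cF x; apply: (@cvgM _ _ _ _ (fun=> a) F); [exact: cvg_cst|exact: cF].
Qed.

Lemma continuous_mul (T : topologicalType) (F G : T -> R) :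
  continuous F -> continuous G -> continuous (fun x => F x * G x).
Proof. by move=> cF cG x; apply: (@cvgM _ _ _ _ F G); [exact: cF|exact: cG]. Qed.

Lemma continuous_on_gam (f : pt -> R) g : continuous f -> continuous (fun t => f (gam g t)).
Proof.
move=> cf t; apply: (@continuous_comp _ _ _ (gam g) f); last exact: cf.
exact: continuous_gam.
Qed.

Lemma continuous_on_gam1 (f : pt -> R) g : continuous f ->
  continuous (fun p : R * R => f (gam g p.1)).
Proof.
move=> cf p; apply: (@continuous_comp _ _ _ fst (fun t => f (gam g t))); first exact: cvg_fst.
exact: continuous_on_gam.
Qed.

Lemma continuous_on_gam2 (f : pt -> R) g : continuous f ->
  continuous (fun p : R * R => f (gam g p.2)).
Proof.
move=> cf p; apply: (@continuous_comp _ _ _ snd (fun t => f (gam g t))); first exact: cvg_snd.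
exact: continuous_on_gam.
Qed.

Lemma cvg_fin_sum (I : Type) (r : seq I) (f : I -> nat -> R) (l : I -> R) :
  (forall i, f i n @[n --> \oo] --> l i) ->
  \sum_(i <- r) f i n @[n --> \oo] --> \sum_(i <- r) l i.
Proof.
move=> H; elim: r => [|i r IH].
  rewrite big_nil (_ : (fun n => _) = fun=> 0); first exact: cvg_cst.
  by apply/funext => n; rewrite big_nil.
rewrite big_cons (_ : (fun n => _) = fun n => f i n + \sum_(j <- r) f j n).
  by apply: cvgD; [exact: H|exact: IH].
by apply/funext => n; rewrite big_cons.
Qed.

Lemma rsum_sum n (I : Type) (r : seq I) (a : I -> R) (F : I -> R -> R) :
  rsum n (fun t => \sum_(k <- r) a k * F k t) = \sum_(k <- r) a k * rsum n (F k).
Proof.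
rewrite /rsum exchange_big /= mulr_sumr; apply: eq_bigr => k _.
by rewrite -mulr_sumr mulrCA.
Qed.

Lemma rsum2_sum n (I : Type) (r : seq I) (a : I -> R) (G : I -> R * R -> R) :
  rsum2 n (fun p => \sum_(k <- r) a k * G k p) = \sum_(k <- r) a k * rsum2 n (G k).
Proof.
rewrite /rsum2 -rsum_sum; congr (rsum n); apply/funext => t.
exact: rsum_sum.
Qed.

Lemma cvgn_unique (f : nat -> R) (a b : R) :
  f n @[n --> \oo] --> a -> f n @[n --> \oo] --> b -> a = b.
Proof. by move=> fa fb; exact: norm_cvg_unique fa fb. Qed.

(** Squares of sampled potentials depend on [n] themselves, but only through finitely many
    convergent coefficients. *)
Lemma rsum_moving (I : finType) (a : nat -> I -> R) (b : I -> R) (F : I -> R -> R) :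
  (forall k, continuous (F k)) -> (forall k, a n k @[n --> \oo] --> b k) ->
  rsum n (fun t => \sum_k a n k * F k t) @[n --> \oo] --> int01 (fun t => \sum_k b k * F k t).
Proof.
move=> cF ab; have lim (c : nat -> I -> R) : (forall k, c n k @[n --> \oo] --> b k) ->
    rsum n (fun t => \sum_k c n k * F k t) @[n --> \oo] --> \sum_k b k * int01 (F k).
  move=> cb; under eq_fun do rewrite rsum_sum.
  by apply: cvg_fin_sum => k; apply: cvgM; [exact: cb|exact: rsum_cvg].
(* Linearity of the integral follows from the same limit with constant coefficients. *)
suff -> : int01 (fun t => \sum_k b k * F k t) = \sum_k b k * int01 (F k) by exact: lim.
have h1 := lim (fun _ => b) (fun k => cvg_cst _).
apply: (@cvgn_unique (fun n => rsum n (fun t => \sum_k b k * F k t))); last exact: h1.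
by apply: rsum_cvg; apply: continuous_sum => k; exact: continuous_scale.
Qed.

Lemma rsum2_moving (I : finType) (a : nat -> I -> R) (b : I -> R) (G : I -> R * R -> R) :
  (forall k, continuous (G k)) -> (forall k, a n k @[n --> \oo] --> b k) ->
  rsum2 n (fun p => \sum_k a n k * G k p) @[n --> \oo] -->
  int01_2 (fun p => \sum_k b k * G k p).
Proof.
move=> cG ab; have lim (c : nat -> I -> R) : (forall k, c n k @[n --> \oo] --> b k) ->
    rsum2 n (fun p => \sum_k c n k * G k p) @[n --> \oo] --> \sum_k b k * int01_2 (G k).
  move=> cb; under eq_fun do rewrite rsum2_sum.
  by apply: cvg_fin_sum => k; apply: cvgM; [exact: cb|exact: rsum2_cvg].
suff -> : int01_2 (fun p => \sum_k b k * G k p) = \sum_k b k * int01_2 (G k) by exact: lim.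
have h1 := lim (fun _ => b) (fun k => cvg_cst _).
apply: (@cvgn_unique (fun n => rsum2 n (fun t => \sum_k b k * G k t))); last exact: h1.
by apply: rsum2_cvg; apply: continuous_sum => k; exact: continuous_scale.
Qed.

Lemma int01_lin (I : Type) (s : seq I) (b : I -> R) (F : I -> R -> R) :
  (forall k, continuous (F k)) ->
  int01 (fun t => \sum_(k <- s) b k * F k t) = \sum_(k <- s) b k * int01 (F k).
Proof.
move=> cF; have h : rsum n (fun t => \sum_(k <- s) b k * F k t) @[n --> \oo] -->
    \sum_(k <- s) b k * int01 (F k).
  under eq_fun do rewrite rsum_sum.
  by apply: cvg_fin_sum => k; apply: cvgM; [exact: cvg_cst|exact: rsum_cvg].
apply: (@cvgn_unique (fun n => rsum n (fun t => \sum_(k <- s) b k * F k t))); last exact: h.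
by apply: rsum_cvg; apply: continuous_sum => k; exact: continuous_scale.
Qed.

Lemma int01Z (c : R) (f : R -> R) : continuous f -> int01 (fun t => c * f t) = c * int01 f.
Proof.
move=> cf; have := @int01_lin _ [:: tt] (fun=> c) (fun=> f) (fun=> cf).
by rewrite big_seq1 => <-; congr int01; apply/funext => t; rewrite big_seq1.
Qed.

(** Fubini for continuous functions: the finite sums can be exchanged and limits are unique. *)
Lemma int01_2_swap (G : R * R -> R) : continuous G ->
  int01_2 (fun p => G (p.2, p.1)) = int01_2 G.
Proof.
move=> cG; have cG' : continuous (fun p : R * R => G (p.2, p.1)).
  move=> p; apply: (@continuous_comp _ _ _ (fun p : R * R => (p.2, p.1)) G); last exact: cG.
  have h1 : snd x @[x --> p] --> p.2 by exact: cvg_snd.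
  have h2 : fst x @[x --> p] --> p.1 by exact: cvg_fst.
  exact: cvg_pair h1 h2.
have h1 := rsum2_cvg cG'; have h2 := rsum2_cvg cG.
apply: (@cvgn_unique (fun n => rsum2 n (fun p => G (p.2, p.1)))) => //.
rewrite (_ : (fun n => rsum2 n _) = (fun n => rsum2 n G)) //.
apply/funext => n; rewrite /rsum2 /rsum; congr (_ * _).
rewrite -!mulr_sumr; congr (_ * _); exact: exchange_big.
Qed.

Lemma sum_sqr_le_seq (T : Type) (s : seq T) (a : T -> R) :
  (\sum_(g <- s) a g) ^+ 2 <= (size s)%:R * \sum_(g <- s) a g ^+ 2.
Proof.
rewrite !(big_tnth _ _ s) /=; have := sum_sqr_le (fun i : 'I_(size s) => a (tnth (in_tuple s) i)).
by rewrite card_ord.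
Qed.

End RiemannAlgebra.

(** * Norms of sampled potentials *)

Section PotentialBound.
Local Open Scope classical_set_scope.
Variable R : realType.
Notation pt := (R * R)%type.
Implicit Types (s : seq (segment R)) (u : pt -> R) (N n : nat) (r : R).

Definition bI s (f : pt -> R) : R := \sum_(g <- s) seg_len g * int01 (fun t => f (gam g t)).

Definition rI s n (f : pt -> R) : R := \sum_(g <- s) seg_len g * rsum n (fun t => f (gam g t)).

Lemma rI_cvg s f : continuous f -> rI s n f @[n --> \oo] --> bI s f.
Proof.
move=> cf; apply: cvg_fin_sum => g; apply: cvgM; first exact: cvg_cst.
by apply: rsum_cvg; exact: continuous_on_gam.
Qed.

Definition potential N r s u (x : pt) : R := bI s (fun y => pkernel N r x y * u y).
(** The inner variable uses the same [n] points as the outer ones, so that the discrete norms are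
    the finite sums estimated before. *)
Definition sampled_potential N r s u n (x : pt) : R := rI s n (fun y => pkernel N r x y * u y).

(** The same polynomials [p] serve the potential and all its sampled versions, which [rsum_moving]
    and [rsum2_moving] require. *)
Lemma potential_expansion N r s u : continuous u ->
  exists (I : finType) (p : I -> pt -> R) (a : nat -> I -> R) (b : I -> R),
  [/\ forall i, polyfun (p i), forall i, a n i @[n --> \oo] --> b i,
      forall n x, sampled_potential N r s u n x = \sum_i a n i * p i x &
      forall x, potential N r s u x = \sum_i b i * p i x].
Proof.
move=> cu; have [I [p [q [hp hq hK]]]] := separable_pkernel N r.
have cqu i : continuous (fun y => q i y * u y).
  by apply: continuous_mul => //; exact: polyfun_continuous.
exists I, p, (fun n i => rI s n (fun y => q i y * u y)), (fun i => bI s (fun y => q i y * u y)).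
split => //.
- by move=> i; exact: rI_cvg.
- move=> n x; rewrite /sampled_potential /rI.
  under [RHS]eq_bigr do rewrite mulr_suml.
  rewrite exchange_big /=; apply: eq_bigr => g _.
  under [RHS]eq_bigr do rewrite -mulrA.
  rewrite -mulr_sumr; congr (_ * _).
  under [RHS]eq_bigr do rewrite mulrC.
  rewrite -rsum_sum; congr (rsum n); apply/funext => t.
  by rewrite hK mulr_suml; apply: eq_bigr => i _; rewrite mulrA.
- move=> x; rewrite /potential /bI.
  under [RHS]eq_bigr do rewrite mulr_suml.
  rewrite exchange_big /=; apply: eq_bigr => g _.
  under [RHS]eq_bigr do rewrite -mulrA.
  rewrite -mulr_sumr; congr (_ * _).
  under [RHS]eq_bigr do rewrite mulrC.
  rewrite -int01_lin; last by move=> i; apply: (@continuous_on_gam _ (fun y => q i y * u y)).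
  congr int01; apply/funext => t.
  by rewrite hK mulr_suml; apply: eq_bigr => i _; rewrite mulrA.
Qed.

(** M = r^4 then bounds the squared distance, and M^(-1/4) = r^-1 involves no root. *)
Definition diam_le s r := forall g h t t', g \in s -> h \in s ->
  0 <= t <= 1 -> 0 <= t' <= 1 -> edist (gam g t) (gam h t') <= r ^+ 2.

Lemma diam_exists s : exists2 r : R, 0 < r & diam_le s r.
Proof.
pose B := \sum_(g <- s) (edist g.1 (0, 0) + seg_len g).
have B0 : 0 <= B by rewrite sumr_ge0 // => g _; rewrite addr_ge0 // edist_ge0.
have hB g t : g \in s -> 0 <= t <= 1 -> edist (gam g t) (0, 0) <= B.
  move=> gs t01; apply: (@le_trans _ _ (edist g.1 (0, 0) + seg_len g)).
    rewrite addrC; apply: le_trans (edist_tri _ g.1 _) _; rewrite lerD2r.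
    have e1 : gam g 0 = g.1 by rewrite /gam !mul0r !addr0; case: (g.1).
    move: t01 => /andP[t0 t1].
    by rewrite -[X in edist _ X]e1 edist_gam subr0 ger0_norm // ler_piMr ?edist_ge0.
  rewrite /B (big_rem g) //= lerDl sumr_ge0 // => h _.
  by rewrite addr_ge0 // edist_ge0.
exists (1 + 2 * B); first by lra.
move=> g h t t' gs hs t01 t'01; apply: le_trans (edist_tri _ (0, 0) _) _.
rewrite (edistC (0, 0)); have := hB g t gs t01; have := hB h t' hs t'01; nra.
Qed.

(** In units of 1/n the homogeneity -1/2 of the limit kernel yields sqrt n; for large n the other
    factor comes from [kernel_class 4]. *)
Lemma pkernel_scaled N r s n g h (t t' : R) : diam_le s r -> g \in s -> h \in s ->
  0 <= t <= 1 -> 0 <= t' <= 1 -> (0 < n)%N ->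
  pkernel N r (gam h t) (gam g t') =
  Num.sqrt n%:R * (bker N r (n%:R * edist (gam h t) (gam g t') / n%:R) * isq n%:R).
Proof.
move=> dm gs hs t01 t'01 n0; have nr : (0 : R) < n%:R by rewrite ltr0n.
rewrite pkernelE; last exact: dm.
rewrite [n%:R * _]mulrC mulfK ?gt_eqF // mulrCA.
by rewrite divff ?mulr1 // gt_eqF // sqrtr_gt0.
Qed.

Lemma seg_len_sqr_le s g : g \in s -> seg_len g ^+ 2 <= (\sum_(g <- s) seg_len g) * seg_len g.
Proof.
move=> gs; rewrite expr2 ler_wpM2r ?edist_ge0 // (big_rem g) //= lerDl sumr_ge0 // => h _.
exact: edist_ge0.
Qed.

Lemma rsum_sqr_ge0 n (f : R -> R) : 0 <= rsum n (fun t => f t ^+ 2).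
Proof. by rewrite /rsum mulr_ge0 ?invr_ge0 // sumr_ge0 // => i _; exact: sqr_ge0. Qed.

Lemma sum_seg_sqr_le s n (f : pt -> R) :
  \sum_(g <- s) seg_len g ^+ 2 * rsum n (fun t => f (gam g t) ^+ 2) <=
  (\sum_(g <- s) seg_len g) * rI s n (fun x => f x ^+ 2).
Proof.
rewrite /rI mulr_sumr big_seq [leRHS]big_seq; apply: ler_sum => g gs.
by rewrite mulrA ler_wpM2r ?rsum_sqr_ge0 // seg_len_sqr_le.
Qed.

(** Powers of n: n^-2 from the outer Riemann sums, (n^-1 sqrt n)^2 = n^-1 from the inner one and the
    scaling, n^2 from the denominator. The remaining n^-1 turns the sum of the u^2 into a Riemann
    sum. The condition n^-2 <= e makes the regularised denominator at least that of [energy] divided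
    by n^2. *)
Lemma sampled_energy_bound s r : 0 < r -> diam_le s r ->
  (forall g, g \in s -> g.1 <> g.2) ->
  (forall g h, g \in s -> h \in s -> g <> h ->
     forall p q, seg_set g p -> seg_set h p -> seg_set g q -> seg_set h q -> p = q) ->
  exists2 C : R, 0 <= C & forall N u n h h' (e : R), (0 < n)%N -> bker N r 0 ^+ 2 <= n%:R ->
    n%:R ^- 2 <= e -> h \in s -> h' \in s ->
    rsum2 n (fun p => (sampled_potential N r s u n (gam h p.1)
                     - sampled_potential N r s u n (gam h' p.2)) ^+ 2
                     / (edist (gam h p.1) (gam h' p.2) ^+ 2 + e)) <=
    C * rI s n (fun x => u x ^+ 2).
Proof.
move=> r0 dm nd uq; have [C C0 hC] := energy_bound 4 nd uq.
have L0 : 0 <= \sum_(g <- s) seg_len g by rewrite sumr_ge0 // => g _; exact: edist_ge0.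
exists ((size s)%:R * C * \sum_(g <- s) seg_len g); first by rewrite !mulr_ge0.
move=> N u n h h' e n0 kn ne hs h's; have nr : (0 : R) < n%:R by rewrite ltr0n.
have e0 : 0 < e by apply: lt_le_trans ne; rewrite invr_gt0 exprn_gt0.
pose k d := bker N r (d / n%:R) * isq n%:R.
have kc : kernel_class 4 k := bker_kernel_class r0 n0 kn.
pose T g (i i' : nat) := \sum_(j < n) (k (n%:R * edist (sample h n i) (sample g n j))
                 - k (n%:R * edist (sample h' n i') (sample g n j))) * u (sample g n j).
pose D (i i' : nat) := (n%:R * edist (sample h n i) (sample h' n i')) ^+ 2 + 1.
have D0 i i' : 0 < D i i' by rewrite /D ltr_wpDl ?sqr_ge0.
apply: (@le_trans _ _ (n%:R^-1 * \sum_(i < n) n%:R^-1 * \sum_(i' < n)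
    ((size s)%:R * \sum_(g <- s) seg_len g ^+ 2 * n%:R * (T g i i' ^+ 2 / D i i')))).
  rewrite /rsum2 /rsum ler_wpM2l ?invr_ge0 ?(ltW nr) //; apply: ler_sum => i _.
  rewrite ler_wpM2l ?invr_ge0 ?(ltW nr) //; apply: ler_sum => i' _ /=.
  rewrite -/(sample h n i) -/(sample h' n i').
  have -> : sampled_potential N r s u n (sample h n i) - sampled_potential N r s u n (sample h' n i')
     = \sum_(g <- s) seg_len g * (n%:R^-1 * (Num.sqrt n%:R * T g i i')).
    rewrite /sampled_potential /rI -sumrB !big_seq; apply: eq_bigr => g gs.
    rewrite -mulrBr; congr (_ * _); rewrite /rsum -mulrBr; congr (_ * _).
    rewrite -sumrB mulr_sumr; apply: eq_bigr => j _; rewrite -/(sample g n j).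
    by rewrite -mulrBl mulrA mulrBr /k /sample -!(pkernel_scaled N dm) ?sample_itv.
  apply: (@le_trans _ _ ((size s)%:R *
     (\sum_(g <- s) (seg_len g * (n%:R^-1 * (Num.sqrt n%:R * T g i i'))) ^+ 2)
      * (n%:R ^+ 2 / D i i'))).
    apply: ler_pM; rewrite ?sqr_ge0 ?invr_ge0 ?sum_sqr_le_seq //.
      by rewrite addr_ge0 ?sqr_ge0 // ltW.
    rewrite -[leLHS]mul1r ler_pdivrMr ?ltr_wpDl ?sqr_ge0 // mulrAC ler_pdivlMr // mul1r.
    rewrite /D exprMn mulrDr lerD2l -ler_pdivrMl ?exprn_gt0 // mulr1; exact: ne.
  rewrite -mulrA ler_wpM2l // mulr_suml; apply: ler_sum => g _.
  rewrite !exprMn (@sqr_sqrtr _ n%:R) ?(ltW nr) // le_eqVlt; apply/orP; left; apply/eqP.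
  by field; rewrite !gt_eqF.
apply: (@le_trans _ _ ((size s)%:R * \sum_(g <- s) seg_len g ^+ 2 *
    (n%:R^-1 * energy k h h' g n (fun j => u (sample g n j))))).
  rewrite le_eqVlt; apply/orP; left; apply/eqP.
  rewrite /energy -/(T _ _ _).
  transitivity (\sum_(g <- s) \sum_(i < n) \sum_(i' < n)
     ((size s)%:R * (seg_len g ^+ 2 * n%:R^-1 * (T g i i' ^+ 2 / D i i')))).
    rewrite mulr_sumr exchange_big /=; apply: eq_bigr => i _.
    rewrite !mulr_sumr exchange_big /=; apply: eq_bigr => i' _.
    rewrite !mulr_sumr; apply: eq_bigr => g _.
    by field; rewrite !gt_eqF.
  rewrite mulr_sumr; apply: eq_bigr => g _.
  rewrite !mulr_sumr; apply: eq_bigr => i _.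
  rewrite !mulr_sumr; apply: eq_bigr => i' _.
  by rewrite /T /D !mulrA.
apply: (@le_trans _ _ ((size s)%:R * \sum_(g <- s) C * (seg_len g ^+ 2 *
    rsum n (fun t => u (gam g t) ^+ 2)))).
  rewrite ler_wpM2l // !big_seq; apply: ler_sum => g gs.
  rewrite [leRHS]mulrCA ler_wpM2l ?sqr_ge0 // /rsum [leRHS]mulrCA ler_wpM2l ?invr_ge0 ?(ltW nr) //.
  exact: (hC h h' g hs h's gs n k (fun j => u (sample g n j)) n0 kc).
rewrite -mulr_sumr mulrA -[leRHS]mulrA ler_wpM2l ?mulr_ge0 //.
exact: sum_seg_sqr_le.
Qed.

Lemma sampled_mass_bound s r : 0 < r -> diam_le s r ->
  (forall g, g \in s -> g.1 <> g.2) ->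
  exists2 C : R, 0 <= C & forall N u n h, (0 < n)%N -> bker N r 0 ^+ 2 <= n%:R -> h \in s ->
    rsum n (fun t => sampled_potential N r s u n (gam h t) ^+ 2) <=
    C * rI s n (fun x => u x ^+ 2).
Proof.
move=> r0 dm nd.
pose M h g C := forall n k (v : nat -> R), (0 < n)%N -> kernel_class 4 k ->
    \sum_(i < n) (\sum_(j < n)
      k (n%:R * edist (sample h n i) (sample g n j)) * v j) ^+ 2 <=
    C * n%:R * \sum_(j < n) v j ^+ 2.
have mono h g C C' : M h g C -> C <= C' -> M h g C'.
  move=> H CC n k v n0 kc; apply: le_trans (H n k v n0 kc) _.
  rewrite ler_wpM2r ?ler_wpM2r // sumr_ge0 // => j _; exact: sqr_ge0.
have [|h hs|C C0 hC] := @seq_uniform_bound R _ s (fun h C => forall g, g \in s -> M h g C).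
- by move=> h C C' H CC g gs; apply: mono CC; exact: H.
- apply: seq_uniform_bound; first by move=> g C C' H CC; apply: mono CC.
  by move=> g gs; apply: mass_bound => //; exact: nd.
have L0 : 0 <= \sum_(g <- s) seg_len g by rewrite sumr_ge0 // => g _; exact: edist_ge0.
exists ((size s)%:R * C * \sum_(g <- s) seg_len g); first by rewrite !mulr_ge0.
move=> N u n h n0 kn hs; have nr : (0 : R) < n%:R by rewrite ltr0n.
pose k d := bker N r (d / n%:R) * isq n%:R.
have kc : kernel_class 4 k := bker_kernel_class r0 n0 kn.
pose T g (i : nat) := \sum_(j < n) k (n%:R * edist (sample h n i) (sample g n j)) * u (sample g n j).
apply: (@le_trans _ _ ((size s)%:R * \sum_(g <- s) seg_len g ^+ 2 *
    (n%:R ^- 2 * \sum_(i < n) T g i ^+ 2))).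
  apply: (@le_trans _ _ (n%:R^-1 * \sum_(i < n)
     (size s)%:R * \sum_(g <- s) seg_len g ^+ 2 * (n%:R^-1 * T g i ^+ 2))).
    rewrite /rsum ler_wpM2l ?invr_ge0 ?(ltW nr) //; apply: ler_sum => i _.
    rewrite -/(sample h n i).
    have -> : sampled_potential N r s u n (sample h n i)
       = \sum_(g <- s) seg_len g * (n%:R^-1 * (Num.sqrt n%:R * T g i)).
      rewrite /sampled_potential /rI !big_seq; apply: eq_bigr => g gs.
      congr (_ * _); rewrite /rsum; congr (_ * _).
      rewrite mulr_sumr; apply: eq_bigr => j _; rewrite -/(sample g n j).
      by rewrite mulrA /k /sample -(pkernel_scaled N dm) ?sample_itv.
    apply: le_trans (sum_sqr_le_seq _ _) _; rewrite ler_wpM2l //; apply: ler_sum => g _.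
    rewrite !exprMn (@sqr_sqrtr _ n%:R) ?(ltW nr) // le_eqVlt; apply/orP; left; apply/eqP.
    by field; rewrite !gt_eqF.
  rewrite le_eqVlt; apply/orP; left; apply/eqP.
  rewrite !mulr_sumr.
  transitivity (\sum_(i < n) \sum_(g <- s) ((size s)%:R * (seg_len g ^+ 2 * (n%:R ^- 2 * T g i ^+ 2)))).
    apply: eq_bigr => i _; rewrite !mulr_sumr; apply: eq_bigr => g _.
    by field; rewrite gt_eqF.
  rewrite exchange_big /=; apply: eq_bigr => g _.
  by rewrite !mulr_sumr.
apply: (@le_trans _ _ ((size s)%:R * \sum_(g <- s) C * (seg_len g ^+ 2 *
    rsum n (fun t => u (gam g t) ^+ 2)))).
  rewrite ler_wpM2l // !big_seq; apply: ler_sum => g gs.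
  rewrite [leRHS]mulrCA ler_wpM2l ?sqr_ge0 //.
  have := hC h hs g gs n k (fun j => u (sample g n j)) n0 kc.
  have n2 : 0 <= n%:R ^- 2 :> R by rewrite invr_ge0 sqr_ge0.
  move=> /(ler_wpM2l n2) /le_trans; apply; rewrite /rsum le_eqVlt; apply/orP; left; apply/eqP.
  by field; rewrite gt_eqF.
rewrite -mulr_sumr mulrA -[leRHS]mulrA ler_wpM2l ?mulr_ge0 //.
exact: sum_seg_sqr_le.
Qed.

End PotentialBound.

(** * The H^(1/2) norm of the potentials *)

Section PotentialNorm.
Local Open Scope classical_set_scope.
Variable R : realType.
Notation pt := (R * R)%type.
Notation mu := (@lebesgue_measure R).
Implicit Types (s : seq (segment R)) (u : pt -> R) (N n : nat) (r : R).

Lemma potential_polyfun N r s u : continuous u -> polyfun (potential N r s u).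
Proof.
move=> cu; have [I [p [a [b [hp _ _ hb]]]]] := potential_expansion N r s cu.
rewrite (_ : potential N r s u = fun x => \sum_i b i * p i x); last exact/funext.
by apply: polyfun_sum => i; apply: polyfun_mul => //; exact: polyfun_cst.
Qed.

Lemma continuous_quotient (T : topologicalType) (F G : T -> R) :
  continuous F -> continuous G -> (forall x, G x != 0) -> continuous (fun x => F x / G x).
Proof.
move=> cF cG G0 x; apply: (@cvgM _ _ _ _ F (fun x => (G x)^-1)); first exact: cF.
by apply: cvgV => //; exact: cG.
Qed.

Lemma continuous_sqr (T : topologicalType) (F : T -> R) :
  continuous F -> continuous (fun x => F x ^+ 2).
Proof.
move=> cF; rewrite (_ : (fun x => _) = fun x => F x * F x).
  exact: continuous_mul.
by apply/funext => x; rewrite expr2.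
Qed.

Lemma continuous_add (T : topologicalType) (F G : T -> R) :
  continuous F -> continuous G -> continuous (fun x => F x + G x).
Proof. by move=> cF cG x; apply: cvgD; [exact: cF|exact: cG]. Qed.

Lemma continuous_edist2 g h : continuous (fun p : R * R => edist (gam g p.1) (gam h p.2)).
Proof.
apply: continuous_edist => p.
  by apply: (@continuous_comp _ _ _ fst (gam g)); [exact: cvg_fst|exact: continuous_gam].
by apply: (@continuous_comp _ _ _ snd (gam h)); [exact: cvg_snd|exact: continuous_gam].
Qed.

Lemma continuous_regularized (f : pt -> R) g h (e : R) : continuous f -> 0 < e ->
  continuous (fun p : R * R => (f (gam g p.1) - f (gam h p.2)) ^+ 2 /
     (edist (gam g p.1) (gam h p.2) ^+ 2 + e)).
Proof.
move=> cf e0; apply: continuous_quotient => [||p].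
- apply: continuous_sqr => q; apply: cvgB.
    exact: (@continuous_on_gam1 _ f g cf q).
  exact: (@continuous_on_gam2 _ f h cf q).
- apply: continuous_add; last by move=> ?; exact: cvg_cst.
  by apply: continuous_sqr; exact: continuous_edist2.
- by rewrite gt_eqF // ltr_wpDl ?sqr_ge0.
Qed.

(** For fixed N and e every large n meets both conditions of [sampled_energy_bound], and the
    constant depends on neither N nor e. *)
Lemma potential_energy_bound s r : 0 < r -> diam_le s r ->
  (forall g, g \in s -> g.1 <> g.2) ->
  (forall g h, g \in s -> h \in s -> g <> h ->
     forall p q, seg_set g p -> seg_set h p -> seg_set g q -> seg_set h q -> p = q) ->
  exists2 C : R, 0 <= C & forall N u h h' (e : R), continuous u -> 0 < e ->
    h \in s -> h' \in s ->
    int01_2 (fun p => (potential N r s u (gam h p.1) - potential N r s u (gam h' p.2)) ^+ 2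
                     / (edist (gam h p.1) (gam h' p.2) ^+ 2 + e)) <=
    C * bI s (fun x => u x ^+ 2).
Proof.
move=> r0 dm nd uq; have [C C0 hC] := sampled_energy_bound r0 dm nd uq.
exists C => // N u h h' e cu e0 hs h's.
have [I [p [a [b [hp ab ha hb]]]]] := potential_expansion N r s cu.
pose G (k : I * I) (z : R * R) := (p k.1 (gam h z.1) - p k.1 (gam h' z.2)) *
   (p k.2 (gam h z.1) - p k.2 (gam h' z.2)) / (edist (gam h z.1) (gam h' z.2) ^+ 2 + e).
have cp i : continuous (p i) by exact: polyfun_continuous.
have cG k : continuous (G k).
  apply: continuous_quotient => [||z].
  - have cd i : continuous (fun z : R * R => p i (gam h z.1) - p i (gam h' z.2)).
      move=> z; apply: cvgB; first exact: (@continuous_on_gam1 _ _ h (cp i) z).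
      exact: (@continuous_on_gam2 _ _ h' (cp i) z).
    by apply: continuous_mul; exact: cd.
  - apply: continuous_add; last by move=> ?; exact: cvg_cst.
    by apply: continuous_sqr; exact: continuous_edist2.
  - by rewrite gt_eqF // ltr_wpDl ?sqr_ge0.
have expand (c : I -> R) z :
    ((\sum_i c i * p i (gam h z.1)) - \sum_i c i * p i (gam h' z.2)) ^+ 2
     / (edist (gam h z.1) (gam h' z.2) ^+ 2 + e) = \sum_k c k.1 * c k.2 * G k z.
  rewrite -sumrB expr2 mulr_suml mulr_suml.
  rewrite -(pair_bigA _ (fun i j => c i * c j * G (i, j) z)) /=.
  apply: eq_bigr => i _; rewrite mulr_sumr mulr_suml; apply: eq_bigr => j _.
  by rewrite /G /=; ring.
have cvg1 : rsum2 n (fun z => \sum_k a n k.1 * a n k.2 * G k z) @[n --> \oo] -->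
    int01_2 (fun z => \sum_k b k.1 * b k.2 * G k z).
  apply: (@rsum2_moving _ _ (fun n k => a n k.1 * a n k.2) (fun k => b k.1 * b k.2) G cG) => k.
  exact: cvgM (ab k.1) (ab k.2).
rewrite (_ : (fun p => _) = fun z => \sum_k b k.1 * b k.2 * G k z); last first.
  by apply/funext => z; rewrite !hb expand.
have cu2 := continuous_sqr cu.
have cvg2 : C * rI s n (fun x => u x ^+ 2) @[n --> \oo] --> C * bI s (fun x => u x ^+ 2).
  by apply: cvgM; [exact: cvg_cst|exact: rI_cvg].
apply: (ler_cvg_to cvg1 cvg2); near=> n.
have [n0 ne] : (0 < n)%N /\ n%:R^-1 < e :> R by near: n; exact: near_invn.
rewrite (_ : (fun z => _) = fun z => (sampled_potential N r s u n (gam h z.1)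
   - sampled_potential N r s u n (gam h' z.2)) ^+ 2
     / (edist (gam h z.1) (gam h' z.2) ^+ 2 + e)); last first.
  by apply/funext => z; rewrite !ha expand.
apply: hC => //.
  by near: n; exact: nbhs_infty_ger.
apply: le_trans (ltW ne); rewrite expr2 invfM ler_piMr ?invr_ge0 //.
by rewrite invf_le1 ?ltr0n // ler1n.
Unshelve. all: by end_near. Qed.

Lemma potential_mass_bound s r : 0 < r -> diam_le s r ->
  (forall g, g \in s -> g.1 <> g.2) ->
  exists2 C : R, 0 <= C & forall N u h, continuous u -> h \in s ->
    int01 (fun t => potential N r s u (gam h t) ^+ 2) <= C * bI s (fun x => u x ^+ 2).
Proof.
move=> r0 dm nd; have [C C0 hC] := sampled_mass_bound r0 dm nd.
exists C => // N u h cu hs.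
have [I [p [a [b [hp ab ha hb]]]]] := potential_expansion N r s cu.
pose F (k : I * I) (t : R) := p k.1 (gam h t) * p k.2 (gam h t).
have cF k : continuous (F k).
  by apply: continuous_mul; apply: continuous_on_gam; exact: polyfun_continuous.
have expand (c : I -> R) t :
    (\sum_i c i * p i (gam h t)) ^+ 2 = \sum_k c k.1 * c k.2 * F k t.
  rewrite expr2 mulr_suml -(pair_bigA _ (fun i j => c i * c j * F (i, j) t)) /=.
  apply: eq_bigr => i _; rewrite mulr_sumr; apply: eq_bigr => j _.
  by rewrite /F /=; ring.
have cvg1 : rsum n (fun z => \sum_k a n k.1 * a n k.2 * F k z) @[n --> \oo] -->
    int01 (fun z => \sum_k b k.1 * b k.2 * F k z).
  apply: (@rsum_moving _ _ (fun n k => a n k.1 * a n k.2) (fun k => b k.1 * b k.2) F cF) => k.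
  exact: cvgM (ab k.1) (ab k.2).
rewrite (_ : (fun t => _) = fun t => \sum_k b k.1 * b k.2 * F k t); last first.
  by apply/funext => t; rewrite !hb expand.
have cu2 := continuous_sqr cu.
have cvg2 : C * rI s n (fun x => u x ^+ 2) @[n --> \oo] --> C * bI s (fun x => u x ^+ 2).
  by apply: cvgM; [exact: cvg_cst|exact: rI_cvg].
apply: (ler_cvg_to cvg1 cvg2); near=> n.
rewrite (_ : (fun z => _) = fun t => sampled_potential N r s u n (gam h t) ^+ 2); last first.
  by apply/funext => z; rewrite !ha expand.
apply: hC => //.
  by near: n; exists 1%N.
by near: n; exact: nbhs_infty_ger.
Unshelve. all: by end_near. Qed.

Lemma bintE s (f : pt -> R) : continuous f -> bint s f = (bI s f)%:E.
Proof.
move=> cf; rewrite /bint /bI -sumEFin; apply: eq_bigr => g _.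
by rewrite int01E //; exact: continuous_on_gam.
Qed.

(** Monotone convergence along e = 1 / (k + 1). *)
Lemma gagliardo_le s (w : pt -> R) h h' (B : R) : continuous w ->
  (forall e, 0 < e -> int01_2 (fun p => (w (gam h p.1) - w (gam h' p.2)) ^+ 2
                     / (edist (gam h p.1) (gam h' p.2) ^+ 2 + e)) <= B) ->
  (\int[mu]_(t in `[0%R, 1%R]) \int[mu]_(t' in `[0%R, 1%R])
     ((w (gam h t) - w (gam h' t')) ^+ 2 / edist (gam h t) (gam h' t') ^+ 2)%:E <= B%:E)%E.
Proof.
move=> cw hB.
have e0 k : 0 < k.+1%:R^-1 :> R by rewrite invr_gt0.
have D0 k (x y : pt) : 0 < edist x y ^+ 2 + k.+1%:R^-1 by rewrite ltr_wpDl ?sqr_ge0.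
apply: (@int2_monotone_le _ (fun k p => (w (gam h p.1) - w (gam h' p.2)) ^+ 2
    / (edist (gam h p.1) (gam h' p.2) ^+ 2 + k.+1%:R^-1))
  (fun t t' => (w (gam h t) - w (gam h' t')) ^+ 2 / edist (gam h t) (gam h' t') ^+ 2)).
- by move=> k; exact: continuous_regularized.
- by move=> k p; rewrite divr_ge0 ?sqr_ge0 // ltW.
- move=> k p; rewrite ler_wpM2l ?sqr_ge0 // lef_pV2 ?posrE // lerD2l lef_pV2 ?posrE ?ltr0n //.
  by rewrite ler_nat.
(* At coinciding points the numerator vanishes, so the sequence and its limit, a quotient by 0, are
   both 0. *)
- move=> t t'; have [d0|d0] := eqVneq (edist (gam h t) (gam h' t')) 0.
    rewrite (_ : (fun k => _) = fun=> 0); last first.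
      by apply/funext => k; rewrite /= (edist_eq0 d0) subrr expr0n mul0r.
    by rewrite (edist_eq0 d0) subrr expr0n mul0r; exact: cvg_cst.
  apply: cvgM; first exact: cvg_cst.
  apply: cvgV; first by rewrite expf_neq0.
  rewrite -[X in _ --> X]addr0; apply: cvgD; first exact: cvg_cst.
  exact: cvg_harmonic.
- by move=> k; exact: hB.
Qed.

Lemma H12norm_potential_le s r : 0 < r -> diam_le s r ->
  (forall g, g \in s -> g.1 <> g.2) ->
  (forall g h, g \in s -> h \in s -> g <> h ->
     forall p q, seg_set g p -> seg_set h p -> seg_set g q -> seg_set h q -> p = q) ->
  exists2 C : R, 0 <= C & forall N u, continuous u ->
    (H12norm s (potential N r s u) <= (C * Num.sqrt (bI s (fun x => u x ^+ 2)))%:E)%E.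
Proof.
move=> r0 dm nd uq; have [C1 C10 hC1] := potential_energy_bound r0 dm nd uq.
have [C2 C20 hC2] := potential_mass_bound r0 dm nd.
pose K := (\sum_(h <- s) seg_len h) * C2 +
          \sum_(h <- s) \sum_(g <- s) seg_len h * seg_len g * C1.
have L0 h : 0 <= seg_len h by exact: edist_ge0.
have K0 : 0 <= K.
  rewrite addr_ge0 //; first by apply: mulr_ge0 => //; apply: sumr_ge0 => h _; exact: L0.
  by rewrite sumr_ge0 // => h _; rewrite sumr_ge0 // => g _; rewrite !mulr_ge0 ?L0.
exists (Num.sqrt K); first exact: sqrtr_ge0.
move=> N u cu; set U := bI s _; set w := potential N r s u.
have pw := potential_polyfun N r s cu; have cw := polyfun_continuous pw.
rewrite -sqrtrM // -[X in (_ <= X)%E]/(sqrte (K * U)%:E).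
have cw2 := continuous_sqr cw.
have U0 : 0 <= U.
  rewrite sumr_ge0 // => g _; rewrite mulr_ge0 ?L0 // -[leLHS](int01_cst 0); apply: le_int01.
  - by move=> ?; exact: cvg_cst.
  - by apply: (@continuous_on_gam _ (fun x => u x ^+ 2)); exact: continuous_sqr.
  - by move=> t _; exact: sqr_ge0.
rewrite /H12norm lee_sqrt ?lee_fin ?mulr_ge0 // bintE // mulrDl EFinD; apply: leeD.
  rewrite lee_fin -mulrA mulr_suml /bI !big_seq; apply: ler_sum => h hs.
  by apply: ler_wpM2l; [exact: L0|exact: hC2].
rewrite mulr_suml -sumEFin /bint2 !big_seq; apply: lee_sum => h hs.
rewrite mulr_suml -sumEFin !big_seq; apply: lee_sum => g gs.
rewrite -mulrA EFinM EFinM; apply: lee_wpmul2l; first by rewrite mule_ge0 ?lee_fin ?L0.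
apply: gagliardo_le => // e e0; exact: hC1.
Qed.

End PotentialNorm.

(** * Limit of the truncated Riesz forms *)

Section RieszLimit.
Local Open Scope classical_set_scope.
Variable R : realType.
Notation pt := (R * R)%type.
Notation mu := (@lebesgue_measure R).
Implicit Types (s : seq (segment R)) (u v : pt -> R) (N n : nat) (r : R).

Lemma pkernel_sym N r (x y : pt) : pkernel N r x y = pkernel N r y x.
Proof. by rewrite /pkernel -(sqrrN (x.1 - _)) -(sqrrN (x.2 - _)) !opprB. Qed.

(** Uniformity in N provides the constant majorant of [outer_limit]. The lower bound on n depends on
    N but disappears as n -> oo. *)
Lemma pkernel_int_bound s r : 0 < r -> diam_le s r -> (forall g, g \in s -> g.1 <> g.2) ->
  forall g, g \in s -> exists2 C : R, 0 <= C & forall N h t, h \in s -> 0 <= t <= 1 ->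
    int01 (fun t' => pkernel N r (gam h t) (gam g t')) <= C.
Proof.
move=> r0 dm nd g gs; have [C C0 hC] := kernel_row_bound (ler0n R 4) (nd _ gs).
exists C => // N h t hs t01.
have [I [p [q [hp hq hK]]]] := separable_pkernel N r.
have cK : continuous (fun t' => pkernel N r (gam h t) (gam g t')).
  rewrite (_ : (fun t' => _) = fun t' => \sum_i p i (gam h t) * q i (gam g t')).
    apply: continuous_sum => i; apply: continuous_scale; apply: continuous_on_gam.
    exact: polyfun_continuous.
  by apply/funext => t'; rewrite hK.
apply: (cvgr_to_le (rsum_cvg cK)); near=> n.
have n0 : (0 < n)%N by near: n; exists 1%N.
have kn : bker N r 0 ^+ 2 <= n%:R by near: n; exact: nbhs_infty_ger.
have nr : (0 : R) < n%:R by rewrite ltr0n.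
have := hC n _ (gam h t) n0 (bker_kernel_class r0 n0 kn).
have i0 : 0 <= n%:R^-1 * Num.sqrt n%:R :> R by rewrite mulr_ge0 ?invr_ge0 ?sqrtr_ge0.
move=> /(ler_wpM2l i0).
have -> : n%:R^-1 * Num.sqrt n%:R * (C * Num.sqrt n%:R) = C.
  by rewrite mulrACA -expr2 mulrAC sqr_sqrtr ?(ltW nr) // mulVf ?mul1r ?gt_eqF // mulrC.
move=> /(le_trans _); apply; rewrite /rsum -mulrA ler_wpM2l ?invr_ge0 ?(ltW nr) //.
rewrite mulr_sumr; apply: ler_sum => j _.
by rewrite (pkernel_scaled N dm gs hs t01 (sample_itv R (ltn_ord j)) n0).
Unshelve. all: by end_near. Qed.

Lemma pkernel_le N r (x y : pt) : 0 < r -> 0 < edist x y -> edist x y <= r ^+ 2 ->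
  0 <= pkernel N r x y <= isq (edist x y).
Proof. by move=> r0 d0 dr; rewrite pkernelE // bker_ge0 ?edist_ge0 // bker_le. Qed.

Lemma pkernel_cvg r (x y : pt) : 0 < r -> 0 < edist x y -> edist x y <= r ^+ 2 ->
  pkernel N r x y @[N --> \oo] --> isq (edist x y).
Proof.
move=> r0 d0 dr; set z := edist x y in d0 dr *.
pose t := 1 - z ^+ 2 / r ^+ 4.
have t01 : 0 <= t < 1.
  have /andP[-> _] := bker_arg r0 (ltW d0) dr; rewrite /= gtrBl.
  by rewrite divr_gt0 ?exprn_gt0.
apply: (@squeeze_cvgr _ _ _ _ (fun N => isq z * (1 - t ^+ N.+1)) (fun=> isq z)).
- apply: nearW => N; rewrite pkernelE // bker_le // andbT.
  exact: bker_ge.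
- rewrite -[X in _ --> X]mulr1 -[X in _ * X]subr0; apply: cvgM; first exact: cvg_cst.
  apply: cvgB; first exact: cvg_cst.
  move: t01 => /andP[t0 t1].
  have h : t ^+ n @[n --> \oo] --> 0 by apply: cvg_expr; rewrite ger0_norm.
  by move: h; rewrite -cvg_shiftS.
- exact: cvg_cst.
Qed.

(* Unlike shifting the argument of [isq], this increases to [isq z] also at [z = 0], where
   [isq 0 = 0] by convention. *)
Definition soft_isq (k : nat) (z : R) : R := Num.sqrt z / (z + k.+1%:R^-1).

Lemma soft_isq_cvg z : 0 <= z -> soft_isq k z @[k --> \oo] --> isq z.
Proof.
rewrite le_eqVlt => /orP[/eqP <-|z0].
  rewrite /isq /soft_isq sqrtr0 invr0; under eq_fun do rewrite mul0r; exact: cvg_cst.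
have -> : isq z = Num.sqrt z / (z + 0).
  by rewrite addr0 -[X in _ = _ / X](@sqr_sqrtr _ z) ?(ltW z0) // expr2 invfM mulrA divff ?mul1r // gt_eqF // sqrtr_gt0.
apply: cvgM; first exact: cvg_cst.
apply: cvgV; first by rewrite addr0 gt_eqF.
by apply: cvgD; [exact: cvg_cst|exact: cvg_harmonic].
Qed.

(** The singular integral is the increasing limit of integrals of [soft_isq], whose Riemann sums are
    dominated by the discrete row sums. It makes the majorant of [inner_limit] integrable. *)
Lemma isq_dist_integral g : g.1 <> g.2 -> exists2 C : R, 0 <= C & forall x : pt,
  [/\ measurable_fun (`[(0 : R), (1 : R)] : set R) (fun t => isq (edist x (gam g t))) &
  (\int[mu]_(t in `[0%R, 1%R]) (isq (edist x (gam g t)))%:E <= C%:E)%E].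
Proof.
move=> gn; have [C C0 hC] := row_sum_bound gn.
exists (2 * C); first by rewrite mulr_ge0.
move=> x; pose F k t := soft_isq k (edist x (gam g t)).
have e0 k : 0 < k.+1%:R^-1 :> R by rewrite invr_gt0.
have ce : continuous (fun t => edist x (gam g t)).
  by apply: continuous_edist; [move=> ?; exact: cvg_cst|exact: continuous_gam].
have cF k : continuous (F k).
  apply: continuous_quotient.
  - move=> t; apply: (@continuous_comp _ _ _ (fun t => edist x (gam g t)) (@Num.sqrt R)); [exact: ce|exact: sqrt_continuous].
  - by apply: continuous_add => //; move=> ?; exact: cvg_cst.
  - by move=> t; rewrite gt_eqF // ltr_wpDl ?edist_ge0.
have F0 k t : 0 <= F k t by rewrite divr_ge0 ?sqrtr_ge0 // addr_ge0 ?edist_ge0 // ltW.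
have Fnd k t : F k t <= F k.+1 t.
  rewrite /F /soft_isq ler_wpM2l ?sqrtr_ge0 // lef_pV2 ?posrE ?ltr_wpDl ?edist_ge0 //.
  by rewrite lerD2l lef_pV2 ?posrE ?ltr0n // ler_nat.
have Fc t : F k t @[k --> \oo] --> isq (edist x (gam g t)).
  by apply: soft_isq_cvg; exact: edist_ge0.
split.
  apply: (@measurable_fun_cvg _ _ _ _ F) => [k|t _]; first exact: measurable_continuous.
  exact: Fc.
have := cvg_int01 cF F0 Fnd Fc => cvgF.
apply: (cvge_to_le cvgF); apply: nearW => k; rewrite lee_fin.
apply: (cvgr_to_le (rsum_cvg (cF k))); near=> n.
have [n0 nk] : (0 < n)%N /\ n%:R^-1 < k.+1%:R^-1 :> R by near: n; exact: near_invn.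
have nr : (0 : R) < n%:R by rewrite ltr0n.
have hx := hC n x n0.
(* As 1/n < 1 / (k + 1), the soft kernel at distance z is at most 2 (z + 1/n)^(-1/2) = 2 sqrt n isq
   (1 + n z). *)
apply: (@le_trans _ _ (n%:R^-1 * \sum_(j < n) 2 * (Num.sqrt n%:R *
   isq (1 + n%:R * edist x (sample g n j))))).
  rewrite /rsum ler_wpM2l ?invr_ge0 ?(ltW nr) //; apply: ler_sum => j _.
  rewrite -/(sample g n j) /F /soft_isq; set z := edist _ _; set d := k.+1%:R^-1 in nk *.
  have z0 : 0 <= z by exact: edist_ge0.
  have d0 : 0 < d by exact: e0.
  have i0 : 0 <= isq (1 + n%:R * z) by exact: isq_ge0.
  have nz : 0 < 1 + n%:R * z by rewrite ltr_wpDr // mulr_ge0 // ltW.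
  rewrite ler_pdivrMr; last by lra.
  rewrite -ler_sqr ?nnegrE ?sqrtr_ge0 //; last by rewrite !mulr_ge0 ?sqrtr_ge0 //; lra.
  rewrite !exprMn isq_sqr ?(ltW nz) // !sqr_sqrtr ?(ltW nr) //.
  rewrite -(ler_pM2r nz).
  have -> : 2 ^+ 2 * (n%:R * (1 + n%:R * z)^-1) * (z + d) ^+ 2 * (1 + n%:R * z) =
     4 * n%:R * (z + d) ^+ 2 by field; rewrite gt_eqF.
  have nd1 : 1 <= n%:R * d by rewrite -ler_pdivrMl // mulr1 ltW.
  have : z * 1 <= z * (n%:R * d) by rewrite ler_wpM2l.
  have : 0 <= n%:R * (z * z) by rewrite !mulr_ge0 // ltW.
  have : 0 <= n%:R * (z * d) by rewrite !mulr_ge0 // ltW.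
  have : 0 <= n%:R * (d * d) by rewrite !mulr_ge0 // ltW.
  by lra.
rewrite -!mulr_sumr.
have i0 : 0 <= n%:R^-1 * 2 * Num.sqrt n%:R :> R by rewrite !mulr_ge0 ?invr_ge0 ?sqrtr_ge0.
have := ler_wpM2l i0 hx.
have -> : n%:R^-1 * 2 * Num.sqrt n%:R * (C * Num.sqrt n%:R) = 2 * C :> R.
  have -> : n%:R^-1 * 2 * Num.sqrt n%:R * (C * Num.sqrt n%:R) =
     n%:R^-1 * Num.sqrt n%:R ^+ 2 * (2 * C) by ring.
  by rewrite sqr_sqrtr ?(ltW nr) // mulVf ?mul1r // gt_eqF.
by rewrite !mulrA.
Unshelve. all: by end_near. Qed.

Lemma continuous_bounded (f : R -> R) : continuous f ->
  exists2 M : R, 0 <= M & forall t, 0 <= t <= 1 -> `|f t| <= M.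
Proof.
move=> cf; have cn : continuous (fun t => `|f t|).
  by move=> t; apply: cvg_norm; exact: cf.
have [c _ hc] := @EVT_max R (fun t => `|f t|) 0 1 ler01 (continuous_subspaceT cn).
by exists `|f c| => // t t01; apply: hc; rewrite in_itv.
Qed.

Lemma inner_limit s r g (x : pt) (f : R -> R) : 0 < r -> g.1 <> g.2 ->
  (forall t, 0 <= t <= 1 -> edist x (gam g t) <= r ^+ 2) -> continuous f ->
  (forall N, continuous (fun t => pkernel N r x (gam g t))) ->
  (int01 (fun t => f t * pkernel N r x (gam g t)))%:E @[N --> \oo] -->
  (\int[mu]_(t in `[0%R, 1%R]) (f t / Num.sqrt (edist x (gam g t)))%:E)%E.
Proof.
move=> r0 gn dr cf cK; have [M M0 hM] := continuous_bounded cf.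
have [C C0 /(_ x)[mI hI]] := isq_dist_integral gn.
(* [x] lies on the segment at most at the parameter [p]. If it does, the polynomials tend to
   infinity there while the quotient by 0 is 0, so convergence is claimed only off this null set. *)
have [p hp] := edist_proj x gn; have L0 := seg_len_gt0 gn.
have dpos t : t <> p -> 0 < edist x (gam g t).
  move=> tp; apply: lt_le_trans (hp t); rewrite mulr_gt0 // normr_gt0 subr_eq0.
  exact/eqP.
have fin : mu.-integrable `[0%R, 1%R] (fun t => (M * isq (edist x (gam g t)))%:E).
  rewrite (_ : (fun t => _) = fun t => (M%:E * (isq (edist x (gam g t)))%:E)%E); last first.
    by apply/funext => t; rewrite EFinM.
  apply: integrableZl => //; apply/integrableP; split; first exact/measurable_EFinP.
  apply: le_lt_trans (ltry C); apply: le_trans hI.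
  rewrite le_eqVlt; apply/orP; left; apply/eqP; apply: eq_integral => t _.
  by rewrite /= ger0_norm // isq_ge0.
have ae (P : R -> Prop) : (forall t, 0 <= t <= 1 -> t <> p -> P t) ->
    {ae mu, forall t, `[0%R, 1%R]%classic t -> P t}.
  move=> hP; exists [set p]; split; [exact: measurable_set1|exact: lebesgue_measure_set1|].
  move=> t /= h; apply: contrapT => tp; apply: h; rewrite in_itv /= => t01; exact: hP.
have ae2 (P : R -> nat -> Prop) : (forall t N, 0 <= t <= 1 -> t <> p -> P t N) ->
    {ae mu, forall t N, `[0%R, 1%R]%classic t -> P t N}.
  move=> hP; exists [set p]; split; [exact: measurable_set1|exact: lebesgue_measure_set1|].
  move=> t /= h; apply: contrapT => tp; apply: h => N; rewrite in_itv /= => t01; exact: hP.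
have mf : measurable_fun (`[(0 : R), (1 : R)] : set R)
    (fun t => f t / Num.sqrt (edist x (gam g t))).
  by apply: measurable_funM => //; exact: measurable_continuous.
have cfK N : continuous (fun t => f t * pkernel N r x (gam g t)) by exact: continuous_mul.
have [|||||_ _] := @dominated_convergence _ _ _ mu `[0%R, 1%R] (measurable_itv _)
  (fun N t => (f t * pkernel N r x (gam g t))%:E)
  (fun t => (f t / Num.sqrt (edist x (gam g t)))%:E)
  (fun t => (M * isq (edist x (gam g t)))%:E).
- by move=> N; apply/measurable_EFinP; exact: measurable_continuous.
- exact/measurable_EFinP.
- apply: ae => t t01 tp; apply: cvg_EFin; first exact: nearW.
  by apply: cvgM; [exact: cvg_cst|apply: pkernel_cvg => //; [exact: dpos|exact: dr]].
- exact: fin.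
- apply: ae2 => t N t01 tp; rewrite /= lee_fin normrM.
  have /andP[k0 k1] := pkernel_le N r0 (dpos t tp) (dr t t01).
  by apply: ler_pM => //; [exact: hM|rewrite ger0_norm].
rewrite (_ : (fun N => _) = fun N => (int01 (fun t => f t * pkernel N r x (gam g t)))%:E) //.
by apply/funext => N; rewrite /= int01E.
Qed.

Lemma int01_abs_le (F K : R -> R) (M : R) : continuous F -> continuous K ->
  (forall t, 0 <= t <= 1 -> `|F t| <= M * K t) -> `|int01 F| <= M * int01 K.
Proof.
move=> cF cK hF; have cMK : continuous (fun t => M * K t) by exact: continuous_scale.
have cNF : continuous (fun t => -1 * F t) by exact: continuous_scale.
have h1 : int01 F <= M * int01 K.
  rewrite -int01Z //; apply: le_int01 => // t t01.
  by apply: le_trans (hF t t01); exact: ler_norm.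
have h2 : - int01 F <= M * int01 K.
  rewrite -mulN1r -!int01Z //; apply: le_int01 => // t t01.
  by rewrite mulN1r; apply: le_trans (hF t t01); rewrite -normrN ler_norm.
by rewrite ler_norml h1 andbT lerNl.
Qed.

Definition riesz_slice N r h g u v (p : R * R) : R :=
  u (gam h p.1) * v (gam g p.2) * pkernel N r (gam h p.1) (gam g p.2).

Lemma continuous_riesz_slice N r h g u v : continuous u -> continuous v ->
  continuous (riesz_slice N r h g u v).
Proof.
move=> cu cv; have [I [p [q [hp hq hK]]]] := separable_pkernel N r.
have cp i := polyfun_continuous (hp i); have cq i := polyfun_continuous (hq i).
rewrite (_ : riesz_slice N r h g u v = fun z => u (gam h z.1) * v (gam g z.2) *
   \sum_i p i (gam h z.1) * q i (gam g z.2)).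
  apply: continuous_mul.
    by apply: continuous_mul; [exact: continuous_on_gam1|exact: continuous_on_gam2].
  apply: continuous_sum => i.
  by apply: continuous_mul; [exact: continuous_on_gam1|exact: continuous_on_gam2].
by apply/funext => z; rewrite /riesz_slice hK.
Qed.

Lemma continuous_pkernel_gam N r (x : pt) g : continuous (fun t => pkernel N r x (gam g t)).
Proof.
have [I [p [q [hp hq hK]]]] := separable_pkernel N r.
rewrite (_ : (fun t => _) = fun t => \sum_i p i x * q i (gam g t)).
  apply: continuous_sum => i; apply: continuous_scale; apply: continuous_on_gam.
  exact: polyfun_continuous.
by apply/funext => t; rewrite hK.
Qed.

(** Dominated convergence also yields the integrability of the limit, so that its integral is a real
    [rho]. *)
Lemma outer_limit s r h g u v : 0 < r -> diam_le s r -> (forall g, g \in s -> g.1 <> g.2) ->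
  h \in s -> g \in s -> continuous u -> continuous v ->
  exists rho : R,
    (\int[mu]_(t in `[0%R, 1%R]) \int[mu]_(t' in `[0%R, 1%R])
      (u (gam h t) * v (gam g t') / Num.sqrt (edist (gam h t) (gam g t')))%:E = rho%:E)%E /\
    int01_2 (riesz_slice N r h g u v) @[N --> \oo] --> rho.
Proof.
move=> r0 dm nd hs gs cu cv.
have [Mu Mu0 hMu] := continuous_bounded (continuous_on_gam (g := h) cu).
have [Mv Mv0 hMv] := continuous_bounded (continuous_on_gam (g := g) cv).
have [C C0 hC] := pkernel_int_bound r0 dm nd gs.
pose f N (t : R) := int01 (fun t' => riesz_slice N r h g u v (t, t')).
pose f0 (t : R) : \bar R := (\int[mu]_(t' in `[0%R, 1%R])
   (u (gam h t) * v (gam g t') / Num.sqrt (edist (gam h t) (gam g t')))%:E)%E.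
have cS N : continuous (riesz_slice N r h g u v) by exact: continuous_riesz_slice.
have cf N : continuous (f N) by exact: continuous_int01_slice.
have ff0 t : 0 <= t <= 1 -> (f N t)%:E @[N --> \oo] --> f0 t.
  move=> t01; apply: (@inner_limit s r g (gam h t) (fun t' => u (gam h t) * v (gam g t'))) => //.
  - exact: nd.
  - by move=> t' t'01; exact: dm.
  - by apply: continuous_scale; exact: continuous_on_gam.
  - by move=> N; exact: continuous_pkernel_gam.
have mfN N : measurable_fun (`[(0 : R), (1 : R)] : set R) (EFin \o f N).
  by apply/measurable_EFinP; exact: measurable_continuous.
have [||||| if0 _ cvgf] := @dominated_convergence _ _ _ mu `[0%R, 1%R] (measurable_itv _)
  (fun N t => (f N t)%:E) f0 (fun=> (Mu * Mv * C)%:E).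
- exact: mfN.
- apply: (@emeasurable_fun_cvg _ _ _ _ (fun N t => (f N t)%:E)) => [N|t]; first exact: mfN.
  by rewrite /= in_itv; exact: ff0.
- by apply: aeW => t; rewrite /= in_itv; exact: ff0.
- exact: (@continuous_integrable _ (fun=> Mu * Mv * C) 0 1 (fun x => cvg_cst _)).
- apply: aeW => t N; rewrite /= in_itv /= => t01; rewrite lee_fin.
  apply: (@le_trans _ _ (Mu * Mv * int01 (fun t' => pkernel N r (gam h t) (gam g t')))).
    apply: int01_abs_le; [exact: continuous_slice|exact: continuous_pkernel_gam|].
    move=> t' t'01; rewrite /riesz_slice /= normrM.
    have k0 : 0 <= pkernel N r (gam h t) (gam g t').
      by rewrite pkernelE ?bker_ge0 ?edist_ge0 // dm.
    rewrite (ger0_norm k0) ler_wpM2r // normrM.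
    by apply: ler_pM => //; [exact: hMu|exact: hMv].
  by rewrite ler_wpM2l ?mulr_ge0 // hC.
have fin : (\int[mu]_(t in `[0%R, 1%R]) f0 t)%E \is a fin_num by exact: integrable_fin_num.
rewrite -(fineK fin) in cvgf.
exists (fine (\int[mu]_(t in `[0%R, 1%R]) f0 t)%E); rewrite fineK //; split => //.
move/fine_cvg: cvgf.
rewrite (_ : _ \o _ = fun N => int01_2 (riesz_slice N r h g u v)) //.
Qed.

(** The form has [u] in the outer variable and the pairing has it in the inner one; [int01_2_swap]
    exchanges them while the kernel is still continuous. *)
Lemma riesz_limit s r u v : 0 < r -> diam_le s r -> (forall g, g \in s -> g.1 <> g.2) ->
  continuous u -> continuous v ->
  exists2 rho : R, riesz_form s u v = rho%:E &
    bI s (fun x => v x * potential N r s u x) @[N --> \oo] --> rho.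
Proof.
move=> r0 dm nd cu cv.
have step N : bI s (fun x => v x * potential N r s u x) =
   \sum_(h <- s) \sum_(g <- s) seg_len h * seg_len g * int01_2 (riesz_slice N r h g u v).
  rewrite exchange_big /=; apply: eq_bigr => g _.
  under [RHS]eq_bigr => h _ do rewrite mulrAC mulrC.
  rewrite -mulr_sumr; congr (_ * _).
  rewrite (_ : (fun t => _) = fun t => \sum_(h <- s) seg_len h *
     int01 (fun t' => riesz_slice N r h g u v (t', t))); last first.
    apply/funext => t; rewrite /potential /bI mulr_sumr; apply: eq_bigr => h _.
    rewrite mulrCA; congr (_ * _); rewrite -int01Z.
      congr int01; apply/funext => t'; rewrite /riesz_slice /= pkernel_sym; ring.
    apply: continuous_mul; first exact: continuous_pkernel_gam.
    exact: continuous_on_gam.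
  have cS h : continuous (fun p : R * R => riesz_slice N r h g u v (p.2, p.1)).
    move=> p; apply: (@continuous_comp _ _ _ (fun p : R * R => (p.2, p.1)) (riesz_slice N r h g u v)).
      have h1 : snd x @[x --> p] --> p.2 by exact: cvg_snd.
      have h2 : fst x @[x --> p] --> p.1 by exact: cvg_fst.
      exact: cvg_pair h1 h2.
    exact: continuous_riesz_slice.
  rewrite int01_lin; last by move=> h; exact: (continuous_int01_slice (cS h)).
  apply: eq_bigr => h _; congr (_ * _).
  by apply: (@int01_2_swap _ (riesz_slice N r h g u v)); exact: continuous_riesz_slice.
pose J h g : \bar R := (\int[mu]_(t in `[0%R, 1%R]) \int[mu]_(t' in `[0%R, 1%R])
      (u (gam h t) * v (gam g t') / Num.sqrt (edist (gam h t) (gam g t')))%:E)%E.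
have J1 h g : h \in s -> g \in s -> J h g = (fine (J h g))%:E /\
    int01_2 (riesz_slice N r h g u v) @[N --> \oo] --> fine (J h g).
  move=> hs gs; have [rho [e c]] := outer_limit r0 dm nd hs gs cu cv.
  by rewrite /J e.
have cvg_big (P : segment R -> nat -> R) (l : segment R -> R) :
    (forall g, g \in s -> P g N @[N --> \oo] --> l g) ->
    \sum_(g <- s) P g N @[N --> \oo] --> \sum_(g <- s) l g.
  move=> HP; rewrite big_seq (_ : (fun N => _) = fun N => \sum_(g <- s) (if g \in s then P g N else 0)).
    rewrite big_mkcond; apply: cvg_fin_sum => g; case: ifP => gs; [exact: HP|exact: cvg_cst].
  by apply/funext => N; rewrite big_seq big_mkcond.
exists (\sum_(h <- s) \sum_(g <- s) seg_len h * seg_len g * fine (J h g)).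
  rewrite /riesz_form /bint2 -sumEFin !big_seq; apply: eq_bigr => h hs.
  rewrite -sumEFin !big_seq; apply: eq_bigr => g gs.
  rewrite [RHS]EFinM [in RHS]EFinM; congr (_ * _)%E.
  transitivity (J h g); last exact: (J1 h g hs gs).1.
  apply: eq_integral => t _; apply: eq_integral => t' _.
  by rewrite (edistC (gam g t')).
rewrite (_ : (fun N => _) = fun N => \sum_(h <- s) \sum_(g <- s)
   seg_len h * seg_len g * int01_2 (riesz_slice N r h g u v)); last exact/funext.
apply: (cvg_big
  (fun h N => \sum_(g <- s) seg_len h * seg_len g * int01_2 (riesz_slice N r h g u v))
  (fun h => \sum_(g <- s) seg_len h * seg_len g * fine (J h g))) => h hs.
apply: (cvg_big (fun g N => seg_len h * seg_len g * int01_2 (riesz_slice N r h g u v))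
  (fun g => seg_len h * seg_len g * fine (J h g))) => g gs.
apply: (@cvgM _ _ _ _ (fun=> seg_len h * seg_len g)
  (fun N => int01_2 (riesz_slice N r h g u v))); [exact: cvg_cst|exact: (J1 h g hs gs).2].
Qed.

End RieszLimit.

(** * Duality and conclusion *)

Section Duality.
Local Open Scope classical_set_scope.
Variable R : realType.
Notation pt := (R * R)%type.
Notation mu := (@lebesgue_measure R).
Implicit Types (s : seq (segment R)) (u v w : pt -> R).

Lemma smooth_continuous u : smooth u -> continuous u.
Proof. by move=> /(_ 0%N). Qed.

Lemma int01_gt0 (f : R -> R) (t0 : R) : continuous f -> (forall t, 0 <= f t) ->
  0 <= t0 <= 1 -> 0 < f t0 -> 0 < int01 f.
Proof.
move=> cf f0 /andP[t00 t01] ft0; pose c := f t0 / 2.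
have c0 : 0 < c by rewrite divr_gt0.
have /nbhs_ballP[d /= d0 hd] : \forall t \near t0, `|f t0 - f t| < c.
  by have /cvgr_dist_lt := cf t0; apply.
pose a := Num.max 0 (t0 - d / 2); pose b := Num.min 1 (t0 + d / 2).
have d2 : 0 < d / 2 by rewrite divr_gt0.
have ab : a < b by rewrite gt_max !lt_min; apply/andP; split; apply/andP; split; lra.
have a0 : 0 <= a by rewrite le_max lexx.
have b1 : b <= 1 by rewrite ge_min lexx.
have fc t : a <= t -> t <= b -> c <= f t.
  rewrite ge_max le_min => /andP[_ h1] /andP[_ h2].
  have : ball t0 d t by rewrite /ball /= ltr_norml; lra.
  by move/hd; rewrite ltr_norml /c => /andP[]; lra.
rewrite -lte_fin -int01E //.
apply: (@lt_le_trans _ _ (\int[mu]_(t in `[a, b]) c%:E)%E).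
  rewrite integral_cst //= lebesgue_measure_itv /= lte_fin ab -EFinB -EFinM lte_fin.
  by rewrite mulr_gt0 // subr_gt0.
apply: (@le_trans _ _ (\int[mu]_(t in `[a, b]) (f t)%:E)%E).
  apply: ge0_le_integral => //.
  - by move=> t _; rewrite lee_fin ltW.
  - by apply/measurable_EFinP; exact: measurable_continuous.
  - by move=> t; rewrite /= in_itv /= => /andP[h1 h2]; rewrite lee_fin fc.
apply: ge0_subset_integral => //.
- by apply/measurable_EFinP; exact: measurable_continuous.
- by move=> t _; rewrite lee_fin.
- by move=> t; rewrite /= !in_itv /= => /andP[h1 h2]; apply/andP; split; lra.
Qed.

Lemma bdry_gam (O : set pt) s g t : boundary_decomp O s -> g \in s -> 0 <= t <= 1 ->
  bdry O (gam g t).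
Proof. by move=> [-> _ _ _] gs t01; exists g => //; exists t => //; rewrite /= in_itv. Qed.

(** Every boundary point lies on a nondegenerate segment, along which continuity spreads a nonzero
    value. This makes [L2norm] positive for the admissible [u]. *)
Lemma bI_sqr_gt0 (O : set pt) s u : boundary_decomp O s -> continuous u -> nonzero_on O u ->
  0 < bI s (fun x => u x ^+ 2).
Proof.
move=> [bO _ nd _] cu [x]; rewrite bO => -[g /= gs [t t01 <-]] ux; move: t01; rewrite /= in_itv /= => t01.
have cu2 h := continuous_on_gam (g := h) (continuous_sqr cu).
have u2 h (a : R) : 0 <= u (gam h a) ^+ 2 by exact: sqr_ge0.
have I0 h : 0 <= seg_len h * int01 (fun t => u (gam h t) ^+ 2).
  rewrite mulr_ge0 ?edist_ge0 // -[leLHS](int01_cst 0); apply: le_int01 => //.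
  by move=> ?; exact: cvg_cst.
rewrite /bI (big_rem g) //= ltr_pwDl //; last by rewrite sumr_ge0.
rewrite mulr_gt0 //; first exact: (seg_len_gt0 (nd _ gs)).
apply: (@int01_gt0 _ t) => //; rewrite exprn_even_gt0 //=; exact/eqP.
Qed.

Lemma bI_bdry0 (O : set pt) s w : boundary_decomp O s -> continuous w ->
  (forall x, bdry O x -> w x = 0) -> bI s w = 0.
Proof.
move=> bd cw w0; rewrite /bI big_seq big1 // => g gs.
suff : `|int01 (fun t => w (gam g t))| <= 0 * int01 (fun t => w (gam g t)).
  by rewrite mul0r normr_le0 => /eqP ->; rewrite mulr0.
apply: int01_abs_le; try exact: continuous_on_gam.
by move=> t t01; rewrite w0 ?normr0 ?mul0r //; exact: bdry_gam bd gs t01.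
Qed.

Lemma Hm12norm_ge0 (O : set pt) s v : smooth v -> nonzero_on O v -> (0 <= Hm12norm O s v)%E.
Proof.
move=> sv nv.
have h : [set (`|bpair s v w|%E / H12norm s w)%E | w in [set w | smooth w /\ nonzero_on O w]]
    (`|bpair s v v|%E / H12norm s v)%E by exists v.
apply: le_trans (ereal_sup_ubound h); rewrite mule_ge0 ?abse_ge0 // inve_ge0.
exact: sqrte_ge0.
Qed.

(** A function [w] that vanishes on the boundary is not among the test functions of [Hm12norm], but
    then the pairing is 0. *)
Lemma pairing_le (O : set pt) s v w (B h : R) : boundary_decomp O s ->
  smooth v -> smooth w -> 0 < B -> 0 <= h -> (H12norm s w <= B%:E)%E ->
  Hm12norm O s v = h%:E -> `|bI s (fun x => v x * w x)| <= B * h.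
Proof.
move=> bd sv sw B0 h0 wB vh.
have cv := smooth_continuous sv; have cw := smooth_continuous sw.
have cvw : continuous (fun x => v x * w x) by exact: continuous_mul.
have [nw|nw] := pselect (nonzero_on O w); last first.
  rewrite (bI_bdry0 bd cvw) ?normr0 ?mulr_ge0 ?(ltW B0) // => x bx.
  suff -> : w x = 0 by rewrite mulr0.
  by apply: contrapT => wx; apply: nw; exists x.
have : (`|bpair s v w|%E / H12norm s w <= h%:E)%E.
  by rewrite -vh; apply: ereal_sup_ubound; exists w.
have i1 : (B%:E^-1 <= (H12norm s w)^-1)%E.
  by rewrite lee_pV2 // inE ?sqrte_ge0 // lee_fin ltW.
move=> /(le_trans (lee_wpmul2l (abse_ge0 _) i1)).
rewrite /bpair bintE // inver gt_eqF //= -EFinM lee_fin.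
by rewrite ler_pdivrMr // mulrC.
Qed.

Lemma riesz_form_le (O : set pt) s : boundary_decomp O s ->
  exists2 C : R, 0 < C & forall u v, smooth u -> nonzero_on O u -> smooth v -> nonzero_on O v ->
    (`|riesz_form s u v| / (L2norm s u * Hm12norm O s v) <= C%:E)%E.
Proof.
move=> bd; have [_ _ nd uq] := bd.
have [r r0 dm] := diam_exists s.
have [C C0 hC] := H12norm_potential_le r0 dm nd uq.
(* One is added so that [B] below is positive, as [pairing_le] requires. *)
exists (C + 1); first by rewrite ltr_wpDl.
move=> u v su nu sv nv; have cu := smooth_continuous su; have cv := smooth_continuous sv.
have U0 := bI_sqr_gt0 bd cu nu; set U := bI s (fun x => u x ^+ 2) in U0.
have sU0 : 0 < Num.sqrt U by rewrite sqrtr_gt0.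
have -> : L2norm s u = (Num.sqrt U)%:E by rewrite /L2norm bintE //; exact: continuous_sqr.
have [rho -> lim] := riesz_limit r0 dm nd cu cv.
have C1 : 0 <= C + 1 by rewrite addr_ge0.
have := Hm12norm_ge0 s sv nv.
case E : (Hm12norm O s v) => [h||] //; last first.
  (* An infinite dual norm has inverse 0. *)
  by move=> _; rewrite gt0_muley ?lte_fin // invey mule0 lee_fin.
rewrite lee_fin => h0.
pose B := (C + 1) * Num.sqrt U.
have B0 : 0 < B by rewrite mulr_gt0 // ltr_wpDl.
have rB : `|rho| <= B * h.
  apply: (cvgr_to_le (cvg_norm lim)); apply: nearW => N.
  apply: pairing_le E => //; first by apply: polyfun_smooth; exact: potential_polyfun.
  apply: le_trans (hC N u cu) _; rewrite lee_fin -/U ler_wpM2r ?(ltW sU0) //.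
  by rewrite lerDl.
(* A dual norm 0 makes the inverse +oo, but [rB] then forces rho = 0, and the product of 0 and +oo
   is 0. *)
rewrite -EFinM inver; case: ifPn => [/eqP Uh|Uh].
  have h00 : h = 0 by apply/eqP; move/eqP: Uh; rewrite mulf_eq0 gt_eqF.
  move: rB; rewrite h00 mulr0 normr_le0 => /eqP ->.
  by rewrite abse0 mul0e lee_fin.
have Uh0 : 0 < Num.sqrt U * h by rewrite lt_def Uh mulr_ge0 // ltW.
by rewrite -EFinM lee_fin ler_pdivrMr // mulrA.
Qed.

End Duality.

Local Open Scope classical_set_scope.
Local Open Scope ereal_scope.

Theorem theorem1 (R : realType) (O : set (R * R)) (s : seq (segment R)) :
  polygonal_domain O s ->
  ereal_sup [set abse (riesz_form s uv.1 uv.2) / (L2norm s uv.1 * Hm12norm O s uv.2) |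
             uv in [set uv : (R * R -> R) * (R * R -> R) |
                      [/\ smooth uv.1, nonzero_on O uv.1,
                          smooth uv.2 & nonzero_on O uv.2]]] < +oo.
Proof.
move=> [_ _ _ bd]; have [C _ hC] := riesz_form_le bd.
apply: (@le_lt_trans _ _ C%:E); last exact: ltry.
by apply: ge_ereal_sup => _ [[u v] /= [su nu sv nv] <-]; exact: hC.
Qed.
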